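(* Fix $\kappa,\rho\in(0,+\infty)$. For $n=1,2,\dots$ let $m(n)\in\mathbb{N}$ and let $\mathbf{X}_n$ be a random element of $\mathcal{A}_n^{m(n)}$ with distribution, for all $B\in\mathcal{A}_n^{m}$ with $m=m(n)$, $$\mathbf{P}(\mathbf{X}_n=B)=\frac{\prod_{i=1}^n\prod_{j=1}^{d(B,i)}(\kappa+j-1)}{\prod_{j=1}^{2m}(\kappa n+j-1)}\cdot\frac{m!\,2^{m'(B)}}{\Big(\prod_{i=1}^n\prod_{j=1}^{i-1}B(i,j)!\Big)\Big(\prod_{i=1}^n\frac{B(i,i)}{2}!\Big)},$$ where $m'(B)=\sum_{i=1}^n\sum_{j=1}^{i-1}B(i,j)$. Suppose that $$\lim_{n\to\infty}\frac{2m(n)}{n^2}=\rho.$$ Then $\mathbf{X}_n\xrightarrow{\ p\ }W$, where $W$ is the multigraphon defined (for $x,y\in(0,1)$, $k\in\mathbb{N}_0$) by $$W(x,y,k)=\begin{cases}\mathbf{p}\Big(k,\dfrac{F^{-1}(x)F^{-1}(y)}{\rho}\Big)&\text{if }x\ne y,\\[2mm]\mathbf{1}[\,2\mid k\,]\cdot\mathbf{p}\Big(\dfrac k2,\dfrac{F^{-1}(x)F^{-1}(y)}{2\rho}\Big)&\text{if }x=y,\end{cases}$$ and $F^{-1}$ is the inverse function of $F(z)=\int_0^z\mathbf{g}\big(y,\kappa,\tfrac{\kappa}{\rho}\big)\,dy$.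
   Context: $\mathbb{N}_0=\{0,1,2,\dots\}$, $[n]=\{1,\dots,n\}$. $\mathcal{A}_n$ is the set of symmetric matrices $B\in\mathbb{N}_0^{n\times n}$ with $B(i,i)$ even for all $i$ (adjacency matrices of labeled multigraphs on $[n]$, parallel and loop edges allowed; $B(i,i)$ is twice the number of loops at $i$). The degree is $d(B,i)=\sum_{j=1}^nB(i,j)$; the number of edges is $\frac12\sum_{i=1}^n d(B,i)$; $\mathcal{A}_n^m$ is the set of $B\in\mathcal{A}_n$ with exactly $m$ edges. Empty products equal $1$. (The displayed distribution is that of the preferential attachment graph $\mathrm{PAG}_\kappa(n,m)$ and is the stationary distribution of the edge reconnecting model.) Homomorphism densities: for $A\in\mathcal{A}_k$ and $B\in\mathcal{A}_n$, $$t_=(A,B)=\frac1{n^k}\sum_{\varphi:[k]\to[n]}\mathbf{1}\big[\forall i,j\in[k]:\ A(i,j)=B(\varphi(i),\varphi(j))\big].$$ A multigraphon is a (Borel) measurable function $W:[0,1]\times[0,1]\times\mathbb{N}_0\to[0,1]$ with $W(x,y,k)=W(y,x,k)$, $\sum_{k=0}^\infty W(x,y,k)=1$ and $W(x,x,2k+1)=0$ for all $x,y,k$. For $A\in\mathcal{A}_k$, $$t_=(A,W)=\int_{[0,1]^k}\prod_{1\le i\le j\le k}W(x_i,x_j,A(i,j))\,dx_1\cdots dx_k.$$ (The values of $W$ at coordinates $x,y\in\{0,1\}$ do not matter for $t_=$.) For random elements $\mathbf{X}_n$ of $\mathcal{A}_n$, $\mathbf{X}_n\xrightarrow{\ p\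 }W$ means that for every $k\in\mathbb{N}$ and $A\in\mathcal{A}_k$, $t_=(A,\mathbf{X}_n)\to t_=(A,W)$ in probability as $n\to\infty$. Poisson weights and Gamma density: $\mathbf{p}(k,\lambda)=e^{-\lambda}\frac{\lambda^k}{k!}$, $\ \mathbf{g}(x,\alpha,\beta)=x^{\alpha-1}\frac{\beta^\alpha e^{-\beta x}}{\Gamma(\alpha)}\mathbf{1}[x>0]$. *)

(* Defs.v *)
From HB Require Import structures.
From mathcomp Require Import all_boot all_order all_algebra.
From mathcomp Require Import all_classical all_reals all_analysis.
From mathcomp Require Import measurable_realfun.
Set Implicit Arguments.
Unset Strict Implicit.
Unset Printing Implicit Defensive.
Import Order.TTheory GRing.Theory Num.Theory.
Import numFieldNormedType.Exports.
Local Open Scope classical_set_scope.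
Local Open Scope ring_scope.

(* The set of matrices over nat is countable, so random matrices are maps that
   are measurable for the discrete sigma-algebra. *)
HB.instance Definition _ (n : nat) :=
  @isMeasurable.Build default_measure_display 'M[nat]_n
    discrete_measurable discrete_measurable0
    discrete_measurableC discrete_measurableU.

(* The diagonal entry B i i is twice the number of loops at i. *)
Definition adjacency (n : nat) : set 'M[nat]_n :=
  [set B | (forall i j, B i j = B j i) /\ (forall i, ~~ odd (B i i))].

Definition degree (n : nat) (B : 'M[nat]_n) (i : 'I_n) : nat :=
  (\sum_(j < n) B i j)%N.

(* On adjacency matrices the sum of the degrees is even, so ./2 is exact. *)
Definition num_edges (n : nat) (B : 'M[nat]_n) : nat :=
  (\sum_(i < n) degree B i)./2.

Definition adjacency_edges (n m : nat) : set 'M[nat]_n :=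
  [set B | adjacency B /\ num_edges B = m].

Definition nonloop_edges (n : nat) (B : 'M[nat]_n) : nat :=
  (\sum_(i < n) \sum_(j < n | (j < i)%N) B i j)%N.

Definition pag_pmf (R : realType) (kappa : R) (n m : nat) (B : 'M[nat]_n) : R :=
  (\prod_(i < n) \prod_(1 <= j < (degree B i).+1) (kappa + j%:R - 1))
    / (\prod_(1 <= j < (2 * m).+1) (kappa * n%:R + j%:R - 1))
  * (m`!%:R * 2 ^+ nonloop_edges B
     / ((\prod_(i < n) \prod_(j < n | (j < i)%N) (B i j)`!%:R)
        * (\prod_(i < n) ((B i i)./2)`!%:R))).

(* Lebesgue measure on [0,1], as a measure on R (of total mass 1). *)
Definition unit_itv_measure (R : realType) :
    probability (measurableTypeR R) R :=
  uniform_prob (@ltr01 R).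

Local Notation rtuple R k := (k.-tuple (measurableTypeR R)).

Definition tuple_cons (R : realType) (k : nat)
  (p : measurableTypeR R * rtuple R k) : rtuple R (k.+1) :=
  [tuple of p.1 :: p.2].

Lemma measurable_tuple_cons (R : realType) (k : nat) :
  measurable_fun [set: measurableTypeR R * rtuple R k] (@tuple_cons R k).
Proof. exact: measurable_cons. Qed.

HB.instance Definition _ (R : realType) (k : nat) :=
  isMeasurableFun.Build _ _ _ _ (@tuple_cons R k) (@measurable_tuple_cons R k).

(* The k-fold product of the Lebesgue measure on [0,1]: by the two lemmas below,
   integrating against it is integrating over x_1, ..., x_k in [0,1]. *)
Fixpoint unit_cube_measure (R : realType) (k : nat) :
    probability (rtuple R k) R :=
  match k return probability (rtuple R k) R with
  | 0 => \d_([tuple of [::]] : rtuple R 0)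
  | k'.+1 => distribution (unit_itv_measure R \x unit_cube_measure R k')%E
               (@tuple_cons R k')
  end.

Lemma integral_unit_cube0 (R : realType) (f : rtuple R 0 -> \bar R) :
  measurable_fun [set: rtuple R 0] f ->
  (\int[unit_cube_measure R 0]_t f t = f [tuple of [::]])%E.
Proof. by move=> mf; rewrite integral_dirac// diracT mul1e. Qed.

Lemma integral_unit_cubeS (R : realType) (k : nat)
    (f : rtuple R (k.+1) -> \bar R) :
  measurable_fun [set: rtuple R (k.+1)] f -> (forall t, 0 <= f t)%E ->
  (\int[unit_cube_measure R k.+1]_t f t =
   \int[lebesgue_measure]_(x in `[0%R, 1%R])
     \int[unit_cube_measure R k]_t f [tuple of x :: t])%E.
Proof.
move=> mf f0 /=; rewrite ge0_integral_distribution//.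
have mg : measurable_fun setT (f \o @tuple_cons R k).
  by apply: measurableT_comp => //; exact: measurable_tuple_cons.
rewrite fubini_tonelli1//= /unit_itv_measure integral_uniform//=.
- by rewrite subr0 invr1 mul1e.
- by apply: measurable_fun_fubini_tonelli_F => // p; exact: f0.
- by move=> x; rewrite /fubini_F; apply: integral_ge0 => t _; exact: f0.
Qed.

(* W is a function on R * R * nat of which only the values on
   [0,1] * [0,1] * nat are relevant. *)
Record multigraphon (R : realType) (W : R -> R -> nat -> R) : Prop := {
  multigraphon_measurable :
    measurable_fun (`[0 : R, 1 : R] `*` `[0 : R, 1 : R] `*` [set: nat])
      (fun p : R * R * nat => W p.1.1 p.1.2 p.2) ;
  multigraphon_itv01 : forall x y k, x \in `[0, 1] -> y \in `[0, 1] ->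
    0 <= W x y k <= 1 ;
  multigraphon_sym : forall x y k, x \in `[0, 1] -> y \in `[0, 1] ->
    W x y k = W y x k ;
  multigraphon_sum1 : forall x y, x \in `[0, 1] -> y \in `[0, 1] ->
    series (W x y) n @[n --> \oo] --> (1 : R) ;
  multigraphon_diag : forall x k, x \in `[0, 1] -> W x x (2 * k).+1 = 0 }.

Definition hom_density (R : realType) (k n : nat)
    (A : 'M[nat]_k) (B : 'M[nat]_n) : R :=
  (n%:R ^+ k)^-1 *
  \sum_(phi : {ffun 'I_k -> 'I_n})
    ([forall i, forall j, A i j == B (phi i) (phi j)] : nat)%:R.

Definition multigraphon_density (R : realType) (k : nat)
    (A : 'M[nat]_k) (W : R -> R -> nat -> R) : R :=
  \int[unit_cube_measure R k]_x
    \prod_(i < k) \prod_(j < k | (i <= j)%N) W (tnth x i) (tnth x j) (A i j).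

(* Each Y n lives on its own probability space; the limit is a constant. *)
Definition cvg_in_probability (R : realType) (d : nat -> measure_display)
    (Omega : forall n, measurableType (d n))
    (P : forall n, probability (Omega n) R)
    (Y : forall n, Omega n -> R) (l : R) : Prop :=
  forall eps : R, 0 < eps ->
    P n [set w | eps < `|Y n w - l|] @[n --> \oo] --> 0%E.

Definition cvg_to_multigraphon (R : realType) (d : nat -> measure_display)
    (Omega : forall n, measurableType (d n))
    (P : forall n, probability (Omega n) R)
    (X : forall n, {RV (P n) >-> 'M[nat]_n}) (W : R -> R -> nat -> R) : Prop :=
  forall (k : nat) (A : 'M[nat]_k), (0 < k)%N -> adjacency A ->
    cvg_in_probability P (fun n w => hom_density R A (X n w))
      (multigraphon_density A W).
Arguments cvg_to_multigraphon {R d Omega} P X W.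

(* The library's poisson_pmf is 1 at rate 0; here the weights at rate 0 are
   those of the point mass at 0. *)
Definition poisson_weight (R : realType) (k : nat) (lambda : R) : R :=
  expR (- lambda) * (lambda ^+ k / k`!%:R).

Definition Gamma (R : realType) (a : R) : R :=
  \int[lebesgue_measure]_(t in `]0, +oo[) (t `^ (a - 1) * expR (- t)).

Definition gamma_pdf (R : realType) (x alpha beta : R) : R :=
  if 0 < x
  then x `^ (alpha - 1) * (beta `^ alpha * expR (- (beta * x)) / Gamma alpha)
  else 0.

Definition gamma_cdf (R : realType) (kappa rho z : R) : R :=
  \int[lebesgue_measure]_(y in `[0, z]) gamma_pdf y kappa (kappa / rho).

(* The inverse of gamma_cdf : ]0,+oo[ -> ]0,1[, extended by 0 outside the
   range; in particular it is 0 at 0 and at 1. *)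
Definition gamma_cdf_inv (R : realType) (kappa rho : R) : R -> R :=
  'pinv_(fun=> 0) `]0, +oo[ (gamma_cdf kappa rho).

Definition pag_limit (R : realType) (kappa rho : R) (x y : R) (k : nat) : R :=
  let u := gamma_cdf_inv kappa rho x in
  let v := gamma_cdf_inv kappa rho y in
  if x != y then poisson_weight k (u * v / rho)
  else (~~ odd k : nat)%:R * poisson_weight k./2 (u * v / (2 * rho)).

(* Main.v *)
(* Second moment method. Let Z_1, ..., Z_n be independent Gamma variables of
   shape kappa. Their moments are rising factorials, so the weight of B is, up to
   a constant, the product of the factors 1 / B(i,j)! and 1 / (B(i,i)/2)! and of
   the mean of prod_i Z_i ^ d(B,i): the graph is a mixture of multinomial graphs.
   The probability that B agrees with A on k given vertices is thus a sum over
   the remaining entries which the multinomial formula evaluates, leaving the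
   mean of a product of powers of the Z_i of the block and of a power of
   (sum of all Z)^2 - (sum over the block)^2. By additivity of independent Gamma
   variables and the Beta law of their ratios this is a one-dimensional Beta
   mean, whose limit, given by dominated convergence, is also the density of A in
   the limit multigraphon. For two disjoint blocks the same computation, with a
   double Beta mean, yields the square of that limit. Hence the variance of the
   density, an average over pairs of vertex maps of which almost all are jointly
   injective, tends to 0, and Chebyshev's inequality concludes. *)

From HB Require Import structures.
Require Import Defs.
From mathcomp Require Import all_boot all_order all_algebra.
From mathcomp Require Import all_classical all_reals all_analysis.
From mathcomp Require Import measurable_realfun.
From mathcomp Require Import ring lra.
Set Implicit Arguments.
Unset Strict Implicit.
Unset Printing Implicit Defensive.
Import Order.TTheory GRing.Theory Num.Theory.
Import numFieldNormedType.Exports.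
Local Open Scope classical_set_scope.
Local Open Scope ring_scope.

(** * Counting multigraphs by slots *)

(** Sums over multigraphs with [m] edges are indexed by finite families of bounded counts, one per
    unordered pair, so that a generating function evaluates them. The Gamma variables are realised
    as [Z_i = gamma_cdf_inv kappa rho x_i] on the unit cube: one mixed-moment formula then serves
    both the finite graph and the density of the limit, which is an integral over that cube. Their
    rate [kappa / rho] is dictated by the limit; in the finite graph it cancels, because the degrees
    add up to [2 * m]. The free vertices enter only through the sum of their variables, which is why
    three Gamma variables suffice. Once the total mass is factored out by homogeneity, a block holds
    a share [u] of size about [x / n] with [x] Gamma distributed, and [(1 - u ^+ 2) ^+ M] with [M]
    close to [rho * n ^+ 2 / 2] tends to [expR (- (rho / 2 * x ^+ 2))]. After scaling by [rho] this
    is the Gaussian factor of the limit: over all pairs and loops the Poisson rates add up to the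
    square of the sum of the [Z_i], divided by [2 * rho]. Two blocks decouple because each takes a
    share of order [1 / n] only. *)

Section slot_counts.
Variables (R : numFieldType) (I : finType) (m : nat).
Implicit Types (w : I -> R) (Q : pred I) (alpha : I -> nat).

(** The exponential series cut at degree [m] is a polynomial, and its coefficients up to degree [m]
    are those of the full series, which is all that counting [m] edges requires. *)
Definition trunc_exp (x : R) : {poly R} :=
  \sum_(j < m.+1) ((x ^+ j / j`!%:R)%:P * 'X^j).

Lemma coef_trunc_exp x M : (M <= m)%N ->
  (trunc_exp x)`_M = x ^+ M / M`!%:R.
Proof.
move=> Mm; rewrite /trunc_exp coef_sum (bigD1 (Ordinal (Mm : M < m.+1)%N))//=.
rewrite coefCM coefXn eqxx mulr1 big1 ?addr0// => i iM.
rewrite coefCM coefXn; case: eqP => [Mi|]; last by rewrite mulr0.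
by move: iM; rewrite -val_eqE /= Mi eqxx.
Qed.

(** The law of exponents read coefficientwise, that is, the multinomial formula. The bound on [M]
    keeps clear of the truncation; the induction step is the binomial formula. *)
Lemma coef_prod_trunc_exp w Q M : (M <= m)%N ->
  (\prod_(p | Q p) trunc_exp (w p))`_M = (\sum_(p | Q p) w p) ^+ M / M`!%:R.
Proof.
move=> Mm; rewrite -!(big_filter _ Q); elim: [seq p <- _ | _] M Mm => [|p s IH] M Mm.
  rewrite !big_nil coefC; case: M Mm => [|M] _; first by rewrite expr0 divr1.
  by rewrite expr0n /= mul0r.
rewrite !big_cons coefMr exprDn mulr_suml; apply: eq_bigr => -[j /= jM] _.
rewrite ltnS in jM.
rewrite coef_trunc_exp ?(leq_trans (leq_subr _ _))// IH ?(leq_trans jM)//.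
have f0 k : (k`!%:R : R) != 0 by rewrite pnatr_eq0 -lt0n fact_gt0.
rewrite -mulr_natr -(bin_fact jM) !natrM.
by field; rewrite !f0 pnatr_eq0 -lt0n bin_gt0 jM.
Qed.

(** Generating function argument: a prescribed slot contributes one monomial, a free slot a
    truncated exponential, and the condition on the total extracts the coefficient of degree [m].
    Bounding the counts by [m] loses nothing, as their total is [m]. *)
Lemma sum_constrained_slot_counts w Q alpha :
  (\sum_(p | Q p) alpha p <= m)%N ->
  \sum_(a : {ffun I -> 'I_m.+1} |
      (\sum_p a p == m)%N && [forall (p | Q p), a p == alpha p :> nat])
    \prod_p (w p ^+ a p / (a p)`!%:R) =
  \prod_(p | Q p) (w p ^+ alpha p / (alpha p)`!%:R) *
  ((\sum_(p | ~~ Q p) w p) ^+ (m - \sum_(p | Q p) alpha p)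
   / (m - \sum_(p | Q p) alpha p)`!%:R).
Proof.
move=> le_e_m; set e := (\sum_(p | Q p) alpha p)%N.
(* A violated prescription is encoded as the zero polynomial, so that the constraint distributes
   over the slots. *)
pose F p (j : 'I_m.+1) : {poly R} :=
  if Q p && (j != alpha p :> nat) then 0 else (w p ^+ j / j`!%:R)%:P * 'X^j.
have prodF (a : {ffun I -> 'I_m.+1}) : \prod_p F p (a p) =
    if [forall (p | Q p), a p == alpha p :> nat]
    then (\prod_p (w p ^+ a p / (a p)`!%:R))%:P * 'X^(\sum_p a p) else 0.
  case: ifPn => [/'forall_implyP h|].
    rewrite (eq_bigr (fun p => (w p ^+ a p / (a p)`!%:R)%:P * 'X^(a p))).
      by rewrite big_split /= rmorph_prod -expr_sum.
    by move=> p _; rewrite /F; case: ifP => // /andP[/h/eqP->]; rewrite eqxx.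
  rewrite negb_forall => /existsP[p]; rewrite negb_imply => hp.
  by rewrite (bigD1 p)//= /F hp mul0r.
transitivity ((\prod_p \sum_j F p j)`_m).
  rewrite bigA_distr_bigA coef_sum [RHS]big_mkcond/= big_mkcond/=.
  apply: eq_bigr => a _; rewrite prodF; case: ifPn => [/andP[/eqP s ->]|].
    by rewrite coefCM coefXn s eqxx mulr1.
  rewrite negb_and; case: ifP => _; last by rewrite coef0.
  by rewrite orbF coefCM coefXn eq_sym => /negPf ->; rewrite mulr0.
have -> : \prod_p \sum_j F p j =
    (\prod_(p | Q p) (w p ^+ alpha p / (alpha p)`!%:R))%:P * 'X^e *
    \prod_(p | ~~ Q p) trunc_exp (w p).
  rewrite (bigID Q)/=; congr (_ * _); last first.
    apply: eq_bigr => p /negPf nQ; apply: eq_bigr => j _.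
    by rewrite /F nQ.
  rewrite /e expr_sum rmorph_prod -big_split; apply: eq_bigr => p Qp /=.
  have am : (alpha p < m.+1)%N.
    by rewrite ltnS (leq_trans _ le_e_m)// (bigD1 p)//= leq_addr.
  rewrite (bigD1 (Ordinal am))//= {1}/F Qp /= eqxx/= big1 ?addr0// => j.
  by rewrite -val_eqE /= /F Qp /= => ->.
rewrite -mulrA coefCM coefXnM ltnNge le_e_m/=; congr *%R.
exact/coef_prod_trunc_exp/leq_subr.
Qed.
End slot_counts.

(* The slot (i, j) with j <= i stands for the unordered pair {i, j}; a loop sits
   in the slot (i, i) and counts twice on the diagonal. *)
Definition slot_matrix (n : nat) (a : 'I_n * 'I_n -> nat) : 'M[nat]_n :=
  \matrix_(i, j) (a (i, j) + a (j, i))%N.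

Definition slots_of (n : nat) (B : 'M[nat]_n) (p : 'I_n * 'I_n) : nat :=
  if (p.2 < p.1)%N then B p.1 p.2 else
  if p.1 == p.2 then (B p.1 p.1)./2 else 0%N.

Definition upper (n : nat) (p : 'I_n * 'I_n) : bool := (p.1 < p.2)%N.

Definition zero_above (n : nat) (a : 'I_n * 'I_n -> nat) : Prop :=
  forall p, upper p -> a p = 0%N.

(** The number of ordered pairs a slot stands for; it accounts both for the powers of 2 in the law
    and for the cross terms of a squared sum. *)
Definition multiplicity (R : realType) (n : nat) (p : 'I_n * 'I_n) : R :=
  if p.1 == p.2 then 1 else 2.

(** For an adjacency matrix with [m] edges, the factorial of [m] times this is the number of
    sequences of [m] ordered pairs of vertices that produce the multigraph. *)
Definition edge_weight (R : realType) (n : nat) (B : 'M[nat]_n) : R :=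
  2 ^+ nonloop_edges B /
  ((\prod_(i < n) \prod_(j < n | (j < i)%N) (B i j)`!%:R)
   * (\prod_(i < n) ((B i i)./2)`!%:R)).

Lemma zero_above_slots_of n (B : 'M[nat]_n) : zero_above (slots_of B).
Proof.
move=> [i j]; rewrite /upper /slots_of /= => ij.
by rewrite ltnNge (ltnW ij)/= -val_eqE /= ltn_eqF.
Qed.

Lemma adjacency_slot_matrix n (a : 'I_n * 'I_n -> nat) :
  adjacency (slot_matrix a).
Proof.
split=> [i j|i]; first by rewrite !mxE addnC.
by rewrite mxE addnn odd_double.
Qed.

Lemma slot_matrixK n (a : 'I_n * 'I_n -> nat) p : zero_above a ->
  slots_of (slot_matrix a) p = a p.
Proof.
move: p => [i j] a0; rewrite /slots_of /= !mxE; case: ltngtP => [ji|ij|/val_inj ->].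
- by rewrite (a0 (j, i)) ?addn0.
- by rewrite -val_eqE /= ltn_eqF// a0.
- by rewrite eqxx addnn doubleK.
Qed.

Lemma slots_ofK n (B : 'M[nat]_n) : adjacency B ->
  slot_matrix (slots_of B) = B.
Proof.
move=> [symB evB]; apply/matrixP => i j; rewrite !mxE /slots_of /=.
case: (ltngtP i j) => [ij|ji|/val_inj ->].
- by rewrite -val_eqE /= ltn_eqF.
- by rewrite -[j == i]val_eqE /= ltn_eqF// addn0.
- by rewrite eqxx addnn even_halfK.
Qed.

(** Each end of an edge gains one degree and a loop adds two to its vertex; the factor
    [z p.1 * z p.2] covers both cases in one form. *)
Lemma prod_degree_slot_matrix (R : comNzRingType) n (a : 'I_n * 'I_n -> nat)
    (z : 'I_n -> R) :
  \prod_i z i ^+ degree (slot_matrix a) i =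
  \prod_p (z p.1 * z p.2) ^+ a p.
Proof.
under eq_bigr => i _.
  rewrite /degree expr_sum.
  under eq_bigr => j _ do rewrite mxE exprD.
  rewrite big_split /=; over.
rewrite big_split/= [X in _ * X]exchange_big /=.
under [RHS]eq_bigr do rewrite exprMn.
rewrite [RHS]big_split /= !pair_bigA /=.
by congr *%R; apply: eq_bigr => -[].
Qed.

Lemma sum_degree_slot_matrix n (a : 'I_n * 'I_n -> nat) :
  (\sum_i degree (slot_matrix a) i = (\sum_p a p).*2)%N.
Proof.
rewrite /degree.
under eq_bigr => i _.
  under eq_bigr => j _ do rewrite mxE.
  rewrite big_split /=; over.
rewrite big_split/= [X in (_ + X)%N]exchange_big /= -addnn pair_bigA /=.
by congr (_ + _)%N; apply: eq_bigr => -[].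
Qed.

Lemma num_edges_slot_matrix n (a : 'I_n * 'I_n -> nat) :
  num_edges (slot_matrix a) = (\sum_p a p)%N.
Proof. by rewrite /num_edges sum_degree_slot_matrix doubleK. Qed.

Lemma sum_degree_adjacency n (B : 'M[nat]_n) : adjacency B ->
  (\sum_i degree B i = (num_edges B).*2)%N.
Proof.
by move=> /slots_ofK <-; rewrite num_edges_slot_matrix sum_degree_slot_matrix.
Qed.

Lemma prod_pairE (R : comNzRingType) (I J : finType) (F : I * J -> R) :
  \prod_p F p = \prod_i \prod_j F (i, j).
Proof. by rewrite pair_bigA; apply: eq_bigr => -[]. Qed.

Lemma edge_weight_slot_matrix (R : realType) n (a : 'I_n * 'I_n -> nat) :
  zero_above a ->
  edge_weight R (slot_matrix a) =
  \prod_p (multiplicity R p ^+ a p / (a p)`!%:R).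
Proof.
move=> a0; rewrite /edge_weight /nonloop_edges expr_sum.
under eq_bigr do rewrite expr_sum.
rewrite big_split /= prodfV; congr (_ / _); rewrite [RHS]prod_pairE.
  apply: eq_bigr => i _; rewrite [LHS]big_mkcond; apply: eq_bigr => j _.
  rewrite mxE /multiplicity /=; case: ltngtP => [ji|ij|/val_inj ->].
  - by rewrite -val_eqE /= gtn_eqF// (a0 (j, i))// addn0.
  - by rewrite (a0 (i, j)).
  - by rewrite eqxx expr1n.
rewrite -big_split; apply: eq_bigr => i _ /=.
rewrite [RHS](bigD1 i)//= mulrC mxE addnn doubleK; congr *%R.
rewrite big_mkcond [RHS]big_mkcond; apply: eq_bigr => j _.
rewrite mxE -val_eqE /=; case: (ltngtP j i) => [ji|ij|//].
- by rewrite (a0 (j, i))// addn0.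
- by rewrite (a0 (i, j)).
Qed.

(** A vertex map need not be increasing, so a pair of the lower triangle may be met in reversed
    orientation after embedding. Two ways of orienting each pair differ by swapping some of the
    pairs, which a symmetric factor does not notice. *)
Lemma prod_symmetric_tournament (R : comNzRingType) (T : finType)
    (r s : rel T) (f : T -> T -> R) :
  (forall i j, f i j = f j i) ->
  (forall i j, i != j -> r i j = ~~ r j i) ->
  (forall i j, i != j -> s i j = ~~ s j i) ->
  irreflexive r -> irreflexive s ->
  \prod_i \prod_(j | r i j) f i j = \prod_i \prod_(j | s i j) f i j.
Proof.
move=> fC rC sC r0 s0; rewrite !pair_big_dep /=.
rewrite (bigID (fun p => s p.1 p.2))/= [RHS](bigID (fun p => r p.1 p.2))/=.
congr *%R; first by apply: eq_bigl => p; rewrite andbC.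
rewrite (reindex_inj (can_inj (@swap_pairK _ _)))/=.
apply: eq_big => [[i j]/=|[i j] _ /=]; last by rewrite fC.
have [->|ij] := eqVneq i j; first by rewrite r0 s0.
by rewrite (rC _ _ ij) negbK andbC (sC _ _ ij).
Qed.

Lemma sqr_sum_slots (R : realType) n (y : 'I_n -> R) :
  \sum_(p | ~~ upper p) multiplicity R p * (y p.1 * y p.2) = (\sum_i y i) ^+ 2.
Proof.
rewrite expr2 mulr_suml; under [RHS]eq_bigr do rewrite mulr_sumr.
rewrite [RHS]pair_bigA /= (bigID (fun p => p.1 == p.2))/= [RHS](bigID (fun p => p.1 == p.2))/=.
congr +%R.
  apply: eq_big => [[i j]/=|[i j] /andP[_ /= ij]]; rewrite /upper /multiplicity /=.
    by have [->|//] := eqVneq i j; rewrite ?ltnn ?andbF.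
  by rewrite ij mul1r.
rewrite [RHS](bigID (fun p => upper p))/=.
rewrite [X in _ = X + _](reindex_inj (can_inj (@swap_pairK _ _)))/=.
rewrite /upper /=.
transitivity (\sum_(p : 'I_n * 'I_n | ~~ (p.1 < p.2)%N && (p.1 != p.2)) y p.2 * y p.1 +
    \sum_(p : 'I_n * 'I_n | ~~ (p.1 < p.2)%N && (p.1 != p.2)) y p.1 * y p.2).
  rewrite -big_split; apply: eq_bigr => -[i j] /andP[_ /= /negbTE ij].
  by rewrite /multiplicity /= ij; ring.
congr +%R; apply: eq_bigl => -[i j] /=; last by rewrite andbC.
by rewrite -!val_eqE /=; case: ltngtP.
Qed.

(** A finite index set for the multigraphs with [m] edges: the zeros forced above the diagonal make
    each of them occur exactly once. *)
Definition slot_counts (n m : nat) (a : {ffun 'I_n * 'I_n -> 'I_m.+1}) : bool :=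
  (\sum_p a p == m)%N && [forall (p | upper p), a p == 0 :> nat].

(* With grp constant, Phi embeds A as an induced submatrix of B. With two groups
   only the entries within each group are prescribed: this is the intersection
   of the events attached to two vertex maps. *)
Definition block_event (N n : nat) (grp : 'I_N -> bool) (Phi : 'I_N -> 'I_n)
    (A : 'M[nat]_N) (B : 'M[nat]_n) : bool :=
  [forall i, forall j, (grp i == grp j) ==> (A i j == B (Phi i) (Phi j))].

(** Entries between the groups are not prescribed; setting them to 0 makes the degrees and the edge
    count of [A] refer to prescribed edges only. *)
Definition block_diagonal (N : nat) (grp : 'I_N -> bool) (A : 'M[nat]_N) :=
  forall i j, grp i != grp j -> A i j = 0%N.

Lemma edge_weightE (R : realType) n (B : 'M[nat]_n) :
  edge_weight R B = (\prod_(i < n) \prod_(j < n | (j < i)%N) (2 ^+ B i j / (B i j)`!%:R)) /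
    \prod_i ((B i i)./2)`!%:R.
Proof.
rewrite /edge_weight /nonloop_edges expr_sum invfM mulrA; congr *%R.
rewrite -prodfV -big_split; apply: eq_bigr => i _ /=.
by rewrite expr_sum -prodfV -big_split.
Qed.

(** * Embedding a block into the vertex set *)

Section embedding.
Variables (N n : nat) (Phi : 'I_N -> 'I_n).
Hypothesis Phi_inj : injective Phi.

Definition label (u : 'I_n) : option 'I_N := [pick i | Phi i == u].

Lemma labelK i : label (Phi i) = Some i.
Proof.
rewrite /label; case: pickP => [j /eqP/Phi_inj -> //|/(_ i)].
by rewrite eqxx.
Qed.

Lemma label_some u i : label u = Some i -> u = Phi i.
Proof. by rewrite /label; case: pickP => // j /eqP <- [->]. Qed.

Lemma big_label (T : Type) (idx : T) (op : Monoid.com_law idx) (F : 'I_n -> T) :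
  (forall u, label u = None -> F u = idx) ->
  \big[op/idx]_u F u = \big[op/idx]_i F (Phi i).
Proof.
move=> F0; rewrite [RHS](partition_big Phi xpredT)//=; apply: eq_bigr => u _.
case lu : (label u) => [i|].
  rewrite (label_some lu) (big_pred1 i)// => j /=.
  by apply/eqP/eqP => [/Phi_inj|->].
rewrite F0// big_pred0// => i; apply/negbTE/eqP => iu.
by move: lu; rewrite -iu labelK.
Qed.

(** Padding by zeros makes the slot formulas on [n] vertices applicable to [A], with the vertex
    order seen through [Phi]. *)
Definition embed (A : 'M[nat]_N) : 'M[nat]_n :=
  \matrix_(u, v) (if label u is Some i then
                    if label v is Some j then A i j else 0%N else 0%N).

Variable A : 'M[nat]_N.
Hypothesis Aadj : adjacency A.

Lemma embedE i j : embed A (Phi i) (Phi j) = A i j.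
Proof. by rewrite mxE !labelK. Qed.

Lemma embed0l u v : label u = None -> embed A u v = 0%N.
Proof. by rewrite mxE => ->. Qed.

Lemma embed0r u v : label v = None -> embed A u v = 0%N.
Proof. by rewrite mxE => ->; case: label. Qed.

Lemma adjacency_embed : adjacency (embed A).
Proof.
case: Aadj => As Ae; split => [u v|u]; rewrite !mxE.
  by case: (label u) => [i|]; case: (label v) => [j|].
by case: (label u) => [i|].
Qed.

Lemma degree_embed i : degree (embed A) (Phi i) = degree A i.
Proof.
rewrite /degree big_label => [|u]; last exact: embed0r.
by apply: eq_bigr => j _; rewrite embedE.
Qed.

Lemma degree_embed0 u : label u = None -> degree (embed A) u = 0%N.
Proof. by move=> u0; rewrite /degree big1// => v _; rewrite embed0l. Qed.

Lemma num_edges_embed : num_edges (embed A) = num_edges A.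
Proof.
rewrite /num_edges big_label => [|u]; last exact: degree_embed0.
by under eq_bigr do rewrite degree_embed.
Qed.

Lemma prod_degree_embed (R : comNzRingType) (z : 'I_n -> R) :
  \prod_u z u ^+ degree (embed A) u = \prod_i z (Phi i) ^+ degree A i.
Proof.
rewrite big_label => [|u /degree_embed0 ->//].
by under eq_bigr do rewrite degree_embed.
Qed.

Lemma edge_weight_embed (R : realType) :
  edge_weight R (embed A) = edge_weight R A.
Proof.
have inC i j : i != j -> (Phi i < Phi j)%N = ~~ (Phi j < Phi i)%N.
  move=> ij; rewrite -leqNgt [RHS]leq_eqVlt.
  have /negbTE -> // : val (Phi i) != val (Phi j).
  by rewrite (inj_eq val_inj) (inj_eq Phi_inj).
have inC' (i j : 'I_N) : i != j -> (i < j)%N = ~~ (j < i)%N.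
  by move=> ij; rewrite -leqNgt [RHS]leq_eqVlt; move/negbTE: ij; rewrite -val_eqE /= => ->.
rewrite !edge_weightE; congr (_ / _); last first.
  rewrite big_label => [|u u0]; last by rewrite embed0l.
  by under eq_bigr do rewrite embedE.
under eq_bigr do rewrite big_mkcond.
rewrite big_label => [|u u0]; last first.
  by rewrite big1// => v _; rewrite embed0l// divr1 if_same.
under eq_bigr => i _.
  rewrite big_label => [|u u0]; last by rewrite embed0r// divr1 if_same.
  under eq_bigr do rewrite embedE.
  rewrite -big_mkcond; over.
apply: (@prod_symmetric_tournament _ _ (fun i j => (Phi j < Phi i)%N)
  (fun i j => (j < i)%N)) => [i j|i j ij|i j ij|i|i].
- by have [As _] := Aadj; rewrite (As i j).
- by apply: inC; rewrite eq_sym.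
- by apply: inC'; rewrite eq_sym.
- exact: ltnn.
- exact: ltnn.
Qed.

Variables (grp : 'I_N -> bool) (m : nat).
Hypothesis Abd : block_diagonal grp A.

Definition in_block (p : 'I_n * 'I_n) : bool :=
  if label p.1 is Some i then
    if label p.2 is Some j then grp i == grp j else false else false.

Lemma slots_of_embed0 p : ~~ in_block p -> slots_of (embed A) p = 0%N.
Proof.
move: p => [u v]; rewrite /in_block /slots_of /= => h.
have -> : embed A u v = 0%N.
  rewrite mxE; case: (label u) h => // i; case: (label v) => // j.
  exact: Abd.
case: ifP => // _; case: eqP => // uv; move: h; rewrite -uv mxE.
by case: (label u) => // i; rewrite eqxx.
Qed.

(** Prescribed slots are the form of the event that the constrained count accepts; by symmetry of
    the matrices the slots determine all prescribed entries. *)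
Lemma block_eventE (a : 'I_n * 'I_n -> nat) : zero_above a ->
  block_event grp Phi A (slot_matrix a) =
  [forall (p | in_block p), a p == slots_of (embed A) p].
Proof.
move=> a0; apply/idP/idP.
  move=> /'forall_forallP h; apply/'forall_implyP => -[u v].
  rewrite /in_block /=; case lu : (label u) => [i|//]; case lv : (label v) => [j|//].
  move=> ij; rewrite -(slot_matrixK _ a0).
  have := h i j; rewrite ij /= => /eqP Aij.
  have := h i i; rewrite eqxx /= => /eqP Aii.
  rewrite (label_some lu) (label_some lv).
  by rewrite /slots_of /= -Aij -Aii !embedE.
move=> /'forall_implyP h; apply/'forall_forallP => i j; apply/implyP => ij.
have hE u v : in_block (u, v) -> a (u, v) = slots_of (embed A) (u, v).
  by move=> /h/eqP.
rewrite mxE !hE /in_block /= ?labelK// 1?eq_sym//.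
have := congr1 (fun B : 'M[nat]_n => B (Phi i) (Phi j)) (slots_ofK adjacency_embed).
by rewrite mxE embedE => ->.
Qed.

(** The free slots are those on or below the diagonal outside the block. The square of a sum over a
    set of vertices is the weight of all slots within that set, so the free weight is the square of
    the whole sum less the squares of the two group sums. *)
Lemma sum_block_event (R : realType) (z : 'I_n -> R) : (num_edges A <= m)%N ->
  \sum_(a : {ffun 'I_n * 'I_n -> 'I_m.+1} |
      slot_counts a && block_event grp Phi A (slot_matrix (fun p => a p)))
    \prod_p ((multiplicity R p * (z p.1 * z p.2)) ^+ a p / (a p)`!%:R) =
  edge_weight R A * \prod_i z (Phi i) ^+ degree A i *
  (((\sum_u z u) ^+ 2 - (\sum_(i | ~~ grp i) z (Phi i)) ^+ 2
     - (\sum_(i | grp i) z (Phi i)) ^+ 2) ^+ (m - num_edges A)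
   / (m - num_edges A)`!%:R).
Proof.
move=> em; pose al := slots_of (embed A).
(* Slots above the diagonal count as prescribed with value 0, so that one constrained count handles
   both conditions. *)
pose Q p := upper p || in_block p.
have al0 p : ~~ in_block p -> al p = 0%N by exact: slots_of_embed0.
have alup p : upper p -> al p = 0%N by exact: zero_above_slots_of.
have alQ p : ~~ Q p -> al p = 0%N by rewrite negb_or => /andP[_ /al0].
have sal : (\sum_(p | Q p) al p = num_edges A)%N.
  rewrite -num_edges_embed -(slots_ofK adjacency_embed) num_edges_slot_matrix.
  by rewrite [RHS](bigID Q)/= [X in (_ + X)%N]big1 ?addn0// => p /alQ.
transitivity (\sum_(a : {ffun 'I_n * 'I_n -> 'I_m.+1} |
      (\sum_p a p == m)%N && [forall (p | Q p), a p == al p :> nat])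
    \prod_p ((multiplicity R p * (z p.1 * z p.2)) ^+ a p / (a p)`!%:R)).
  apply: eq_bigl => a; rewrite /slot_counts -andbA; congr andb.
  apply/andP/'forall_implyP => [[/'forall_implyP a0]|h].
    rewrite block_eventE; last by move=> p /a0/eqP.
    move=> /'forall_implyP h p /orP[pu|/h//].
    by rewrite alup// a0.
  have a0 : zero_above (fun p => a p : nat).
    by move=> p pu; rewrite /= (eqP (h p _)) ?alup// /Q pu.
  split; first by apply/'forall_implyP => p /a0 ->.
  rewrite block_eventE//; apply/'forall_implyP => p pb; apply: h.
  by rewrite /Q pb orbT.
rewrite sum_constrained_slot_counts ?sal//; congr (_ * (_ ^+ _ / _)).
  transitivity (\prod_p ((multiplicity R p * (z p.1 * z p.2)) ^+ al p / (al p)`!%:R)).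
    rewrite [RHS](bigID Q)/= [X in _ * X]big1 ?mulr1// => p /alQ ->.
    by rewrite expr0 divr1.
  rewrite -prod_degree_embed -edge_weight_embed -(slots_ofK adjacency_embed).
  rewrite prod_degree_slot_matrix edge_weight_slot_matrix; last exact: zero_above_slots_of.
  by rewrite -big_split; apply: eq_bigr => p _ /=; rewrite exprMn mulrAC.
(* Replacing [z] by 0 outside the group [b] reduces the weight of the slots within that group to the
   formula for a square. *)
have sq b : \sum_(p | ~~ upper p) multiplicity R p *
    ((if label p.1 is Some i then if grp i == b then z p.1 else 0 else 0) *
     (if label p.2 is Some i then if grp i == b then z p.2 else 0 else 0)) =
    (\sum_(i | grp i == b) z (Phi i)) ^+ 2.
  pose y u := if label u is Some i then if grp i == b then z u else 0 else 0.
  rewrite (sqr_sum_slots y) big_label => [|u u0]; last by rewrite /y u0.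
  by rewrite [in RHS]big_mkcond; congr (_ ^+ 2); apply: eq_bigr => i _; rewrite /y labelK.
rewrite -sqr_sum_slots.
have := sq false; rewrite (eq_bigl (fun i => ~~ grp i)); last by move=> i; case: grp.
move=> <-; have := sq true; rewrite (eq_bigl grp); last by move=> i; case: grp.
move=> <-; rewrite -!sumrB [LHS]big_mkcond [RHS]big_mkcond; apply: eq_bigr => -[u v] _ /=.
rewrite /Q negb_or /in_block /=; case: (upper _) => //=.
case: (label u) => [i|]; last by rewrite !mul0r !mulr0 !subr0.
case: (label v) => [j|]; last by rewrite !mulr0 !subr0.
by case: (grp i); case: (grp j); rewrite /= ?(mulr0,mul0r,subr0,subrr).
Qed.
End embedding.

(** * Gamma and Beta integrals *)

Section lebesgue_affine.
Context {R : realType}.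
Local Notation mu := (@lebesgue_measure R).
Local Open Scope ereal_scope.

(** Lebesgue measure is determined by its values on bounded half-open intervals, where it agrees
    with [c] times its pushforward under [x |-> c * x + d]. *)
Lemma ge0_integral_affine (c d : R) (f : R -> \bar R) : (0 < c)%R ->
  measurable_fun [set: R] f -> (forall x, 0 <= f x) ->
  \int[mu]_x f x = c%:E * \int[mu]_x f (c * x + d)%R.
Proof.
move=> c0 mf f0.
pose phi : measurableTypeR R -> measurableTypeR R := fun x => (c * x + d)%R.
have mphi : measurable_fun [set: measurableTypeR R] phi.
  by apply: measurable_funD => //; exact: measurable_funM.
pose nu_ : {measure set (measurableTypeR R) -> \bar R} :=
  mscale (NngNum (ltW c0)) (pushforward mu phi).
pose nu := nu_ mphi.
have muE A : measurable A -> mu A = nu A.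
  apply: lebesgue_measure_unique => //= _ [[a b]] _ <-.
  transitivity (c%:E * mu [set` `](a - d) / c, (b - d) / c]%R]); last first.
    congr (_ * mu _).
    apply/seteqP; split => x /=; rewrite !in_itv/= /phi.
      by rewrite ltr_pdivrMr// ler_pdivlMr// ltrBlDr lerBrDr mulrC.
    by rewrite ltr_pdivrMr// ler_pdivlMr// ltrBlDr lerBrDr mulrC.
  rewrite !lebesgue_measure_itv/= !lte_fin ltr_pM2r ?invr_gt0// ltrD2r.
  case: ifPn => _; last by rewrite mule0.
  by rewrite -!EFinB -EFinM -mulrBl mulrC divfK ?gt_eqF//; congr EFin; ring.
rewrite (@eq_measure_integral _ _ _ setT nu); last by move=> A mA _; exact: muE.
rewrite ge0_integral_mscale//=; congr *%E.
by rewrite ge0_integral_pushforward.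
Qed.

Lemma ge0_integral_shift (d : R) (f : R -> \bar R) :
  measurable_fun [set: R] f -> (forall x, 0 <= f x) ->
  \int[mu]_x f x = \int[mu]_x f (x + d)%R.
Proof.
move=> mf f0; rewrite (ge0_integral_affine d ltr01 mf f0) mul1e.
by under eq_integral do rewrite mul1r.
Qed.

Lemma ge0_integral_scale (c : R) (f : R -> \bar R) : (0 < c)%R ->
  measurable_fun [set: R] f -> (forall x, 0 <= f x) ->
  \int[mu]_x f x = c%:E * \int[mu]_x f (c * x)%R.
Proof.
move=> c0 mf f0; rewrite (ge0_integral_affine 0 c0 mf f0).
by under eq_integral do rewrite addr0.
Qed.

(** The substitution [s = r * u], [t = r * (1 - u)] with Jacobian [r], obtained from one-dimensional
    changes of variable: a shift of [t], an exchange of the integrals, then a scaling of [s]. *)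
Lemma ge0_integral_sum_ratio (K : R * R -> \bar R) :
  measurable_fun [set: R * R] K -> (forall p, 0 <= K p) ->
  (forall s t, ~~ ((0 < s) && (0 < t))%R -> K (s, t) = 0) ->
  \int[mu]_s \int[mu]_t K (s, t) =
  \int[mu]_r \int[mu]_u (if (0 < r)%R then r%:E * K (r * u, r * (1 - u))%R else 0).
Proof.
move=> mK K0 Kout.
transitivity (\int[mu]_s \int[mu]_r K (s, r - s)%R).
  apply: eq_integral => s _; rewrite (ge0_integral_shift (- s)%R)//.
  exact: measurableT_comp mK (pair1_measurable _).
transitivity (\int[mu]_r \int[mu]_s K (s, r - s)%R).
  have mKs : measurable_fun [set: R * R] (fun p : R * R => K (p.1, p.2 - p.1)%R).
    apply: measurableT_comp mK _; apply: measurable_fun_pair => //=.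
    exact: measurable_funB.
  exact: (@fubini_tonelli _ _ (measurableTypeR R) (measurableTypeR R) R mu mu
    (fun p : R * R => K (p.1, p.2 - p.1)%R)).
apply: eq_integral => r _; have [r0|r0] := boolP (0 < r)%R; last first.
  rewrite !integral0_eq// => s _; apply: Kout.
  by apply: contra r0 => /andP[s0]; rewrite subr_gt0; exact: lt_trans.
have mKr : measurable_fun [set: R] (fun s => K (s, r - s)%R).
  apply: measurableT_comp mK _; apply: measurable_fun_pair => //=.
  exact: measurable_funB.
rewrite (ge0_integral_scale r0)// -ge0_integralZl//=.
- by apply: eq_integral => u _; rewrite mulrBr mulr1.
- apply: (measurableT_comp mKr); exact: measurable_funM.
- by rewrite lee_fin ltW.
Qed.

End lebesgue_affine.

(** * Measures defined by a density *)

Section density.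
Context d (T : measurableType d) {R : realType} (mu : {measure set T -> \bar R}).
Variable f : T -> R.
Hypotheses (mf : measurable_fun setT f) (f0 : forall x, 0 <= f x).
Local Open Scope ereal_scope.

Definition density_measure (V : set T) : \bar R := \int[mu]_(x in V) (f x)%:E.

Lemma density_measure0 : density_measure set0 = 0.
Proof. exact: integral_set0. Qed.

Lemma density_measure_ge0 V : 0 <= density_measure V.
Proof. by apply: integral_ge0 => x _; rewrite lee_fin. Qed.

Lemma density_measure_sigma_additive : semi_sigma_additive density_measure.
Proof.
move=> /= F mF tF mUF; rewrite /density_measure; apply: cvg_toP.
  apply: ereal_nondecreasing_is_cvgn => m n mn.
  apply: lee_sum_nneg_natr => // k _ _; apply: integral_ge0 => x _.
  by rewrite lee_fin.
rewrite ge0_integral_bigcup//=; first exact/measurable_EFinP/measurable_funTS.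
by move=> x _; rewrite lee_fin.
Qed.
End density.

Section integral_density.
Context d (T : measurableType d) {R : realType} (mu nu : {measure set T -> \bar R}).
Variable f : T -> R.
Hypotheses (mf : measurable_fun setT f) (f0 : forall x, 0 <= f x).
Hypothesis nuE : forall V, measurable V -> nu V = density_measure mu f V.
Local Open Scope ereal_scope.
Import HBNNSimple.

Lemma ge0_integral_density (h : T -> \bar R) : measurable_fun setT h ->
  (forall x, 0 <= h x) -> \int[nu]_x h x = \int[mu]_x ((f x)%:E * h x).
Proof.
move=> mh h0; pose h_ := nnsfun_approx measurableT mh.
have fE0 x : 0 <= (f x)%:E by rewrite lee_fin.
have hcvg x : EFin \o h_ ^~ x @ \oo --> h x by exact: cvg_nnsfun_approx.
have hnd x : nondecreasing_seq (fun n => h_ n x).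
  by move=> m n mn; exact/lefP/nd_nnsfun_approx.
have mfE : measurable_fun setT (EFin \o f) by exact/measurable_EFinP.
transitivity (limn (fun n => \int[nu]_x (h_ n x)%:E)).
  rewrite -monotone_convergence//.
  - by apply: eq_integral => x _; apply/esym/cvg_lim => //; exact: hcvg.
  - by move=> n; exact/measurable_EFinP.
  - by move=> n x _; rewrite lee_fin.
  - by move=> x _ m n mn; rewrite lee_fin hnd.
transitivity (limn (fun n => \int[mu]_x ((f x)%:E * (h_ n x)%:E))); last first.
  rewrite -monotone_convergence//.
  - apply: eq_integral => x _; apply/cvg_lim => //.
    by apply: cvgeZl => //; exact: hcvg.
  - by move=> n; apply: emeasurable_funM => //; exact/measurable_EFinP.
  - by move=> n x _; rewrite mule_ge0// lee_fin.
  - by move=> x _ m n mn; rewrite lee_wpmul2l// lee_fin hnd.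
congr (limn _); apply/funext => n.
under [LHS]eq_integral do rewrite fimfunE -fsumEFin//.
rewrite [LHS]ge0_integral_fsum//; last 2 first.
  - by move=> r; exact/measurable_EFinP/measurableT_comp.
  - by move=> r x _; rewrite EFinM nnfun_muleindic_ge0.
under [RHS]eq_integral.
  move=> x xD; rewrite fimfunE -fsumEFin// ge0_mule_fsumr; last first.
    by move=> r; rewrite EFinM nnfun_muleindic_ge0.
  over.
rewrite [RHS]ge0_integral_fsum//; last 2 first.
  - move=> r; apply: emeasurable_funM => //.
    exact/measurable_EFinP/measurableT_comp.
  - by move=> r x _; rewrite EFinM mule_ge0// nnfun_muleindic_ge0.
apply: eq_fsbigr => r _; rewrite integralZl_indic_nnsfun//= integral_indic//= setIT.
rewrite nuE// /density_measure integral_mkcond.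
(* The sum over the values of the simple function ranges over all reals; negative ones have an empty
   preimage, and homogeneity is applied to the others. *)
have [r0|r0] := ltP r 0%R.
  rewrite preimage_nnfun0// [X in r%:E * X]integral0_eq ?mule0; last first.
    by move=> x _; rewrite patchE in_set0.
  by rewrite integral0_eq// => x _; rewrite indicE in_set0 mulr0 mule0.
rewrite -ge0_integralZl//.
- apply: eq_integral => x _; rewrite patchE indicE.
  by case: (_ \in _); rewrite ?(mulr1, mulr0, mule0)// muleC.
- apply/(measurable_restrictT _ _).1 => //; exact: measurable_funTS.
- by move=> x _; rewrite patchE; case: ifPn.
Qed.
End integral_density.

Section gamma_beta.
Context {R : realType}.
Local Notation mu := (@lebesgue_measure R).
Implicit Types a b x : R.

(** Density without its normalising constant, extended by 0 so that substitutions take place on the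
    whole line. *)
Definition gamma_kernel a b x : R :=
  if 0 < x then x `^ (a - 1) * expR (- (b * x)) else 0.

Definition beta_kernel a b x : R :=
  if 0 < x < 1 then x `^ (a - 1) * (1 - x) `^ (b - 1) else 0.

Lemma gamma_kernel_ge0 a b x : 0 <= gamma_kernel a b x.
Proof. by rewrite /gamma_kernel; case: ifP => // _; rewrite mulr_ge0 ?powR_ge0 ?expR_ge0. Qed.

Lemma beta_kernel_ge0 a b x : 0 <= beta_kernel a b x.
Proof. by rewrite /beta_kernel; case: ifP => // _; rewrite mulr_ge0 ?powR_ge0. Qed.

Lemma measurable_gamma_kernel a b : measurable_fun [set: R] (gamma_kernel a b).
Proof.
apply: measurable_fun_ifT => //; first exact: measurable_fun_ltr.
apply: measurable_funM; first exact: measurable_powR.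
apply: measurableT_comp => //; apply: measurable_funN.
exact: measurable_funM.
Qed.

Lemma measurable_beta_kernel a b : measurable_fun [set: R] (beta_kernel a b).
Proof.
apply: measurable_fun_ifT => //.
  by apply: measurable_and; exact: measurable_fun_ltr.
apply: measurable_funM; first exact: measurable_powR.
apply: (measurableT_comp (measurable_powR _)).
exact: measurable_funB.
Qed.

(** The integrand may be unbounded at 0, so the primitive is used on the intervals from
    [1 / (i + 2)] to 1, which exhaust the domain; the shift by 2 keeps them nondegenerate. *)
Lemma integral_powR01 a : 0 < a ->
  (\int[mu]_(x in `]0%R, 1%R]) (x `^ (a - 1))%:E = (a^-1)%:E)%E.
Proof.
move=> a0.
pose F (i : nat) : set R := `[i.+2%:R^-1, 1]%classic.
have UF : \bigcup_i F i = `]0, 1]%classic.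
  apply/seteqP; split => [x [i _]|x]; rewrite /F /= !in_itv/=.
    by move=> /andP[ix ->]; rewrite andbT (lt_le_trans _ ix)// invr_gt0.
  move=> /andP[x0 x1]; have [i xi] := ltr_add_invr x0.
  exists i => //; rewrite /F /= in_itv/= x1 andbT; rewrite add0r in xi.
  by rewrite (le_trans _ (ltW xi))// lef_pV2 ?posrE// ler_nat.
have mp (D : set R) : measurable_fun D (fun x => (x `^ (a - 1))%:E).
  apply: measurable_funTS; apply/measurable_EFinP.
  exact: measurable_powR.
have ndF : nondecreasing_seq F.
  move=> i j ij; apply/subsetPset => x; rewrite /F /= !in_itv/= => /andP[ix ->].
  by rewrite andbT (le_trans _ ix)// lef_pV2 ?posrE// ler_nat !ltnS.
have c1 : ((\int[mu]_(x in F i) (x `^ (a - 1))%:E)%E @[i --> \oo] -->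
    (\int[mu]_(x in \bigcup_i F i) (x `^ (a - 1))%:E)%E).
  apply: ge0_nondecreasing_set_cvg_integral; first exact: ndF.
  + by move=> i; exact: measurable_itv.
  + by move=> i; exact: mp.
  + by move=> i x _; rewrite lee_fin powR_ge0.
rewrite -UF; apply: (cvg_unique _ c1) => //.
have IF i : (\int[mu]_(x in F i) (x `^ (a - 1))%:E = (a^-1 * (1 - (i.+2%:R^-1) `^ a))%:E)%E.
  have i1 : (i.+2%:R^-1 < 1 :> R) by rewrite invf_lt1// ltr1n.
  have i0 : (0 < i.+2%:R^-1 :> R) by rewrite invr_gt0.
  have dp (x e : R) : 0 < x -> is_derive x 1 (fun y : R => y `^ e) (e * x `^ (e - 1))%R.
    exact: is_derive1_powR.
  have cp (x e : R) : 0 < x -> {for x, continuous (fun y : R => y `^ e)}.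
    move=> x0; apply: differentiable_continuous; apply/derivable1_diffP.
    by apply: derivable_powR; rewrite in_itv/= x0.
  rewrite (@continuous_FTC2 _ _ (fun x => a^-1 * x `^ a) _ _ i1).
  - by rewrite powR1 mulrBr mulr1 EFinB.
  - apply: continuous_in_subspaceT => x; rewrite inE/= in_itv/= => /andP[ix _].
    by apply: cp; exact: lt_le_trans ix.
  - split.
    + move=> x; rewrite in_itv/= => /andP[ix _].
      apply: derivableM => //; apply: derivable_powR; rewrite in_itv/= andbT.
      exact: lt_trans ix.
    + apply: cvg_at_right_filter; apply: cvgM; first exact: cvg_cst.
      exact: cp.
    + apply: cvg_at_left_filter; apply: cvgM; first exact: cvg_cst.
      exact: cp.
  - move=> x; rewrite in_itv/= => /andP[ix _].
    have x0 : 0 < x by exact: lt_trans ix.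
    rewrite derive1E; have dx := dp x a x0.
    rewrite derive_val /= ?scaler0 ?add0r ?addr0.
    by rewrite -[LHS]/(a^-1 * (a * _)) mulrA mulVf ?mul1r// gt_eqF.
rewrite (funext IF); apply/fine_cvgP; split; first by near=> i.
rewrite /comp /= -[X in _ --> X]mulr1; apply: cvgM; first exact: cvg_cst.
rewrite -[X in _ --> X]subr0; apply: cvgB; first exact: cvg_cst.
apply: ((cvg_at_rightP (fun x : R => x `^ a) 0 0).1 _ (fun i => i.+2%:R^-1)).
  exact: powR_cvg0.
split=> [n|]; first by rewrite invr_gt0.
have := @cvg_harmonic R; rewrite -(cvg_shiftS (@harmonic R)); exact.
Unshelve. all: end_near. Qed.

End gamma_beta.

Section gamma_integral.
Context {R : realType}.
Local Notation mu := (@lebesgue_measure R).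
Implicit Types a b x : R.
Local Open Scope ereal_scope.

(** The exponentials multiply to one in [r = s + t], and the powers of [r] together with the
    Jacobian give the shape [a1 + a2], so sum and ratio separate. The arbitrary [H] makes the
    identity yield both the Euler Beta formula and the joint law of sum and ratio. *)
Lemma gamma_beta_exchange a1 a2 b (H : R * R -> \bar R) :
  measurable_fun [set: R * R] H -> (forall p, 0 <= H p) ->
  \int[mu]_s \int[mu]_t ((gamma_kernel a1 b s * gamma_kernel a2 b t)%:E * H (s, t)) =
  \int[mu]_r \int[mu]_u ((gamma_kernel (a1 + a2) b r * beta_kernel a1 a2 u)%:E *
                          H (r * u, r * (1 - u))%R).
Proof.
move=> mH H0.
rewrite (@ge0_integral_sum_ratio _ (fun p =>
  (gamma_kernel a1 b p.1 * gamma_kernel a2 b p.2)%:E * H p))//=; last 3 first.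
- apply: emeasurable_funM => //; apply/measurable_EFinP; apply: measurable_funM.
    exact: measurableT_comp (measurable_gamma_kernel _ _) _.
  exact: measurableT_comp (measurable_gamma_kernel _ _) _.
- by move=> p; rewrite mule_ge0// lee_fin mulr_ge0// gamma_kernel_ge0.
- move=> s t; rewrite negb_and /gamma_kernel => /orP[] /negbTE ->.
    by rewrite mul0r mul0e.
  by rewrite mulr0 mul0e.
apply: eq_integral => r _; apply: eq_integral => u _.
rewrite muleA; case: ifPn => r0; last by rewrite /gamma_kernel (negbTE r0) mul0r mul0e.
congr (_ * _); rewrite -EFinM; congr EFin.
rewrite /gamma_kernel /beta_kernel r0 !pmulr_rgt0// subr_gt0.
case: (boolP (0 < u)%R) => u0; last by rewrite !(mul0r, mulr0).
case: (boolP (u < 1)%R) => u1 /=; last by rewrite !mulr0.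
have r1 : r != 0%R by rewrite gt_eqF.
rewrite !powRM ?ltW ?subr_gt0//.
have -> : (expR (- (b * r)) = expR (- (b * (r * u))) * expR (- (b * (r * (1 - u)))))%R.
  by rewrite -expRD; congr expR; ring.
have -> : (r `^ (a1 + a2 - 1) = r * r `^ (a1 - 1) * r `^ (a2 - 1))%R.
  rewrite -{2}(powRr1 (ltW r0)) -!powRD ?r1 ?implybT//.
  by congr powR; ring.
by ring.
Qed.

Lemma ge0_integral_mul (f g : R -> R) :
  measurable_fun [set: R] f -> measurable_fun [set: R] g ->
  (forall x, 0 <= f x)%R -> (forall x, 0 <= g x)%R ->
  \int[mu]_s \int[mu]_t (f s * g t)%:E = \int[mu]_s (f s)%:E * \int[mu]_t (g t)%:E.
Proof.
move=> mf mg f0 g0.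
under eq_integral => s _.
  under eq_integral do rewrite EFinM.
  rewrite ge0_integralZl//; first last.
  - by rewrite lee_fin.
  - by move=> t _; rewrite lee_fin.
  - exact/measurable_EFinP.
  over.
rewrite ge0_integralZr//; first exact/measurable_EFinP.
- by move=> t _; rewrite lee_fin.
- by apply: integral_ge0 => t _; rewrite lee_fin.
Qed.

(** An identity between extended reals on purpose: the finiteness of the Gamma integrals is deduced
    from it. *)
Lemma gamma_beta_product a1 a2 b :
  (\int[mu]_x (gamma_kernel a1 b x)%:E) * (\int[mu]_x (gamma_kernel a2 b x)%:E) =
  (\int[mu]_x (gamma_kernel (a1 + a2) b x)%:E) *
  (\int[mu]_x (beta_kernel a1 a2 x)%:E).
Proof.
rewrite -!ge0_integral_mul; try (exact: measurable_gamma_kernel || exact: measurable_beta_kernel ||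
  exact: gamma_kernel_ge0 || exact: beta_kernel_ge0).
have := @gamma_beta_exchange a1 a2 b (cst 1) (measurable_cst _) (fun=> lee01).
under eq_integral do under eq_integral do rewrite mule1.
by under [in RHS]eq_integral do under eq_integral do rewrite mule1.
Qed.

Lemma integral_gamma_kernelE a b :
  \int[mu]_x (gamma_kernel a b x)%:E =
  \int[mu]_(x in `]0%R, +oo[) (x `^ (a - 1) * expR (- (b * x)))%:E.
Proof.
rewrite [RHS]integral_mkcond; apply: eq_integral => x _; rewrite patchE /gamma_kernel.
by rewrite mem_setE in_itv/= andbT; case: ifP.
Qed.

Lemma integral_beta_kernel1 a : (0 < a)%R ->
  \int[mu]_x (beta_kernel a 1 x)%:E = (a^-1)%:E.
Proof.
move=> a0; rewrite -integral_powR01// -integral_itv_bndo_bndc; last first.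
  by apply: measurable_funTS; apply/measurable_EFinP; exact: measurable_powR.
rewrite [RHS]integral_mkcond; apply: eq_integral => x _; rewrite patchE /beta_kernel.
by rewrite mem_setE in_itv/=; case: ifP => // _; rewrite subrr powRr0 mulr1.
Qed.

Lemma integral_gamma_kernel1 b : (0 < b)%R ->
  \int[mu]_x (gamma_kernel 1 b x)%:E = (b^-1)%:E.
Proof.
move=> b0; rewrite integral_gamma_kernelE.
have mexp : measurable_fun [set: R] (fun x : R => expR (- (b * x))).
  by apply: measurableT_comp => //; apply: measurable_funN; exact: measurable_funM.
under eq_integral do rewrite subrr powRr0 mul1r.
rewrite integral_itv_obnd_cbnd; last exact/measurable_funTS/measurable_EFinP.
have := integral_exponential_pdf b0.
have -> : \int[mu]_x (exponential_pdf b x)%:E =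
    \int[mu]_(x in `[0%R, +oo[) (b%:E * (expR (- (b * x)))%:E).
  rewrite [RHS]integral_mkcond; apply: eq_integral => x _.
  rewrite /exponential_pdf !patchE; case: ifPn => //.
  by rewrite -mulNr.
rewrite ge0_integralZl//; last 2 first.
- by apply/measurable_EFinP; exact: measurable_funTS.
- by rewrite lee_fin ltW.
move=> h; have b1 : b != 0%R by rewrite gt_eqF.
have := congr1 (fun z => (b^-1)%:E * z) h.
by rewrite /= muleA -EFinM mulVf// mul1e mule1.
Qed.

(** The functional equation of Gamma, as the case [a2 = 1] of the product formula, where the second
    Gamma kernel and the Beta kernel have elementary integrals. *)
Lemma integral_gamma_kernelS a b : (0 < a)%R -> (0 < b)%R ->
  \int[mu]_x (gamma_kernel a b x)%:E * (b^-1)%:E =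
  \int[mu]_x (gamma_kernel (a + 1) b x)%:E * (a^-1)%:E.
Proof.
move=> a0 b0; rewrite -integral_gamma_kernel1// -integral_beta_kernel1//.
exact: gamma_beta_product.
Qed.

(** The functional equation lowers the shape until it is at most 1. There the kernel lies below the
    power function on []0, 1[] and below the exponential from 1 on. *)
Lemma integral_gamma_kernel_lty a b : (0 < a)%R -> (0 < b)%R ->
  \int[mu]_x (gamma_kernel a b x)%:E < +oo.
Proof.
move=> a0 b0.
have [n an] : exists n : nat, (a <= n.+1%:R)%R.
  exists (Num.truncn a); exact/ltW/truncnS_gt.
elim: n a a0 an => [|n IH] a a0 an.
  have mexp : measurable_fun [set: R] (EFin \o gamma_kernel 1 b).
    by apply/measurable_EFinP; exact: measurable_gamma_kernel.
  have mbeta : measurable_fun [set: R] (EFin \o beta_kernel a 1).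
    by apply/measurable_EFinP; exact: measurable_beta_kernel.
  apply: (@le_lt_trans _ _ (\int[mu]_x ((beta_kernel a 1 x)%:E + (gamma_kernel 1 b x)%:E))).
    apply: ge0_le_integral => //.
    - by move=> x _; rewrite lee_fin gamma_kernel_ge0.
    - by apply/measurable_EFinP; exact: measurable_gamma_kernel.
    - exact: emeasurable_funD.
    move=> x _; rewrite -EFinD lee_fin /gamma_kernel /beta_kernel subrr !powRr0 mul1r mulr1.
    case: (ltP 0%R x) => x0 /=; last by rewrite addr0.
    case: (ltP x 1%R) => x1 /=.
      rewrite -[leLHS]addr0 lerD ?expR_ge0// ler_piMr ?powR_ge0//.
      by rewrite expR_le1 oppr_le0 mulr_ge0// ltW.
    rewrite add0r ler_piMl ?expR_ge0//.
    by rewrite -[leRHS](powRr0 x) ler_powR// subr_le0.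
  rewrite ge0_integralD//; last 2 first.
  - by move=> x _; rewrite lee_fin beta_kernel_ge0.
  - by move=> x _; rewrite lee_fin gamma_kernel_ge0.
  by rewrite integral_beta_kernel1// integral_gamma_kernel1// -EFinD ltry.
have [a1|a1] := leP a 1%R; first by apply: IH => //; rewrite (le_trans a1)// ler1n.
have a10 : (0 < a - 1)%R by rewrite subr_gt0.
have := @integral_gamma_kernelS (a - 1) b a10 b0.
rewrite subrK => h.
have fin1 : \int[mu]_x (gamma_kernel (a - 1) b x)%:E < +oo.
  by apply: IH => //; rewrite lerBlDr natr1.
have I0 : 0 <= \int[mu]_x (gamma_kernel a b x)%:E.
  by apply: integral_ge0 => x _; rewrite lee_fin gamma_kernel_ge0.
have I1 : 0 <= \int[mu]_x (gamma_kernel (a - 1) b x)%:E.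
  by apply: integral_ge0 => x _; rewrite lee_fin gamma_kernel_ge0.
move: h I0 I1 fin1.
case: (\int[mu]_x (gamma_kernel (a - 1) b x)%:E) => [r| |]//.
case: (\int[mu]_x (gamma_kernel a b x)%:E) => [s| |]//; first by rewrite ?ltry.
by move=> + _ _ _; rewrite gt0_mulye ?lte_fin ?invr_gt0.
Qed.

(** On []0, 1[] the exponential factor is at least [expR (- b)], and the remaining power has
    integral [a^-1]. *)
Lemma integral_gamma_kernel_gt0 a b : (0 < a)%R -> (0 < b)%R ->
  0 < \int[mu]_x (gamma_kernel a b x)%:E.
Proof.
move=> a0 b0.
have mbeta : measurable_fun [set: R] (EFin \o beta_kernel a 1).
  by apply/measurable_EFinP; exact: measurable_beta_kernel.
apply: (@lt_le_trans _ _ (\int[mu]_x ((expR (- b))%:E * (beta_kernel a 1 x)%:E))).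
  rewrite ge0_integralZl//; last by move=> x _; rewrite lee_fin beta_kernel_ge0.
  by rewrite integral_beta_kernel1// -EFinM lte_fin mulr_gt0 ?expR_gt0 ?invr_gt0.
apply: ge0_le_integral => //.
- by move=> x _; rewrite mule_ge0 ?lee_fin ?expR_ge0 ?beta_kernel_ge0.
- by apply: emeasurable_funM => //.
- by apply/measurable_EFinP; exact: measurable_gamma_kernel.
move=> x _; rewrite -EFinM lee_fin /gamma_kernel /beta_kernel subrr powRr0 mulr1.
case: (ltP 0%R x) => x0 /=; last by rewrite mulr0.
case: (ltP x 1%R) => x1; last by rewrite mulr0 mulr_ge0 ?powR_ge0 ?expR_ge0.
by rewrite mulrC ler_wpM2l ?powR_ge0// ler_expR lerN2 ler_piMr ?ltW.
Qed.

Lemma Gamma_integral a : (0 < a)%R ->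
  \int[mu]_x (gamma_kernel a 1 x)%:E = (Gamma a)%:E.
Proof.
move=> a0; have fin := integral_gamma_kernel_lty a0 ltr01.
have pos := integral_gamma_kernel_gt0 a0 ltr01.
rewrite /Gamma /Rintegral -[LHS]fineK ?ge0_fin_numE ?ltW//.
rewrite integral_gamma_kernelE; congr (fine _)%:E.
by apply: eq_integral => x _; rewrite mul1r.
Qed.

#[local] Opaque Gamma.

Lemma Gamma_gt0 a : (0 < a)%R -> (0 < Gamma a)%R.
Proof.
by move=> a0; rewrite -lte_fin -Gamma_integral// integral_gamma_kernel_gt0.
Qed.

Lemma integral_gamma_kernel a b : (0 < a)%R -> (0 < b)%R ->
  \int[mu]_x (gamma_kernel a b x)%:E = (Gamma a / b `^ a)%:E.
Proof.
move=> a0 b0; rewrite EFinM -Gamma_integral// muleC.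
rewrite [in RHS](ge0_integral_scale b0)/=; last 2 first.
- by apply/measurable_EFinP; exact: measurable_gamma_kernel.
- by move=> x; rewrite lee_fin gamma_kernel_ge0.
have -> : \int[mu]_x (gamma_kernel a 1 (b * x))%:E =
    \int[mu]_x ((b `^ (a - 1))%:E * (gamma_kernel a b x)%:E).
  apply: eq_integral => x _; rewrite -EFinM; congr EFin.
  rewrite /gamma_kernel pmulr_rgt0// mul1r; case: ifP => x0; last by rewrite mulr0.
  by rewrite powRM ?mulrA// ltW.
rewrite ge0_integralZl//; last 3 first.
- by apply/measurable_EFinP; exact: measurable_gamma_kernel.
- by move=> x _; rewrite lee_fin gamma_kernel_ge0.
- by rewrite lee_fin powR_ge0.
rewrite !muleA -!EFinM -mulrA mulr_powRB1 ?ltW// mulVf ?mul1e//.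
by rewrite gt_eqF// powR_gt0.
Qed.

Lemma GammaS a : (0 < a)%R -> Gamma (a + 1) = (a * Gamma a)%R.
Proof.
move=> a0; have := integral_gamma_kernelS a0 ltr01.
rewrite !Gamma_integral ?addr_gt0// invr1 mule1 => -[->].
by rewrite mulrCA mulfV ?mulr1// gt_eqF.
Qed.

Lemma integral_beta_kernel a1 a2 : (0 < a1)%R -> (0 < a2)%R ->
  \int[mu]_x (beta_kernel a1 a2 x)%:E = (Gamma a1 * Gamma a2 / Gamma (a1 + a2))%:E.
Proof.
move=> a10 a20; have := gamma_beta_product a1 a2 1.
have g0 : (0 < Gamma (a1 + a2))%R by rewrite Gamma_gt0 ?addr_gt0.
rewrite !Gamma_integral ?addr_gt0// => h.
move: (\int[mu]_x _) (Gamma a1) (Gamma a2) (Gamma (a1 + a2)) h g0 => I G1 G2 G12 h g0.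
have := congr1 (fun z => G12^-1%:E * z) h.
by rewrite /= !muleA -!EFinM mulVf ?gt_eqF// mul1e => <-; congr EFin; ring.
Qed.

(** The rising factorial from [x] to [x + k - 1], indexed from 1 as in [pag_pmf]. *)
Definition rising (x : R) (k : nat) : R := \prod_(1 <= j < k.+1) (x + j%:R - 1)%R.

Lemma rising0 x : rising x 0 = 1%R.
Proof. by rewrite /rising big_nil. Qed.

Lemma risingS x k : rising x k.+1 = (rising x k * (x + k%:R))%R.
Proof. by rewrite /rising big_nat_recr//= -natr1 addrA addrK. Qed.

Lemma risingD x j k : rising x (j + k) = (rising x j * rising (x + j%:R) k)%R.
Proof.
elim: k => [|k IH]; first by rewrite addn0 rising0 mulr1.
by rewrite addnS !risingS IH natrD addrA mulrA.
Qed.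

Lemma rising_gt0 x k : (0 < x)%R -> (0 < rising x k)%R.
Proof.
move=> x0; elim: k => [|k IH]; first by rewrite rising0.
by rewrite risingS mulr_gt0// ltr_wpDr.
Qed.

Lemma GammaD a k : (0 < a)%R -> Gamma (a + k%:R) = (rising a k * Gamma a)%R.
Proof.
move=> a0; elim: k => [|k IH]; first by rewrite addr0 rising0 mul1r.
rewrite -natr1 addrA risingS (mulrC _ (a + _)%R) -mulrA -IH.
by apply: GammaS; rewrite ltr_wpDr.
Qed.

End gamma_integral.

(** * Gamma laws and Beta means *)

Section gamma_probability.
Context {R : realType}.
Local Notation mu := (@lebesgue_measure R).
Local Notation rT := (measurableTypeR R).
Implicit Types a b x : R.
Local Open Scope ereal_scope.

Lemma powRD_gt0 x r s : (0 < x)%R -> (x `^ (r + s) = x `^ r * x `^ s)%R.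
Proof. by move=> x0; rewrite powRD//; apply/implyP => _; rewrite gt_eqF. Qed.

Lemma gamma_pdfE a b x :
  gamma_pdf x a b = (gamma_kernel a b x * (b `^ a / Gamma a))%R.
Proof.
rewrite /gamma_pdf /gamma_kernel; case: ifP => _; last by rewrite mul0r.
by ring.
Qed.

Lemma measurable_gamma_pdf a b : measurable_fun [set: R] (fun x => gamma_pdf x a b).
Proof.
rewrite (_ : (fun x => _) = fun x => gamma_kernel a b x * (b `^ a / Gamma a))%R; last first.
  by apply/funext => x; exact: gamma_pdfE.
by apply: measurable_funM => //; exact: measurable_gamma_kernel.
Qed.

Section positive.
Variables a b : R.
Hypotheses (a0 : (0 < a)%R) (b0 : (0 < b)%R).

Lemma gamma_pdf_ge0 x : (0 <= gamma_pdf x a b)%R.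
Proof.
rewrite gamma_pdfE mulr_ge0 ?gamma_kernel_ge0// divr_ge0 ?powR_ge0//.
by rewrite ltW// Gamma_gt0.
Qed.

Lemma integral_gamma_pdf : \int[mu]_x (gamma_pdf x a b)%:E = 1.
Proof.
under eq_integral do rewrite gamma_pdfE EFinM.
rewrite ge0_integralZr//.
- rewrite integral_gamma_kernel// -EFinM; congr EFin.
  have g0 := Gamma_gt0 a0; have p0 : (0 < b `^ a)%R by rewrite powR_gt0.
  by field; rewrite !gt_eqF.
- by apply/measurable_EFinP; exact: measurable_gamma_kernel.
- by move=> x _; rewrite lee_fin gamma_kernel_ge0.
- by rewrite lee_fin divr_ge0 ?powR_ge0// ltW// Gamma_gt0.
Qed.

Let pdf x := gamma_pdf x a b.
Let nu : set rT -> \bar R := @density_measure _ rT R mu pdf.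
Let nu_isMeasure := isMeasure.Build _ rT R nu (@density_measure0 _ rT R mu pdf)
  (@density_measure_ge0 _ rT R mu pdf gamma_pdf_ge0)
  (@density_measure_sigma_additive _ rT R mu pdf (measurable_gamma_pdf a b) gamma_pdf_ge0).
Let nu_measure : {measure set rT -> \bar R} := HB.pack nu nu_isMeasure.
Let nu_isProbability := Measure_isProbability.Build _ rT R nu_measure integral_gamma_pdf.
Definition gamma_probability_of_pos : probability rT R :=
  HB.pack (nu_measure : set rT -> \bar R) nu_measure nu_isProbability.

End positive.

(* The law with shape 0, that of an empty sum, is the Dirac mass at 0. *)
Definition gamma_probability a b : probability rT R :=
  match pselect ((0 < a)%R /\ (0 < b)%R) with
  | left ab => gamma_probability_of_pos ab.1 ab.2
  | right _ => \d_(0%R : rT)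
  end.

Lemma gamma_probabilityE a b V : (0 < a)%R -> (0 < b)%R ->
  gamma_probability a b V = \int[mu]_(x in V) (gamma_pdf x a b)%:E.
Proof.
by move=> a0 b0; rewrite /gamma_probability; case: pselect => // -[].
Qed.

Lemma integral_gamma_probability a b (h : R -> \bar R) :
  (0 < a)%R -> (0 < b)%R -> measurable_fun [set: R] h -> (forall x, 0 <= h x) ->
  \int[gamma_probability a b]_x h x = \int[mu]_x ((gamma_pdf x a b)%:E * h x).
Proof.
move=> a0 b0 mh h0.
apply: (@ge0_integral_density _ rT R mu (gamma_probability a b)
  (fun x => gamma_pdf x a b) (measurable_gamma_pdf a b) (gamma_pdf_ge0 b a0)) => //.
by move=> V mV; exact: gamma_probabilityE.
Qed.

Lemma integral_gamma_probability_kernel a b (h : R -> \bar R) :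
  (0 < a)%R -> (0 < b)%R -> measurable_fun [set: R] h -> (forall x, 0 <= h x) ->
  \int[gamma_probability a b]_x h x =
  (b `^ a / Gamma a)%:E * \int[mu]_x ((gamma_kernel a b x)%:E * h x).
Proof.
move=> a0 b0 mh h0; rewrite integral_gamma_probability// -ge0_integralZl//.
- by apply: eq_integral => x _; rewrite gamma_pdfE mulrC EFinM muleA.
- apply: emeasurable_funM => //; apply/measurable_EFinP.
  exact: measurable_gamma_kernel.
- by move=> x _; rewrite mule_ge0// lee_fin gamma_kernel_ge0.
- by rewrite lee_fin divr_ge0 ?powR_ge0// ltW// Gamma_gt0.
Qed.

Lemma integral_gamma_probability0 b (h : R -> \bar R) :
  measurable_fun [set: R] h -> \int[gamma_probability 0 b]_x h x = h 0%R.
Proof.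
move=> mh; rewrite /gamma_probability; case: pselect => [ab|_].
  by exfalso; have := ab.1; rewrite ltxx.
by rewrite integral_dirac// diracT mul1e.
Qed.

(** A power of [x] in front of a Gamma density raises its shape, and the ratio of the normalising
    constants is the rising factorial over a power of the rate. The absolute value acts off the
    support only, where it keeps the integrand nonnegative. *)
Lemma gamma_probability_moment a b (k : nat) (h : R -> \bar R) :
  (0 < a)%R -> (0 < b)%R -> measurable_fun [set: R] h -> (forall x, 0 <= h x) ->
  \int[gamma_probability a b]_x ((`|x| ^+ k)%:E * h x) =
  (rising a k / b ^+ k)%:E * \int[gamma_probability (a + k%:R) b]_x h x.
Proof.
move=> a0 b0 mh h0; have ak0 : (0 < a + k%:R)%R by rewrite ltr_wpDr.
have mX : measurable_fun [set: R] (fun x : R => (`|x| ^+ k)%:E).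
  by apply/measurable_EFinP; apply: measurable_funX; exact: normr_measurable.
rewrite !integral_gamma_probability_kernel//; last 2 first.
- exact: emeasurable_funM.
- by move=> x; rewrite mule_ge0// lee_fin exprn_ge0.
rewrite muleA -EFinM; congr (_%:E * _).
  rewrite GammaD// powRD_gt0// powR_mulrn ?ltW//.
  have g0 := Gamma_gt0 a0; have r0 := rising_gt0 k a0.
  have bk : (b ^+ k != 0)%R by rewrite expf_neq0// gt_eqF.
  by field; rewrite bk !gt_eqF.
apply: eq_integral => x _; rewrite muleA -EFinM; congr (_%:E * _).
rewrite /gamma_kernel; case: ifP => x0; last by rewrite mul0r.
rewrite gtr0_norm// -powR_mulrn ?ltW// mulrAC -powRD_gt0//.
by congr (_ `^ _ * _)%R; ring.
Qed.

Definition beta_mean a1 a2 (f : R -> \bar R) : \bar R :=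
  (Gamma (a1 + a2) / (Gamma a1 * Gamma a2))%:E *
  \int[mu]_u ((beta_kernel a1 a2 u)%:E * f u).

Lemma beta_mean_cst a1 a2 (c : \bar R) : (0 < a1)%R -> (0 < a2)%R -> 0 <= c ->
  beta_mean a1 a2 (cst c) = c.
Proof.
move=> a10 a20 c0; rewrite /beta_mean ge0_integralZr//; last 2 first.
- by apply/measurable_EFinP; exact: measurable_beta_kernel.
- by move=> u _; rewrite lee_fin beta_kernel_ge0.
have g12 := Gamma_gt0 (addr_gt0 a10 a20).
have g1 := Gamma_gt0 a10; have g2 := Gamma_gt0 a20.
rewrite integral_beta_kernel// muleA -EFinM.
move: (Gamma a1) (Gamma a2) (Gamma (a1 + a2)) g1 g2 g12 => G1 G2 G12 g1 g2 g12.
rewrite (_ : (_ * _)%R = 1%R) ?mul1e//.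
by field; rewrite !gt_eqF.
Qed.

(** For independent Gamma variables of equal rate the sum is Gamma, and the share of the first one
    is an independent Beta variable. After [gamma_beta_exchange] it remains to match constants: the
    powers of [b] combine, and the values of [Gamma] leave the Beta normalisation. *)
Lemma gamma_probability_split a1 a2 b (H : R * R -> \bar R) :
  (0 < a1)%R -> (0 < a2)%R -> (0 < b)%R ->
  measurable_fun [set: R * R] H -> (forall p, 0 <= H p) ->
  \int[gamma_probability a1 b]_s \int[gamma_probability a2 b]_t H (s, t) =
  \int[gamma_probability (a1 + a2) b]_r
    beta_mean a1 a2 (fun u => H (r * u, r * (1 - u))%R).
Proof.
move=> a10 a20 b0 mH H0.
have a120 : (0 < a1 + a2)%R by rewrite addr_gt0.
have g1 := Gamma_gt0 a10; have g2 := Gamma_gt0 a20; have g12 := Gamma_gt0 a120.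
have mH1 s : measurable_fun [set: R] (fun t => H (s, t)).
  exact: measurableT_comp mH (pair1_measurable _).
rewrite integral_gamma_probability_kernel//; last 2 first.
- exact: (@measurable_fun_fubini_tonelli_F _ _ rT rT R (gamma_probability a2 b) H).
- by move=> s; apply: integral_ge0.
transitivity ((b `^ a1 / Gamma a1)%:E * \int[mu]_s ((b `^ a2 / Gamma a2)%:E *
    \int[mu]_t ((gamma_kernel a1 b s * gamma_kernel a2 b t)%:E * H (s, t)))).
  congr (_ * _); apply: eq_integral => s _.
  rewrite integral_gamma_probability_kernel// muleCA; congr (_ * _).
  rewrite -ge0_integralZl//.
  - by apply: eq_integral => t _; rewrite EFinM muleA.
  - apply: emeasurable_funM; last exact: mH1.
    by apply/measurable_EFinP; exact: measurable_gamma_kernel.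
  - by move=> t _; rewrite mule_ge0// lee_fin gamma_kernel_ge0.
  - by rewrite lee_fin gamma_kernel_ge0.
rewrite ge0_integralZl//; last 3 first.
- apply: (@measurable_fun_fubini_tonelli_F _ _ rT rT R mu
    (fun p : R * R => (gamma_kernel a1 b p.1 * gamma_kernel a2 b p.2)%:E * H p)) => //.
    apply: emeasurable_funM => //; apply/measurable_EFinP; apply: measurable_funM.
      exact: measurableT_comp (measurable_gamma_kernel _ _) _.
    exact: measurableT_comp (measurable_gamma_kernel _ _) _.
  by move=> p; rewrite mule_ge0// lee_fin mulr_ge0// gamma_kernel_ge0.
- move=> s _; apply: integral_ge0 => t _.
  by rewrite mule_ge0// lee_fin mulr_ge0// gamma_kernel_ge0.
- by rewrite lee_fin divr_ge0 ?powR_ge0 ?(ltW g2).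
rewrite (gamma_beta_exchange a1 a2 b)//=.
pose T (p : R * R) := (beta_kernel a1 a2 p.2)%:E * H (p.1 * p.2, p.1 * (1 - p.2))%R.
have mT : measurable_fun [set: R * R] T.
  apply: emeasurable_funM.
    by apply/measurable_EFinP; apply: measurableT_comp (measurable_beta_kernel _ _) _.
  apply: measurableT_comp mH _; apply: measurable_fun_pair => /=.
    exact: measurable_funM.
  by apply: measurable_funM => //; exact: measurable_funB.
have T0 p : 0 <= T p by rewrite mule_ge0// lee_fin beta_kernel_ge0.
have mT1 r : measurable_fun [set: R] (fun u => T (r, u)).
  exact: measurableT_comp mT (pair1_measurable _).
have mF : measurable_fun [set: R] (fun r => \int[mu]_u T (r, u)).
  exact: (@measurable_fun_fubini_tonelli_F _ _ rT rT R mu T).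
have F0 r : 0 <= \int[mu]_u T (r, u) by exact: integral_ge0.
have c0 : (0 <= Gamma (a1 + a2) / (Gamma a1 * Gamma a2))%R.
  exact: (divr_ge0 (ltW g12) (mulr_ge0 (ltW g1) (ltW g2))).
rewrite integral_gamma_probability_kernel//; last 2 first.
- exact: emeasurable_funM.
- by move=> r; apply: mule_ge0; [exact: c0|exact: F0].
transitivity ((b `^ a1 / Gamma a1)%:E * ((b `^ a2 / Gamma a2)%:E *
    \int[mu]_r ((gamma_kernel (a1 + a2) b r)%:E * \int[mu]_u T (r, u)))).
  congr (_ * (_ * _)); apply: eq_integral => r _; rewrite -ge0_integralZl//.
  - by apply: eq_integral => u _; rewrite /T EFinM muleA.
  - exact: mT1.
  - by rewrite lee_fin gamma_kernel_ge0.
move: c0; rewrite /beta_mean.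
have [c cE] : exists c, c = (Gamma (a1 + a2) / (Gamma a1 * Gamma a2))%R by eexists.
rewrite -cE => c0.
have -> : \int[mu]_r ((gamma_kernel (a1 + a2) b r)%:E * (c%:E * \int[mu]_u T (r, u))) =
    c%:E * \int[mu]_r ((gamma_kernel (a1 + a2) b r)%:E * \int[mu]_u T (r, u)).
  rewrite -ge0_integralZl//; first by apply: eq_integral => r _; rewrite muleCA.
  - by apply: emeasurable_funM => //; apply/measurable_EFinP; exact: measurable_gamma_kernel.
  - by move=> r _; rewrite mule_ge0// lee_fin gamma_kernel_ge0.
move: (\int[mu]_r _) => I; rewrite cE.
move: (Gamma a1) (Gamma a2) (Gamma (a1 + a2)) g1 g2 g12 {c c0 cE} => G1 G2 G12 g1 g2 g12.
rewrite !muleA -!EFinM; congr (_%:E * _).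
rewrite powRD_gt0//.
by field; rewrite !gt_eqF.
Qed.

Lemma gamma_probability_conv a1 a2 b (h : R -> \bar R) :
  (0 <= a1)%R -> (0 <= a2)%R -> (0 < b)%R ->
  measurable_fun [set: R] h -> (forall x, 0 <= h x) ->
  \int[gamma_probability a1 b]_s \int[gamma_probability a2 b]_t h (s + t)%R =
  \int[gamma_probability (a1 + a2) b]_r h r.
Proof.
move=> a10 a20 b0 mh h0.
have mhs s : measurable_fun [set: R] (fun t => h (s + t)%R).
  by apply: measurableT_comp mh _; exact: measurable_funD.
have mhD : measurable_fun [set: R * R] (fun p : R * R => h (p.1 + p.2)%R).
  by apply: measurableT_comp mh _; exact: measurable_funD.
have [a1E|a1N] := eqVneq a1 0%R.
  rewrite a1E add0r integral_gamma_probability0.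
    by under eq_integral do rewrite add0r.
  exact: (@measurable_fun_fubini_tonelli_F _ _ rT rT R (gamma_probability a2 b)
    (fun p : R * R => h (p.1 + p.2)%R)).
have [a2E|a2N] := eqVneq a2 0%R.
  rewrite a2E addr0; apply: eq_integral => s _.
  by rewrite integral_gamma_probability0// addr0.
have {}a10 : (0 < a1)%R by rewrite lt_neqAle eq_sym a1N.
have {}a20 : (0 < a2)%R by rewrite lt_neqAle eq_sym a2N.
rewrite (gamma_probability_split (H := fun p => h (p.1 + p.2)%R))//=.
apply: eq_integral => r _; rewrite -[RHS](beta_mean_cst a10 a20)//.
congr beta_mean; apply/funext => u /=; congr h.
by ring.
Qed.
End gamma_probability.

(** * The inverse Gamma distribution function *)

Section gamma_cdf_inverse.
Context {R : realType}.
Local Notation mu := (@lebesgue_measure R).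
Local Notation rT := (measurableTypeR R).
Variables kappa rho : R.
Hypotheses (kappa_gt0 : 0 < kappa) (rho_gt0 : 0 < rho).

Let beta := kappa / rho.
Let beta_gt0 : 0 < beta. Proof. exact: divr_gt0. Qed.
Let pdf x := gamma_pdf x kappa beta.
Let G := gamma_probability kappa beta.
Let F := gamma_cdf kappa rho.
Let Finv := gamma_cdf_inv kappa rho.

Let pdf_ge0 x : 0 <= pdf x. Proof. exact: gamma_pdf_ge0. Qed.
Let mpdf (D : set R) : measurable_fun D pdf.
Proof. by apply: measurable_funTS; exact: measurable_gamma_pdf. Qed.
Let pdf_le0 x : x <= 0 -> pdf x = 0.
Proof. by move=> x0; rewrite /pdf /gamma_pdf ltNge x0. Qed.
Let pdf_gt0 x : 0 < x -> 0 < pdf x.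
Proof.
move=> x0; rewrite /pdf /gamma_pdf x0 mulr_gt0 ?powR_gt0//.
by rewrite divr_gt0 ?mulr_gt0 ?powR_gt0 ?expR_gt0 ?Gamma_gt0.
Qed.

Let GE (V : set R) : (G V = \int[mu]_(x in V) (pdf x)%:E)%E.
Proof. exact: gamma_probabilityE. Qed.

Lemma gamma_cdfE z : 0 <= z -> ((F z)%:E = G `]-oo, z]%classic)%E.
Proof.
move=> z0; rewrite GE /F /gamma_cdf /Rintegral fineK.
  rewrite [LHS]integral_mkcond [RHS]integral_mkcond; apply: eq_integral => x _.
  rewrite !patchE !mem_setE !in_itv/=.
  have [x0|x0] := leP 0 x => //=; case: ifPn => // _.
  by rewrite pdf_le0// ltW.
rewrite -(GE `[0, z]%classic) ge0_fin_numE//.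
by rewrite (le_lt_trans (probability_le1 _ _))// ltry.
Qed.

Let G_itvE y z : 0 <= y <= z -> (G `]y, z]%classic = (F z - F y)%:E)%E.
Proof.
move=> /andP[y0 yz]; have z0 := le_trans y0 yz.
rewrite EFinB !gamma_cdfE//.
have -> : `]y, z]%classic = `]-oo, z]%classic `\` `]-oo, y]%classic.
  apply/seteqP; split=> x /=; rewrite !in_itv/=.
    by move=> /andP[yx ->]; split => //; apply/negP; rewrite -ltNge.
  by move=> [-> /negP]; rewrite -ltNge => ->.
rewrite measureD//; last by rewrite (le_lt_trans (probability_le1 _ _))// ltry.
congr (_ - G _)%E; apply/seteqP; split=> x /=; rewrite !in_itv/=; first by case.
by move=> xy; split => //; exact: le_trans yz.
Qed.

(** A vanishing integral of the positive density would make an interval of positive length Lebesgue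
    null. *)
Let G_itv_gt0 y z : 0 <= y < z -> (0 < G `]y, z]%classic)%E.
Proof.
move=> /andP[y0 yz]; rewrite lt_neqAle measure_ge0 andbT eq_sym; apply/eqP => G0.
have : (\int[mu]_(x in `]y, z]) `|(pdf x)%:E| = 0)%E.
  by rewrite -G0 GE; apply: eq_integral => x _; rewrite gee0_abs// lee_fin.
move/ae_eq_integral_abs => /=.
have mE : measurable_fun `]y, z]%classic (fun x => (pdf x)%:E) by exact/measurable_EFinP.
move=> /(_ (measurable_itv _) mE) [N [mN N0 sub]].
have : (mu `]y, z]%classic <= 0)%E.
  rewrite -N0; apply: le_measure; rewrite ?inE//.
  move=> x /= xyz; apply: sub => /= /(_ xyz) [] /eqP; rewrite gt_eqF// pdf_gt0//.
  by move: xyz; rewrite in_itv/= => /andP[yx _]; exact: le_lt_trans yx.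
by rewrite lebesgue_measure_itv/= lte_fin yz -EFinB lee_fin subr_le0 leNgt yz.
Qed.

Lemma gamma_cdf_lt y z : 0 <= y < z -> F y < F z.
Proof.
move=> /andP[y0 yz]; rewrite -subr_gt0 -lte_fin -G_itvE ?y0 ?ltW//.
by rewrite G_itv_gt0// y0.
Qed.

Lemma gamma_cdf_le y z : 0 <= y -> 0 <= z -> (F y <= F z) = (y <= z).
Proof.
move=> y0 z0; have [yz|zy|->] := ltgtP y z; last by rewrite lexx.
  by rewrite ltW// gamma_cdf_lt// y0.
by apply/negbTE; rewrite -ltNge gamma_cdf_lt// z0.
Qed.

Lemma gamma_cdf0 : F 0 = 0.
Proof.
apply: EFin_inj; rewrite gamma_cdfE// GE.
by apply: integral0_eq => x /=; rewrite in_itv/= => x0; rewrite pdf_le0.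
Qed.

Lemma gamma_cdf_cvg1 : (F n%:R @[n --> \oo] --> (1 : R)).
Proof.
have : (G `]-oo, n%:R]%classic @[n --> \oo] --> G (\bigcup_n `]-oo, n%:R]%classic))%E.
  apply: nondecreasing_cvg_mu => //; first exact: bigcup_measurable.
  move=> n p np; apply/subsetPset => x/=; rewrite !in_itv/= => /le_trans.
  by apply; rewrite ler_nat.
have -> : \bigcup_n `]-oo, n%:R]%classic = [set: R].
  rewrite -subTset => t _/=.
  by exists (Num.truncn t).+1 => //=; rewrite in_itv/= ltW// truncnS_gt.
rewrite probability_setT.
rewrite -(funext (fun n => gamma_cdfE (ler0n R n))).
by move/fine_cvgP => [_].
Qed.

Lemma gamma_cdf_lt1 z : 0 <= z -> F z < 1.
Proof.
move=> z0; apply: (@lt_le_trans _ _ (F (z + 1))).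
  by rewrite gamma_cdf_lt// z0 ltrDl ltr01.
by rewrite -lee_fin gamma_cdfE ?addr_ge0// probability_le1.
Qed.

Lemma gamma_cdf_surj p : 0 < p < 1 -> exists2 z, 0 < z & F z = p.
Proof.
move=> /andP[p0 p1].
have [n pn] : exists n : nat, p < F n.+1%:R.
  have /cvgrPdist_lt /(_ (1 - p)) := gamma_cdf_cvg1.
  rewrite subr_gt0 => /(_ p1) [N _ /(_ N.+1)] /= => /(_ (leqnSn _)) h.
  exists N; move: h; rewrite gtr0_norm ?subr_gt0 ?gamma_cdf_lt1//.
  by rewrite ltrD2l ltrN2.
have int : mu.-integrable `[0, n.+1%:R] (EFin \o pdf).
  apply/integrableP; split; first by apply/measurable_EFinP; exact: mpdf.
  under eq_integral do rewrite gee0_abs ?lee_fin//.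
  by rewrite -(GE `[0, n.+1%:R]%classic) (le_lt_trans (probability_le1 _ _))// ltry.
have cF : {within `[0, n.+1%:R], continuous F}.
  exact: (@parameterized_integral_continuous R 0 n.+1%:R pdf (ler0n _ _) int).
have F0n : F 0 <= F n.+1%:R by rewrite gamma_cdf_le.
have [|z] := IVT (v := p) (ler0n _ _) cF.
  by rewrite (min_idPl F0n) (max_idPr F0n) gamma_cdf0 !ltW.
rewrite in_itv/= => /andP[z0 _] Fz; exists z => //.
rewrite lt_neqAle z0 andbT; apply/eqP => z0'; move: p0; rewrite -Fz -z0'.
by rewrite gamma_cdf0 ltxx.
Qed.

Let F_inj : {in `]0, +oo[%classic &, injective F}.
Proof.
move=> y z; rewrite !inE /= !in_itv/= !andbT => y0 z0 /eqP.
by rewrite eq_le !gamma_cdf_le ?(ltW y0) ?(ltW z0)// => yz; apply/eqP; rewrite eq_le.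
Qed.

Lemma gamma_cdf_invK p : 0 < p < 1 -> 0 < Finv p /\ F (Finv p) = p.
Proof.
move=> /gamma_cdf_surj [z z0 <-].
rewrite /Finv /gamma_cdf_inv (pinvKV _ F_inj)//.
by rewrite inE /= in_itv/= andbT.
Qed.

Lemma gamma_cdf_inv_out p : ~~ (0 < p < 1) -> Finv p = 0.
Proof.
move=> p01.
have : ~ (F @` `]0, +oo[%classic) p.
  move=> [z /=]; rewrite in_itv/= andbT => z0 Fz; move/negP: p01; apply.
  by rewrite -Fz gamma_cdf_lt1 ?ltW// andbT -gamma_cdf0 gamma_cdf_lt// lexx.
rewrite /Finv /gamma_cdf_inv => hp.
by rewrite /pinv_ splitV oinv_surj; case: pselect.
Qed.

Lemma gamma_cdf_inv_ge0 p : 0 <= Finv p.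
Proof.
have [/gamma_cdf_invK[/ltW//]|/gamma_cdf_inv_out ->//] := boolP (0 < p < 1).
Qed.

(** This equivalence turns preimages of half-lines into intervals, from which both the measurability
    and the law of the inverse follow. The bound [p < 1] is there because the inverse takes the
    default value 0 from 1 on. *)
Lemma le_gamma_cdf_inv r p : 0 < r -> (r <= Finv p) = (F r <= p < 1).
Proof.
move=> r0; have [p01|p01] := boolP (0 < p < 1).
  have [Fp0 FFp] := gamma_cdf_invK p01.
  rewrite -(gamma_cdf_le (ltW r0) (ltW Fp0)) -/Finv FFp.
  by move: p01 => /andP[_ ->]; rewrite andbT.
rewrite gamma_cdf_inv_out// leNgt r0; apply/esym/negbTE.
apply: contra p01 => /andP[Frp ->]; rewrite andbT (lt_le_trans _ Frp)//.
by rewrite -gamma_cdf0 gamma_cdf_lt// lexx.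
Qed.

Lemma measurable_gamma_cdf_inv : measurable_fun [set: R] Finv.
Proof.
apply: (measurability (@RGenCInfty.G R)) => [|/= _ [_] [r] -> <-].
  exact: RGenCInfty.measurableE.
rewrite setTI; have [r0|r0] := leP r 0.
  rewrite (_ : _ @^-1` _ = setT)//; apply/seteqP; split => x //= _.
  by rewrite in_itv/= andbT (le_trans r0)// gamma_cdf_inv_ge0.
rewrite (_ : _ @^-1` _ = `[F r, 1[%classic); first exact: measurable_itv.
by apply/seteqP; split => x /=; rewrite !in_itv/= andbT le_gamma_cdf_inv.
Qed.

Let mFinv := isMeasurableFun.Build _ _ rT rT (Finv : rT -> rT) measurable_gamma_cdf_inv.
Let FinvM : {mfun rT >-> rT} := HB.pack (Finv : rT -> rT) mFinv.
Let mu01 := unit_itv_measure R.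
Let nu : probability rT R := distribution mu01 FinvM.

Let mu01E (A : set R) : measurable A -> (mu01 A = mu (A `&` `[0%R, 1%R]))%E.
Proof.
move=> mA; transitivity (\int[mu01]_x (\1_A x)%:E)%E.
  by rewrite integral_indic// setIT.
rewrite integral_uniform//.
- by rewrite subr0 invr1 mul1e integral_indic.
- by apply/measurable_EFinP; exact: measurable_indic.
Qed.

(** Inverse transform sampling. The half-lines [[r, +oo[] are stable under intersection and generate
    the Borel sets, so agreement on them suffices. *)
Lemma distribution_gamma_cdf_inv (A : set R) : measurable A -> nu A = G A.
Proof.
have G0 : (G `]-oo, 0%R]%classic = 0)%E by rewrite -gamma_cdfE// gamma_cdf0.
move: A; apply: (@measure_unique _ R rT (@RGenCInfty.G R)
  (fun n => `[- n%:R, +oo[%classic) _ _ _ _ nu G).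
- exact: RGenCInfty.measurableE.
- move=> _ _ [x ->] [y ->]; exists (Num.max x y).
  apply/seteqP; split=> z /=; rewrite !in_itv/= !andbT.
    by move=> [xz yz]; rewrite ge_max xz.
  by rewrite ge_max => /andP.
- by move=> n; exists (- n%:R).
- rewrite -subTset => x _ /=; exists (Num.truncn `|x|).+1 => //=.
  rewrite in_itv/= andbT lerNl (le_trans _ (ltW (truncnS_gt _)))//.
  by rewrite -normrN ler_norm.
- move=> _ [r ->]; rewrite /nu /distribution /pushforward /=.
  have -> : G `[r, +oo[%classic = (1 - G `]-oo, r[%classic)%E.
    rewrite -probability_setC//; congr (G _); apply/seteqP; split=> x /=; rewrite !in_itv/= andbT.
      by move=> rx; apply/negP; rewrite -leNgt.
    by move/negP; rewrite -leNgt.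
  have [r0|r0] := leP r 0.
    have -> : G `]-oo, r[%classic = 0%E.
      apply/eqP; rewrite eq_le measure_ge0 andbT -G0 le_measure ?inE//.
      by move=> x /=; rewrite !in_itv/= => /ltW/le_trans; exact.
    rewrite sube0 (_ : _ @^-1` _ = setT) ?probability_setT//; apply/seteqP; split => x //= _.
    by rewrite in_itv/= andbT (le_trans r0)// gamma_cdf_inv_ge0.
  have -> : G `]-oo, r[%classic = (F r)%:E.
    rewrite gamma_cdfE ?ltW// !GE integral_itv_bndo_bndc//.
    exact/measurable_EFinP.
  rewrite (_ : _ @^-1` _ = `[F r, 1[%classic).
    rewrite mu01E// (_ : _ `&` _ = `[F r, 1[%classic).
      by rewrite lebesgue_measure_itv/= lte_fin gamma_cdf_lt1 ?ltW// EFinB.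
    apply/seteqP; split=> x /=; rewrite !in_itv/=; first by case.
    move=> /andP[Fx x1]; rewrite Fx x1 (ltW x1) (le_trans _ Fx)//.
    by rewrite -gamma_cdf0 gamma_cdf_le// ltW.
  by apply/seteqP; split => x /=; rewrite !in_itv/= andbT le_gamma_cdf_inv.
- by move=> n; rewrite (le_lt_trans (probability_le1 _ _))// ltry.
Qed.

Lemma integral_gamma_cdf_inv (h : R -> \bar R) : measurable_fun [set: R] h ->
  (forall x, 0 <= h x)%E ->
  (\int[mu]_(x in `[0%R, 1%R]) h (Finv x) = \int[G]_z h z)%E.
Proof.
move=> mh h0; rewrite -(@eq_measure_integral _ _ _ setT G nu); last first.
  by move=> A mA _; first [exact: distribution_gamma_cdf_inv | exact/esym/distribution_gamma_cdf_inv].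
rewrite ge0_integral_distribution//.
rewrite integral_uniform//.
- by rewrite subr0 invr1 mul1e.
- exact: measurableT_comp mh measurable_gamma_cdf_inv.
- by move=> x; exact: h0.
Qed.

End gamma_cdf_inverse.

(** * Mixed moments of independent Gamma variables *)

Section cube_moments.
Context {R : realType}.
Local Notation mu := (@lebesgue_measure R).
Local Notation rT := (measurableTypeR R).
Local Open Scope ereal_scope.

Lemma measurable_integral_section d (T : measurableType d) (P : probability rT R)
    (k : T * R -> \bar R) : measurable_fun [set: T * R] k -> (forall p, 0 <= k p) ->
  measurable_fun [set: T] (fun x => \int[P]_y k (x, y)).
Proof.
by move=> mk k0; exact: (@measurable_fun_fubini_tonelli_F _ _ T rT R P k).
Qed.

Variables kappa rho : R.
Hypotheses (kappa_gt0 : (0 < kappa)%R) (rho_gt0 : (0 < rho)%R).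
Let beta := (kappa / rho)%R.
Let beta_gt0 : (0 < beta)%R. Proof. exact: divr_gt0. Qed.
Local Notation Z := (gamma_cdf_inv kappa rho).
Let G a := gamma_probability a beta.

(** The three variables are meant as the sums over the two groups of a block and over the remaining
    vertices; shape 0 stands for an empty group, whose sum is 0. *)
Definition triple_mean a0 a1 a2 (h : R * R * R -> \bar R) : \bar R :=
  \int[G a0]_x \int[G a1]_y \int[G a2]_z h (x, y, z).

Let m2 a (h : R * R * R -> \bar R) : measurable_fun setT h -> (forall p, 0 <= h p) ->
  measurable_fun [set: R * R] (fun p => \int[G a]_z h (p.1, p.2, z)).
Proof.
move=> mh h0; rewrite (_ : (fun p => _) = fun p => \int[G a]_z h (p, z)).
  exact: measurable_integral_section.
by apply/funext => -[].
Qed.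

(** One convolution, in the coordinate [g]: exchanges of integrals bring the integral over [z] next
    to that coordinate. The multiples by a boolean select one coordinate out of three. *)
Lemma triple_mean_conv a0 a1 a2 c (g : 'I_3) (h : R * R * R -> \bar R) :
  (0 <= a0)%R -> (0 <= a1)%R -> (0 <= a2)%R -> (0 < c)%R ->
  measurable_fun setT h -> (forall p, 0 <= h p) ->
  \int[G c]_z triple_mean a0 a1 a2 (fun p => h ((p.1.1 + z *+ (g == 0%N :> nat))%R,
     (p.1.2 + z *+ (g == 1%N :> nat))%R, (p.2 + z *+ (g == 2%N :> nat))%R)) =
  triple_mean (a0 + c *+ (g == 0%N :> nat))%R (a1 + c *+ (g == 1%N :> nat))%R
     (a2 + c *+ (g == 2%N :> nat))%R h.
Proof.
move=> a00 a10 a20 c0 mh h0; rewrite /triple_mean.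
have mh2 a := m2 a mh h0.
case: g => -[|[|[|//]]] /= _.
- rewrite mulr1n !mulr0n !addr0 (addrC a0).
  have mk : measurable_fun [set: R] (fun x => \int[G a1]_y \int[G a2]_w h (x, y, w)%R).
    apply: (measurable_integral_section _ (k := fun p => \int[G a2]_z h (p.1, p.2, z))).
      exact: mh2.
    by move=> p; apply: integral_ge0.
  have k0 x : 0 <= \int[G a1]_y \int[G a2]_w h (x, y, w)%R.
    by apply: integral_ge0 => y _; apply: integral_ge0.
  rewrite -(gamma_probability_conv (ltW c0) a00 beta_gt0 mk k0).
  apply: eq_integral => z _; apply: eq_integral => x _.
  by apply: eq_integral => y _; apply: eq_integral => w _; rewrite !addr0 addrC.
- rewrite mulr1n !mulr0n !addr0.
  transitivity (\int[G a0]_x \int[G c]_z \int[G a1]_y \int[G a2]_w h (x, z + y, w)%R).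
    transitivity (\int[G c]_z \int[G a0]_x \int[G a1]_y \int[G a2]_w h (x, z + y, w)%R).
      apply: eq_integral => z _; apply: eq_integral => x _.
      by apply: eq_integral => y _; apply: eq_integral => w _; rewrite !addr0 addrC.
    apply: (@fubini_tonelli _ _ rT rT R (G c) (G a0) (fun p : R * R =>
      \int[G a1]_y \int[G a2]_w h (p.2, p.1 + y, w)%R)).
      apply: (measurable_integral_section _ (k := fun q : R * R * R =>
        \int[G a2]_w h (q.1.2, q.1.1 + q.2, w)%R)); last first.
        by move=> p; apply: integral_ge0.
      apply: (measurableT_comp (mh2 a2) (g := fun q : R * R * R => (q.1.2, q.1.1 + q.2)%R)).
      apply: measurable_fun_pair; first exact: measurableT_comp.
      by apply: measurable_funD => //; exact: measurableT_comp.
    by move=> p; apply: integral_ge0 => y _; apply: integral_ge0.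
  apply: eq_integral => x _; rewrite (addrC a1).
  have mk : measurable_fun [set: R] (fun y => \int[G a2]_w h (x, y, w)%R).
    exact: measurableT_comp (mh2 a2) (pair1_measurable _).
  have k0 y : 0 <= \int[G a2]_w h (x, y, w)%R by apply: integral_ge0.
  exact: (gamma_probability_conv (ltW c0) a10 beta_gt0 mk k0).
- rewrite mulr1n !mulr0n !addr0.
  transitivity (\int[G a0]_x \int[G a1]_y \int[G c]_z \int[G a2]_w h (x, y, z + w)%R).
    transitivity (\int[G a0]_x \int[G c]_z \int[G a1]_y \int[G a2]_w h (x, y, z + w)%R).
      transitivity (\int[G c]_z \int[G a0]_x \int[G a1]_y \int[G a2]_w h (x, y, z + w)%R).
        apply: eq_integral => z _; apply: eq_integral => x _.
        by apply: eq_integral => y _; apply: eq_integral => w _; rewrite !addr0 addrC.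
      apply: (@fubini_tonelli _ _ rT rT R (G c) (G a0) (fun p : R * R =>
        \int[G a1]_y \int[G a2]_w h (p.2, y, p.1 + w)%R)).
        apply: (measurable_integral_section _ (k := fun q : R * R * R =>
          \int[G a2]_w h (q.1.2, q.2, q.1.1 + w)%R)); last first.
          by move=> p; apply: integral_ge0.
        apply: (measurable_integral_section _ (k := fun q : R * R * R * R =>
          h (q.1.1.2, q.1.2, q.1.1.1 + q.2)%R)) => //.
        apply: measurableT_comp mh _; apply: measurable_fun_pair.
          apply: measurable_fun_pair; last exact: measurableT_comp.
          by apply: measurableT_comp => //; exact: measurableT_comp.
        apply: measurable_funD => //.
        by apply: measurableT_comp => //; exact: measurableT_comp.
      by move=> p; apply: integral_ge0 => y _; apply: integral_ge0.
    apply: eq_integral => x _.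
    apply: (@fubini_tonelli _ _ rT rT R (G c) (G a1) (fun p : R * R =>
        \int[G a2]_w h (x, p.2, p.1 + w)%R)).
      apply: (measurable_integral_section _ (k := fun q : R * R * R =>
          h (x, q.1.2, q.1.1 + q.2)%R)) => //.
      apply: measurableT_comp mh _; apply: measurable_fun_pair.
        by apply: measurable_fun_pair => //; exact: measurableT_comp.
      by apply: measurable_funD => //; exact: measurableT_comp.
    by move=> p; apply: integral_ge0.
  apply: eq_integral => x _; apply: eq_integral => y _; rewrite (addrC a2).
  have mk : measurable_fun [set: R] (fun w => h (x, y, w)%R).
    exact: measurableT_comp mh (pair1_measurable _).
  exact: (gamma_probability_conv (ltW c0) a20 beta_gt0 mk).
Qed.

Lemma measurable_triple_mean a0 a1 a2 (h : R * (R * R * R) -> \bar R) :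
  measurable_fun setT h -> (forall p, 0 <= h p) ->
  measurable_fun [set: R] (fun z => triple_mean a0 a1 a2 (fun p => h (z, p))).
Proof.
move=> mh h0.
apply: (measurable_integral_section _ (k := fun q : R * R =>
  \int[G a1]_y \int[G a2]_w h (q.1, (q.2, y, w)))); last first.
  by move=> p; apply: integral_ge0 => y _; apply: integral_ge0.
apply: (measurable_integral_section _ (k := fun q : R * R * R =>
  \int[G a2]_w h (q.1.1, (q.1.2, q.2, w)))); last first.
  by move=> p; apply: integral_ge0.
apply: (measurable_integral_section _ (k := fun q : R * R * R * R =>
  h (q.1.1.1, (q.1.1.2, q.1.2, q.2)))) => //.
apply: measurableT_comp mh _; apply: measurable_fun_pair.
  by apply: measurableT_comp => //; exact: measurableT_comp.
apply: measurable_fun_pair => //; apply: measurable_fun_pair.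
  by apply: measurableT_comp => //; exact: measurableT_comp.
exact: measurableT_comp.
Qed.

Definition group_sum n (lab : 'I_n -> 'I_3) (g : nat) (t : n.-tuple rT) : R :=
  \sum_(i < n | lab i == g :> nat) Z (tnth t i).

Lemma measurable_group_sum n (lab : 'I_n -> 'I_3) g :
  measurable_fun [set: n.-tuple rT] (group_sum lab g).
Proof.
rewrite /group_sum; under eq_fun do rewrite big_mkcond/=.
apply: measurable_sum => i; case: (_ == _) => //.
exact: measurableT_comp (measurable_gamma_cdf_inv kappa_gt0 rho_gt0) (measurable_tnth i).
Qed.

(* Weighting a Gamma variable of shape kappa by its delta-th power makes it a
   Gamma variable of shape kappa + delta, and shapes add up in sums. *)
Theorem cube_moments n (lab : 'I_n -> 'I_3) (delta : 'I_n -> nat)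
    (h : R * R * R -> \bar R) : measurable_fun setT h -> (forall p, 0 <= h p) ->
  \int[unit_cube_measure R n]_t ((\prod_(i < n) Z (tnth t i) ^+ delta i)%:E *
     h (group_sum lab 0 t, group_sum lab 1 t, group_sum lab 2 t)) =
  (\prod_(i < n) (rising kappa (delta i) / beta ^+ delta i))%:E *
  triple_mean (\sum_(i < n | lab i == 0%N :> nat) (kappa + (delta i)%:R))%R
    (\sum_(i < n | lab i == 1%N :> nat) (kappa + (delta i)%:R))%R
    (\sum_(i < n | lab i == 2%N :> nat) (kappa + (delta i)%:R))%R h.
Proof.
have mZ m (i : 'I_m) : measurable_fun [set: m.-tuple rT] (fun t => Z (tnth t i)).
  exact: measurableT_comp (measurable_gamma_cdf_inv kappa_gt0 rho_gt0) (measurable_tnth i).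
have Z0 x : (0 <= Z x)%R by exact: gamma_cdf_inv_ge0.
have mprod m (d : 'I_m -> nat) :
    measurable_fun [set: m.-tuple rT] (fun t => (\prod_(i < m) Z (tnth t i) ^+ d i)%:E).
  apply/measurable_EFinP; apply: measurable_prod => i _; apply: measurable_funX; exact: mZ.
have mgroup m (l : 'I_m -> 'I_3) (k : R * R * R -> \bar R) : measurable_fun setT k ->
    measurable_fun [set: m.-tuple rT]
      (fun t => k (group_sum l 0 t, group_sum l 1 t, group_sum l 2 t)).
  move=> mk; apply: measurableT_comp mk _; apply: measurable_fun_pair.
    by apply: measurable_fun_pair; exact: measurable_group_sum.
  exact: measurable_group_sum.
have prod0 m (d : 'I_m -> nat) (t : m.-tuple rT) :
    0 <= (\prod_(i < m) Z (tnth t i) ^+ d i)%:E.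
  by rewrite lee_fin prodr_ge0// => i _; exact: exprn_ge0.
elim: n lab delta h => [|n IH] lab delta h mh h0.
  (* All shapes are 0 here, so the triple mean is the value of [h] at the origin. *)
  rewrite integral_unit_cube0; last by apply: emeasurable_funM; [exact: mprod|exact: mgroup].
  rewrite /group_sum !big_ord0 !mul1e /triple_mean.
  have mh2 := m2 0 mh h0.
  rewrite integral_gamma_probability0; last first.
    apply: (measurable_integral_section _ (k := fun p => \int[G 0]_z h (p.1, p.2, z))) => //.
    by move=> p; apply: integral_ge0.
  rewrite integral_gamma_probability0; last exact: measurableT_comp mh2 (pair1_measurable _).
  by rewrite integral_gamma_probability0//; exact: measurableT_comp mh (pair1_measurable _).
rewrite integral_unit_cubeS; last 2 first.
- by apply: emeasurable_funM; [exact: mprod|exact: mgroup].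
- by move=> t; rewrite mule_ge0.
pose lab' i := lab (lift ord0 i); pose delta' i := delta (lift ord0 i).
pose d0 := delta ord0.
(* The first coordinate is absorbed into the function applied to the group sums of the others;
   [triple_mean_conv] later returns it as an increment of shape. *)
pose sh (z : R) (p : R * R * R) := ((p.1.1 + z *+ (lab ord0 == 0%N :> nat))%R,
     (p.1.2 + z *+ (lab ord0 == 1%N :> nat))%R, (p.2 + z *+ (lab ord0 == 2%N :> nat))%R).
have msh : measurable_fun setT (fun q : R * (R * R * R) => sh q.1 q.2).
  have mMn (b : bool) : measurable_fun setT (fun q : R * (R * R * R) => (q.1 *+ b)%R).
    case: b; first exact: measurable_fst.
    by rewrite [X in measurable_fun _ X](_ : _ = cst 0%R).
  apply: measurable_fun_pair; last by apply: measurable_funD => //; exact: measurableT_comp.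
  apply: measurable_fun_pair; apply: measurable_funD => //.
    by apply: measurableT_comp => //; exact: measurableT_comp.
  by apply: measurableT_comp => //; exact: measurableT_comp.
have mhsh z : measurable_fun setT (h \o sh z).
  apply: measurableT_comp mh _.
  exact: (measurableT_comp msh (pair1_measurable z)).
pose a g := (\sum_(i < n | lab' i == g :> nat) (kappa + (delta' i)%:R))%R.
pose C := (\prod_(i < n) (rising kappa (delta' i) / beta ^+ delta' i))%R.
have C0 : (0 <= C)%R.
  by apply: prodr_ge0 => i _; rewrite divr_ge0 ?exprn_ge0// ltW// rising_gt0.
have a0 g : (0 <= a g)%R by apply: sumr_ge0 => i _; rewrite addr_ge0// ltW.
pose T z := triple_mean (a 0%N) (a 1%N) (a 2%N) (h \o sh z).
have T0 z : 0 <= T z.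
  by apply: integral_ge0 => x _; apply: integral_ge0 => y _; apply: integral_ge0 => w _; exact: h0.
have mT : measurable_fun [set: R] T.
  apply: (@measurable_triple_mean _ _ _ (fun q => h (sh q.1 q.2))) => //.
  exact: measurableT_comp mh msh.
have groupS g x (t : n.-tuple rT) : group_sum lab g [tuple of x :: t] =
    (group_sum lab' g t + Z x *+ (lab ord0 == g :> nat))%R.
  rewrite /group_sum big_mkcond big_ord_recl tnth0 [in RHS]big_mkcond addrC.
  congr (_ + _)%R; first by case: (nat_of_ord (lab ord0) == g).
  by apply: eq_bigr => i _; rewrite tnthS.
transitivity (\int[mu]_(x in `[0%R, 1%R]) (((`|Z x| ^+ d0)%:E * (C%:E * T (Z x))))).
  apply: eq_integral => x _; rewrite ger0_norm//.
  rewrite -IH; [|exact: mhsh|by move=> p; exact: h0].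
  rewrite -ge0_integralZl//.
  - apply: eq_integral => t _; rewrite !groupS big_ord_recl tnth0 EFinM -muleA.
    congr (_ * (_%:E * _)).
    by apply: eq_bigr => i _; rewrite tnthS.
  - by apply: emeasurable_funM; [exact: mprod|exact: (mgroup _ _ _ (mhsh _))].
  - by move=> t _; rewrite mule_ge0// h0.
  - by rewrite lee_fin exprn_ge0.
have mCT : measurable_fun [set: R] (fun z => C%:E * T z) by exact: emeasurable_funM.
have CT0 z : 0 <= C%:E * T z by rewrite mule_ge0.
rewrite (integral_gamma_cdf_inv kappa_gt0 rho_gt0
  (h := fun z => (`|z| ^+ d0)%:E * (C%:E * T z))); last 2 first.
- apply: emeasurable_funM => //; apply/measurable_EFinP; apply: measurable_funX.
  exact: normr_measurable.
- by move=> z; rewrite mule_ge0// lee_fin exprn_ge0.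
rewrite gamma_probability_moment//.
rewrite ge0_integralZl// (triple_mean_conv (lab ord0))//; last by rewrite ltr_wpDr.
rewrite big_ord_recl muleA -EFinM; congr (_%:E * _).
have aS g : (\sum_(i < n.+1 | lab i == g :> nat) (kappa + (delta i)%:R))%R =
    (a g + (kappa + d0%:R) *+ (lab ord0 == g :> nat))%R.
  rewrite /a big_mkcond big_ord_recl [X in _ = (X + _)%R]big_mkcond [LHS]addrC.
  by congr (_ + _)%R; case: (nat_of_ord (lab ord0) == g).
by rewrite !aS.
Qed.
End cube_moments.

(** * Limits of Beta means *)

Section poisson_limit.
Context {R : realType}.

(** Both bounds are [ln (1 + x) <= x]: at [- c] for the upper one, and at [c / (1 - c)], through the
    inverse of [1 - c], for the lower one. *)
Lemma ln1B_bounds (c : R) : 0 <= c < 1 -> - c - c ^+ 2 / (1 - c) <= ln (1 - c) <= - c.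
Proof.
move=> /andP[c0 c1]; have d0 : 0 < 1 - c by rewrite subr_gt0.
apply/andP; split; last by rewrite le_ln1Dx// ltrN2.
have -> : - c - c ^+ 2 / (1 - c) = - (c / (1 - c)) by field; rewrite gt_eqF.
rewrite lerNl -lnV ?posrE//.
have e : (1 - c)^-1 = 1 + c / (1 - c) by field; rewrite gt_eqF.
rewrite [X in ln X]e.
by rewrite le_ln1Dx// (lt_le_trans (ltrN10 _))// divr_ge0// ltW.
Qed.

Lemma powR1B_cvg (r_ c_ : nat -> R) (c : R) :
  (\forall n \near \oo, 0 <= r_ n) -> (\forall n \near \oo, 0 <= c_ n < 1) ->
  c_ n @[n --> \oo] --> 0 -> r_ n * c_ n @[n --> \oo] --> c ->
  (1 - c_ n) `^ (r_ n) @[n --> \oo] --> expR (- c).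
Proof.
move=> r0 c01 cc rc.
have key : r_ n * ln (1 - c_ n) @[n --> \oo] --> - c.
  (* The two bounds of the logarithm differ by a relative error [c_ n / (1 - c_ n)], which
     vanishes. *)
  apply: (@squeeze_cvgr _ _ _ _ (fun n => - (r_ n * c_ n) - (r_ n * c_ n) * (c_ n / (1 - c_ n)))
    (fun n => - (r_ n * c_ n))).
  - near=> n; have rn0 : 0 <= r_ n by near: n.
    have cn01 : 0 <= c_ n < 1 by near: n.
    have /andP[lo hi] := ln1B_bounds cn01.
    have := ler_wpM2l rn0 lo; have := ler_wpM2l rn0 hi.
    rewrite mulrN => -> le2; rewrite andbT (le_trans _ le2)//.
    by rewrite le_eqVlt; apply/orP; left; apply/eqP; ring.
  - rewrite -[X in _ --> X]subr0; apply: cvgB; first exact: cvgN.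
    rewrite -(mulr0 c); apply: cvgM => //.
    rewrite -(mul0r 1); apply: cvgM => //; rewrite -[X in _ --> X]invr1.
    apply: cvgV => //; rewrite -[X in _ --> X]subr0.
    by apply: cvgB => //; exact: cvg_cst.
  - exact: cvgN.
have : expR (r_ n * ln (1 - c_ n)) @[n --> \oo] --> expR (- c).
  by apply: (cvg_comp _ _ key); exact: continuous_expR.
apply: cvg_trans; apply: near_eq_cvg; near=> n.
have /andP[_ cn1] : 0 <= c_ n < 1 by near: n.
by rewrite /powR gt_eqF// subr_gt0.
Unshelve. all: by end_near. Qed.
End poisson_limit.

Section beta_to_gamma.
Context {R : realType}.
Local Notation mu := (@lebesgue_measure R).
Variables (a kappa : R) (b_ : nat -> R).
Hypotheses (a0 : 0 < a) (kappa0 : 0 < kappa).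
Hypothesis b_cvg : b_ n / n%:R @[n --> \oo] --> kappa.

(** With [u = x / n], the second factor of the Beta kernel is [1 - x / n] to the power [b_ n - 1],
    which tends to [expR (- (kappa * x))]. The power of [n] in front compensates the first factor
    and the Jacobian; dominated convergence concludes. *)
Lemma beta_kernel_cvg (F_ : nat -> R -> R) (F : R -> R) (C : R) :
  (forall n, measurable_fun [set: R] (F_ n)) -> measurable_fun [set: R] F ->
  (\forall n \near \oo, forall u, 0 < u < 1 -> 0 <= F_ n u <= C) ->
  (forall x, 0 < x -> F_ n (x / n%:R) @[n --> \oo] --> F x) ->
  ((n%:R `^ a)%:E * \int[mu]_u (beta_kernel a (b_ n) u * F_ n u)%:E @[n --> \oo] -->
   \int[mu]_x (gamma_kernel a kappa x * F x)%:E)%E.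
Proof.
move=> mF_ mF Fbnd Fcvg.
pose f n x := n%:R `^ (a - 1) * beta_kernel a (b_ n) (x / n%:R) * F_ n (x / n%:R).
have h1 : (b_ n - 1) / n%:R @[n --> \oo] --> kappa.
  rewrite -[X in _ --> X]subr0.
  under eq_fun do rewrite mulrBl.
  apply: cvgB => //; rewrite -(mulr0 1); apply: cvgM; first exact: cvg_cst.
  by rewrite -cvg_shiftS; exact: cvg_harmonic.
(* Any rate strictly below [kappa] is exceeded for large [n]; half of it gives an integrable
   exponential majorant. *)
have bbig : \forall n \near \oo, kappa / 2 * n%:R <= b_ n - 1.
  have k2 : kappa / 2 < kappa by rewrite ltr_pdivrMr// ltr_pMr// ltr1n.
  near=> n; have n0 : 0 < n%:R :> R by rewrite ltr0n; near: n; exists 1%N.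
  rewrite -ler_pdivlMr// ltW//; near: n; exact: (cvgr_gt kappa h1).
have [N _ HN] : \forall n \near \oo, [/\ (0 < n)%N, kappa / 2 * n%:R <= b_ n - 1 &
    forall u, 0 < u < 1 -> 0 <= F_ n u <= C].
  near=> n; split; near: n => //; by exists 1%N.
pose g x := C * gamma_kernel a (kappa / 2) x.
have Cge0 : 0 <= C.
  have /andP[hC1 hC2] : 0 <= F_ N (2^-1) <= C.
    by have [_ _] := HN N (leqnn N); apply; rewrite invr_gt0 ltr0n invf_lt1// ltr1n.
  exact: le_trans hC2.
have b_out n x : ~~ (0 < x < n%:R) -> (0 < n)%N -> f n x = 0.
  move=> xn n0; have n0' : 0 < n%:R :> R by rewrite ltr0n.
  rewrite /f /beta_kernel pmulr_lgt0 ?invr_gt0// ltr_pdivrMr// mul1r (negbTE xn).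
  by rewrite mulr0 mul0r.
have f_in n x : 0 < x < n%:R -> f n x =
    x `^ (a - 1) * (1 - x / n%:R) `^ (b_ n - 1) * F_ n (x / n%:R).
  move=> /andP[x0 xn]; have n0 : 0 < n%:R :> R by exact: lt_trans xn.
  have n1 : n%:R != 0 :> R by rewrite gt_eqF.
  rewrite /f /beta_kernel divr_gt0// ltr_pdivrMr// mul1r xn/= mulrA.
  congr (_ * _ * _); rewrite -powRM ?(ltW n0) ?divr_ge0 ?(ltW n0) ?(ltW x0)//.
  by rewrite mulrC divfK.
have fg n x : (N <= n)%N -> `|f n x| <= g x.
  move=> Nn; have [n0 bn Fn] := HN n Nn.
  have n0' : 0 < n%:R :> R by rewrite ltr0n.
  have [xn|xn] := boolP (0 < x < n%:R); last first.
    by rewrite b_out// normr0 mulr_ge0// gamma_kernel_ge0.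
  have /andP[x0 xn'] := xn.
  have /andP[F0 FC] : 0 <= F_ n (x / n%:R) <= C.
    by apply: Fn; rewrite divr_gt0// ltr_pdivrMr// mul1r.
  rewrite f_in// ger0_norm; last by rewrite !mulr_ge0 ?powR_ge0.
  rewrite /g /gamma_kernel x0 [C * _]mulrC ler_pM ?mulr_ge0 ?powR_ge0//.
  rewrite ler_wpM2l ?powR_ge0//.
  have t1 : 0 < 1 - x / n%:R by rewrite subr_gt0 ltr_pdivrMr// mul1r.
  rewrite /powR gt_eqF// ler_expR.
  have r0 : 0 <= b_ n - 1 by rewrite (le_trans _ bn)// mulr_ge0 ?divr_ge0 ?ltW.
  apply: (@le_trans _ _ ((b_ n - 1) * - (x / n%:R))).
    by rewrite ler_wpM2l// le_ln1Dx// ltrN2 ltr_pdivrMr// mul1r.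
  rewrite mulrN lerN2.
  have -> : kappa / 2 * x = (kappa / 2 * n%:R) * (x / n%:R) by field; rewrite gt_eqF.
  by rewrite ler_wpM2r// divr_ge0 ?ltW.
have fcvg x : f n x @[n --> \oo] --> gamma_kernel a kappa x * F x.
  have [x0|x0] := leP x 0.
    rewrite /gamma_kernel ltNge x0 mul0r.
    apply: cvg_near_cst; near=> n; apply: b_out; first by rewrite ltNge x0.
    by near: n; exists 1%N.
  rewrite /gamma_kernel x0.
  have xn : \forall n \near \oo, 0 < x < n%:R.
    near=> n; rewrite x0 /=; near: n; exact: nbhs_infty_gtr.
  have : x `^ (a - 1) * (1 - x / n%:R) `^ (b_ n - 1) * F_ n (x / n%:R) @[n --> \oo] -->
      x `^ (a - 1) * expR (- (kappa * x)) * F x.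
    apply: cvgM; last exact: Fcvg.
    apply: cvgM; first exact: cvg_cst.
    apply: powR1B_cvg.
    - near=> n; rewrite (@le_trans _ _ (kappa / 2 * n%:R))//; last by near: n.
      by rewrite mulr_ge0// divr_ge0// ltW.
    - near=> n; have /andP[_ xn'] : 0 < x < n%:R by near: n.
      have n0 : 0 < n%:R :> R by exact: lt_trans xn'.
      by rewrite divr_ge0 ?ltW//= ltr_pdivrMr// mul1r.
    - rewrite -(mulr0 x); apply: cvgM; first exact: cvg_cst.
      by rewrite -cvg_shiftS; exact: cvg_harmonic.
    - under eq_fun do rewrite mulrCA mulrC.
      by apply: cvgM => //; exact: cvg_cst.
  apply: cvg_trans; apply: near_eq_cvg; near=> n.
  by rewrite f_in//; near: n.
have mf n : measurable_fun [set: R] (f n).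
  have mdiv : measurable_fun [set: R] (fun x : R => x / n%:R).
    exact: measurable_funM.
  apply: measurable_funM.
    apply: measurable_funM => //.
    exact: measurableT_comp (measurable_beta_kernel _ _) mdiv.
  exact: measurableT_comp (mF_ n) mdiv.
have mg : measurable_fun [set: R] g.
  by apply: measurable_funM => //; exact: measurable_gamma_kernel.
have k20 : 0 < kappa / 2 by rewrite divr_gt0.
have gint : mu.-integrable setT (EFin \o g).
  apply/integrableP; split; first exact/measurable_EFinP.
  under eq_integral do rewrite /= ger0_norm ?mulr_ge0 ?gamma_kernel_ge0// EFinM.
  rewrite ge0_integralZl//; last 2 first.
  - by apply/measurable_EFinP; exact: measurable_gamma_kernel.
  - by move=> x _; rewrite lee_fin gamma_kernel_ge0.
  by rewrite integral_gamma_kernel// -EFinM ltry.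
have fE n : (N <= n)%N -> ((n%:R `^ a)%:E * \int[mu]_u (beta_kernel a (b_ n) u * F_ n u)%:E =
    \int[mu]_x (f n x)%:E)%E.
  move=> Nn; have [n0 bn Fn] := HN n Nn.
  have n0' : 0 < n%:R :> R by rewrite ltr0n.
  have ni0 : 0 < n%:R^-1 :> R by rewrite invr_gt0.
  have h0 u : (0 <= (beta_kernel a (b_ n) u * F_ n u)%:E)%E.
    rewrite lee_fin /beta_kernel; case: ifP => [u01|]; last by rewrite mul0r.
    by have /andP[F0 _] := Fn u u01; rewrite !mulr_ge0 ?powR_ge0.
  have mh : measurable_fun [set: R] (fun u => (beta_kernel a (b_ n) u * F_ n u)%:E).
    apply/measurable_EFinP; apply: measurable_funM => //.
    exact: measurable_beta_kernel.
  rewrite (ge0_integral_scale ni0 mh h0) muleA -EFinM.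
  have -> : n%:R `^ a * n%:R^-1 = n%:R `^ (a - 1) :> R.
    by rewrite powRB ?powRr1 ?ltW//; apply/implyP => _; rewrite gt_eqF.
  rewrite -ge0_integralZl//.
  - by apply: eq_integral => x _; rewrite -EFinM mulrA [n%:R^-1 * x]mulrC.
  - by apply: measurableT_comp mh _; exact: measurable_funM.
(* The majorant is valid from [N] on, hence the shifted sequence. *)
have dc : (\int[mu]_x (f (n + N)%N x)%:E @[n --> \oo] -->
    \int[mu]_x (gamma_kernel a kappa x * F x)%:E)%E.
  apply: (@dominated_cvg _ _ _ mu setT measurableT _ _ (EFin \o g)) => //.
  - by move=> n; apply/measurable_EFinP; exact: mf.
  - move=> x _; apply: cvg_EFin; first exact: nearW.
    by have := fcvg x; rewrite -(cvg_shiftn N).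
  - by move=> n x _; rewrite /= lee_fin; apply: fg; rewrite leq_addl.
have : (\int[mu]_x (f n x)%:E @[n --> \oo] -->
    \int[mu]_x (gamma_kernel a kappa x * F x)%:E)%E by rewrite -(cvg_shiftn N).
apply: cvg_trans; apply: near_eq_cvg; near=> n.
by rewrite fE//; near: n; exists N.
Unshelve. all: by end_near. Qed.
End beta_to_gamma.

Section beta_mean_limits.
Context {R : realType}.
Local Notation mu := (@lebesgue_measure R).
Variables (a kappa : R).
Hypotheses (a0 : 0 < a) (kappa0 : 0 < kappa).

Lemma near_gt0_of_ratio (b_ : nat -> R) : b_ n / n%:R @[n --> \oo] --> kappa ->
  \forall n \near \oo, 0 < b_ n.
Proof.
move=> b_cvg; near=> n.
have : 0 < b_ n / n%:R by near: n; exact: (cvgr_gt kappa b_cvg).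
have n0 : 0 < n%:R :> R by rewrite ltr0n; near: n; exists 1%N.
by rewrite pmulr_lgt0// invr_gt0.
Unshelve. all: by end_near. Qed.

(** In law, [n] times a Beta variable of parameters [a] and [b_ n] tends to a Gamma variable of rate
    [kappa]. The limit of the normalising constant is the case of the constant function 1 of
    [beta_kernel_cvg], which takes the place of asymptotics for [Gamma]. *)
Lemma beta_mean_cvg (b_ : nat -> R) (F_ : nat -> R -> R) (F : R -> R) (C : R) :
  b_ n / n%:R @[n --> \oo] --> kappa ->
  (forall n, measurable_fun [set: R] (F_ n)) -> measurable_fun [set: R] F ->
  (forall x, 0 <= F x) ->
  (\forall n \near \oo, forall u, 0 < u < 1 -> 0 <= F_ n u <= C) ->
  (forall x, 0 < x -> F_ n (x / n%:R) @[n --> \oo] --> F x) ->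
  (beta_mean a (b_ n) (fun u => (F_ n u)%:E) @[n --> \oo] -->
   \int[gamma_probability a kappa]_x (F x)%:E)%E.
Proof.
move=> b_cvg mF_ mF F0 Fbnd Fcvg.
have ga := Gamma_gt0 a0; have ka : 0 < kappa `^ a by rewrite powR_gt0.
rewrite integral_gamma_probability_kernel//; last first.
  exact/measurable_EFinP.
under eq_integral do rewrite -EFinM.
have c1 : (n%:R `^ a * (Gamma a * Gamma (b_ n) / Gamma (a + b_ n)) @[n --> \oo] -->
    Gamma a / kappa `^ a).
  have := @beta_kernel_cvg R a kappa b_ a0 kappa0 b_cvg (fun=> cst 1) (cst 1) 1.
  have -> : (\int[mu]_x (gamma_kernel a kappa x * cst 1 x)%:E = (Gamma a / kappa `^ a)%:E)%E.
    by under eq_integral do rewrite mulr1; exact: integral_gamma_kernel.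
  move=> h; have {h} : ((n%:R `^ a)%:E * (\int[mu]_u (beta_kernel a (b_ n) u * cst 1 u)%:E)
     @[n --> \oo] --> (Gamma a / kappa `^ a)%:E)%E.
    apply: h => //.
    - by apply: nearW => n u _ /=; rewrite ler01 lexx.
    - by move=> x _; exact: cvg_cst.
  move=> /fine_cvgP[_]; apply: cvg_trans; apply: near_eq_cvg.
  near=> n; have bn : 0 < b_ n by near: n; exact: near_gt0_of_ratio.
  rewrite /= ; under eq_integral do rewrite mulr1.
  by rewrite integral_beta_kernel.
have c2 : ((n%:R `^ a * (Gamma a * Gamma (b_ n) / Gamma (a + b_ n)))^-1 @[n --> \oo] -->
    kappa `^ a / Gamma a).
  rewrite -invf_div; apply: cvgV c1.
  by rewrite mulf_neq0 ?invr_neq0// gt_eqF.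
have c3 := @beta_kernel_cvg R a kappa b_ a0 kappa0 b_cvg F_ F C mF_ mF Fbnd Fcvg.
have : (((n%:R `^ a * (Gamma a * Gamma (b_ n) / Gamma (a + b_ n)))^-1)%:E *
   ((n%:R `^ a)%:E * \int[mu]_u (beta_kernel a (b_ n) u * F_ n u)%:E) @[n --> \oo] -->
   (kappa `^ a / Gamma a)%:E * \int[mu]_x (gamma_kernel a kappa x * F x)%:E)%E.
  apply: cvgeM; [| by apply: cvg_EFin; [exact: nearW | exact: c2] | exact: c3].
  (* A product of limits in the extended reals needs a determinate form; the constant is finite and
     nonzero, so a finite and an infinite integral are both admissible. *)
  have [fI|nfI] := boolP ((\int[mu]_x (gamma_kernel a kappa x * F x)%:E)%E \is a fin_num).
    exact: mule_def_fin.
  by apply: mule_def_neq0_infty nfI; rewrite eqe gt_eqF ?divr_gt0.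
apply: cvg_trans; apply: near_eq_cvg; near=> n.
have bn : 0 < b_ n by near: n; exact: near_gt0_of_ratio.
have n0 : 0 < n%:R :> R by rewrite ltr0n; near: n; exists 1%N.
have na : 0 < n%:R `^ a by rewrite powR_gt0.
have gb := Gamma_gt0 bn; have gab := Gamma_gt0 (addr_gt0 a0 bn).
rewrite /beta_mean; under [in RHS]eq_integral do rewrite -EFinM.
move: (\int[mu]_u _)%E => I.
move: (Gamma a) (Gamma (b_ n)) (Gamma (a + b_ n)) ga gb gab => G1 G2 G12 ga gb gab.
rewrite muleA -EFinM; congr (_%:E * _)%E.
by field; rewrite !gt_eqF.
Unshelve. all: by end_near. Qed.

Lemma beta_mean_itv01 (b : R) (f : R -> \bar R) : 0 < b ->
  measurable_fun [set: R] f -> (forall u, 0 <= f u)%E ->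
  (forall u, 0 < u < 1 -> (f u <= 1)%E) -> (0 <= beta_mean a b f <= 1)%E.
Proof.
move=> b0 mf f0 f1.
have c0 : 0 <= Gamma (a + b) / (Gamma a * Gamma b).
  exact: divr_ge0 (ltW (Gamma_gt0 (addr_gt0 a0 b0)))
    (mulr_ge0 (ltW (Gamma_gt0 a0)) (ltW (Gamma_gt0 b0))).
have mb : measurable_fun [set: R] (fun u => (beta_kernel a b u)%:E).
  by apply/measurable_EFinP; exact: measurable_beta_kernel.
have bk0 u : (0 <= (beta_kernel a b u)%:E)%E by rewrite lee_fin beta_kernel_ge0.
apply/andP; split.
  apply: mule_ge0; first exact: c0.
  by apply: integral_ge0 => u _; rewrite mule_ge0.
rewrite -(beta_mean_cst a0 b0 lee01); apply: lee_wpmul2l; first exact: c0.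
apply: ge0_le_integral => //.
- by move=> u _; rewrite mule_ge0.
- exact: emeasurable_funM.
- exact: emeasurable_funM.
move=> u _ /=; have [u01|u01] := boolP (0 < u < 1).
  by rewrite lee_wpmul2l// f1.
by rewrite /beta_kernel (negbTE u01) !mul0e.
Qed.

Variables (b_ : nat -> R) (M_ : nat -> nat) (sigma : R).
Hypotheses (b_cvg : b_ n / n%:R @[n --> \oo] --> kappa)
  (sigma_ge0 : 0 <= sigma) (M_cvg : (M_ n)%:R / n%:R ^+ 2 @[n --> \oo] --> sigma).

Let expX_cvg (c_ : nat -> R) (c : R) :
  (forall n, 0 <= c_ n) -> c_ n @[n --> \oo] --> 0 ->
  (M_ n)%:R * c_ n @[n --> \oo] --> c ->
  `|1 - c_ n| ^+ M_ n @[n --> \oo] --> expR (- c).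
Proof.
move=> c0 cc Mc.
have c1 : \forall n \near \oo, c_ n < 1 by apply: (cvgr_lt 0 cc).
have : (1 - c_ n) `^ (M_ n)%:R @[n --> \oo] --> expR (- c).
  apply: powR1B_cvg => //; first exact: nearW.
  by near=> n; rewrite c0 /=; near: n.
apply: cvg_trans; apply: near_eq_cvg; near=> n.
have cn : 0 < 1 - c_ n by rewrite subr_gt0; near: n.
by rewrite ger0_norm ?powR_mulrn// ltW.
Unshelve. all: by end_near. Qed.

Let inv_cvg x : x / n%:R @[n --> \oo] --> (0 : R).
Proof.
rewrite -(mulr0 x); apply: cvgM; first exact: cvg_cst.
by rewrite -cvg_shiftS; exact: cvg_harmonic.
Qed.

Let sqr_cvg x : (M_ n)%:R * (x / n%:R) ^+ 2 @[n --> \oo] --> sigma * x ^+ 2.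
Proof.
have -> : (fun n => (M_ n)%:R * (x / n%:R) ^+ 2) = (fun n => ((M_ n)%:R / n%:R ^+ 2) * x ^+ 2).
  by apply/funext => n; rewrite exprMn exprVn; ring.
by apply: cvgM => //; exact: cvg_cst.
Qed.

Let G := gamma_probability a kappa.

Lemma beta_mean_single_cvg :
  (beta_mean a (b_ n) (fun u => (`|1 - u ^+ 2| ^+ M_ n)%:E) @[n --> \oo] -->
   \int[G]_x (expR (- (sigma * x ^+ 2)))%:E)%E.
Proof.
apply: (beta_mean_cvg (F_ := fun n u => `|1 - u ^+ 2| ^+ M_ n) (C := 1) b_cvg).
- move=> n; apply: measurable_funX; apply: measurableT_comp => //.
  by apply: measurable_funB => //; exact: measurable_funX.
- apply: measurableT_comp => //; apply: measurable_funN.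
  by apply: measurable_funM => //; exact: measurable_funX.
- by move=> x; exact: expR_ge0.
- apply: nearW => n u /andP[u0 u1]; rewrite exprn_ge0//= exprn_ile1//.
  have /andP[c0 c1] : 0 <= u ^+ 2 <= 1 by rewrite sqr_ge0/= exprn_ile1 ?ltW.
  by rewrite ger0_norm ?subr_ge0// lerBlDr lerDl.
- move=> x x0; apply: expX_cvg; last exact: sqr_cvg.
    by move=> n; exact: sqr_ge0.
  by rewrite -[X in _ --> X](expr0n R 2); apply: cvgM; exact: inv_cvg.
Qed.

(** At [u = x / n] and [v = y / n] the factor [(1 - u) ^+ 2] tends to 1, so the inner mean tends to
    a function of [x] times the single limit. The outer mean is a second instance of
    [beta_mean_cvg], which is why that lemma lets its integrand depend on [n]. *)
Lemma beta_mean_double_cvg :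
  (beta_mean a (a + b_ n) (fun u => beta_mean a (b_ n)
      (fun v => (`|1 - (u ^+ 2 + (1 - u) ^+ 2 * v ^+ 2)| ^+ M_ n)%:E)) @[n --> \oo] -->
   (\int[G]_x (expR (- (sigma * x ^+ 2)))%:E) * (\int[G]_x (expR (- (sigma * x ^+ 2)))%:E))%E.
Proof.
pose E (n : nat) (u v : R) := `|1 - (u ^+ 2 + (1 - u) ^+ 2 * v ^+ 2)| ^+ M_ n.
pose e (x : R) := expR (- (sigma * x ^+ 2)).
have me : measurable_fun [set: R] e.
  apply: measurableT_comp => //; apply: measurable_funN.
  by apply: measurable_funM => //; exact: measurable_funX.
have mE2 n : measurable_fun [set: R * R] (fun p : R * R => E n p.1 p.2).
  apply: measurable_funX; apply: measurableT_comp => //; apply: measurable_funB => //.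
  apply: measurable_funD; first exact: measurable_funX.
  apply: measurable_funM; last exact: measurable_funX.
  by apply: measurable_funX; exact: measurable_funB.
have mE n u : measurable_fun [set: R] (E n u).
  exact: measurableT_comp (mE2 n) (pair1_measurable u).
have E0 n u v : 0 <= E n u v by rewrite exprn_ge0.
have E1 n u v : 0 < u < 1 -> 0 < v < 1 -> E n u v <= 1.
  move=> /andP[u0 u1] /andP[v0 v1]; rewrite exprn_ile1//.
  have v2 : 0 <= v ^+ 2 <= 1 by rewrite sqr_ge0/= exprn_ile1 ?ltW.
  have : 0 <= u ^+ 2 + (1 - u) ^+ 2 * v ^+ 2 <= 1 by nra.
  by move=> /andP[c0 c1]; rewrite ger0_norm ?subr_ge0// lerBlDr lerDl.
(* The limit theorem takes real functions; for large [n] and [u] in []0, 1[] the inner mean lies in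
   [[0, 1]], where [fine] loses nothing. *)
pose F_ n u := fine (beta_mean a (b_ n) (fun v => (E n u v)%:E)).
have mB n : measurable_fun [set: R] (fun u => beta_mean a (b_ n) (fun v => (E n u v)%:E)).
  apply: emeasurable_funM => //.
  apply: (@measurable_fun_fubini_tonelli_F _ _ (measurableTypeR R) (measurableTypeR R) R mu
    (fun p : R * R => ((beta_kernel a (b_ n) p.2)%:E * (E n p.1 p.2)%:E)%E)).
    apply: emeasurable_funM; last by apply/measurable_EFinP; exact: mE2.
    by apply/measurable_EFinP; apply: measurableT_comp (measurable_beta_kernel _ _) _.
  by move=> p; rewrite mule_ge0// lee_fin ?beta_kernel_ge0.
have mF_ n : measurable_fun [set: R] (F_ n).
  exact: measurableT_comp (fine_measurable _) (mB n).
have bn0 := near_gt0_of_ratio b_cvg.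
have B01 : \forall n \near \oo, forall u, 0 < u < 1 ->
    (0 <= beta_mean a (b_ n) (fun v => (E n u v)%:E) <= 1)%E.
  near=> n => u u01; apply: beta_mean_itv01 => //.
  - by near: n.
  - by apply/measurable_EFinP; exact: mE.
  - by move=> v; rewrite lee_fin.
  - by move=> v v01; rewrite lee_fin E1.
have abcvg : (a + b_ n) / n%:R @[n --> \oo] --> kappa.
  rewrite -[X in _ --> X]add0r; under eq_fun do rewrite mulrDl.
  by apply: cvgD => //; exact: inv_cvg.
have Lfin : (\int[G]_x (e x)%:E)%E \is a fin_num.
  rewrite ge0_fin_numE; last by apply: integral_ge0 => x _; rewrite lee_fin expR_ge0.
  apply: (@le_lt_trans _ _ (\int[G]_x (cst 1 x))%E).
    apply: ge0_le_integral => //; first by move=> x _; rewrite lee_fin expR_ge0.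
      exact/measurable_EFinP.
    by move=> x _; rewrite lee_fin expR_le1 oppr_le0 mulr_ge0// sqr_ge0.
  by rewrite integral_cst// mul1e (le_lt_trans (probability_le1 _ _))// ltry.
have LE : (\int[G]_x (e x)%:E = (fine (\int[G]_x (e x)%:E))%:E)%E by rewrite fineK.
pose L := fine (\int[G]_x (e x)%:E)%E.
have L0 : 0 <= L by rewrite fine_ge0//; apply: integral_ge0 => x _; rewrite lee_fin expR_ge0.
rewrite -/(e _) LE -/L.
have Fcvg x : 0 < x -> F_ n (x / n%:R) @[n --> \oo] --> e x * L.
  move=> x0.
  have onem2 : (1 - x / n%:R) ^+ 2 @[n --> \oo] --> (1 : R).
    have h : 1 - x / n%:R @[n --> \oo] --> (1 : R).
      by rewrite -[X in _ --> X]subr0; apply: cvgB; [exact: cvg_cst|exact: inv_cvg].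
    by rewrite -[X in _ --> X]mulr1; exact: (cvgM h h).
  have : (beta_mean a (b_ n) (fun v => (E n (x / n%:R) v)%:E) @[n --> \oo] -->
      \int[G]_y (e x * e y)%:E)%E.
    apply: (beta_mean_cvg (F_ := fun n v => E n (x / n%:R) v) (C := 1) b_cvg).
    - by move=> n; exact: mE.
    - exact: measurable_funM.
    - by move=> y; rewrite mulr_ge0// expR_ge0.
    - near=> n => v v01; rewrite E0/= E1//.
      have n0 : 0 < n%:R :> R by rewrite ltr0n; near: n; exists 1%N.
      rewrite divr_gt0//= ltr_pdivrMr// mul1r; near: n; exact: nbhs_infty_gtr.
    - move=> y y0; rewrite /e -expRD -opprD -mulrDr.
      apply: expX_cvg.
      + by move=> n; apply: addr_ge0; [|apply: mulr_ge0]; exact: sqr_ge0.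
      + rewrite -[X in _ --> X]addr0; apply: cvgD.
          by rewrite -[X in _ --> X](expr0n R 2); apply: cvgM; exact: inv_cvg.
        rewrite -(mulr0 1); apply: cvgM; first exact: onem2.
        by rewrite -[X in _ --> X](expr0n R 2); apply: cvgM; exact: inv_cvg.
      + rewrite mulrDr; under eq_fun do rewrite mulrDr.
        apply: cvgD; first exact: sqr_cvg.
        under eq_fun do rewrite mulrCA.
        by rewrite -[sigma * y ^+ 2]mul1r; apply: cvgM; [exact: onem2|exact: sqr_cvg].
  have -> : (\int[G]_y (e x * e y)%:E = (e x * L)%:E)%E.
    under eq_integral do rewrite EFinM.
    rewrite ge0_integralZl//; last 3 first.
    - exact/measurable_EFinP.
    - by move=> y _; rewrite lee_fin expR_ge0.
    - by rewrite lee_fin expR_ge0.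
    by rewrite LE -EFinM.
  by move=> /fine_cvgP[_].
have : (beta_mean a (a + b_ n) (fun u => (F_ n u)%:E) @[n --> \oo] -->
    \int[G]_x (e x * L)%:E)%E.
  apply: (beta_mean_cvg (C := 1) abcvg) => //.
  - exact: measurable_funM.
  - by move=> x; rewrite mulr_ge0// expR_ge0.
  - near=> n => u u01; have : forall u, 0 < u < 1 ->
      (0 <= beta_mean a (b_ n) (fun v => (E n u v)%:E) <= 1)%E by near: n.
    move=> /(_ _ u01) /andP[h0 h1].
    by rewrite fine_ge0//= -lee_fin fineK// ge0_fin_numE// (le_lt_trans h1)// ltry.
have -> : (\int[G]_x (e x * L)%:E = L%:E * L%:E)%E.
  under eq_integral do rewrite EFinM.
  rewrite ge0_integralZr//; last 2 first.
  - exact/measurable_EFinP.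
  - by move=> y _; rewrite lee_fin expR_ge0.
  by rewrite LE.
apply: cvg_trans; apply: near_eq_cvg; near=> n.
have B01n : forall u, 0 < u < 1 ->
    (0 <= beta_mean a (b_ n) (fun v => (E n u v)%:E) <= 1)%E by near: n.
rewrite /beta_mean; congr (_ * _)%E; apply: eq_integral => u _.
rewrite /beta_kernel; case: ifP => [u01|]; last by rewrite !mul0e.
congr (_ * _)%E; rewrite fineK//; have /andP[h0 h1] := B01n u u01.
by rewrite ge0_fin_numE// (le_lt_trans h1)// ltry.
Unshelve. all: by end_near. Qed.
End beta_mean_limits.

(** * Probabilities of induced blocks *)

Lemma pag_pmfE (R : realType) (kappa : R) n m (B : 'M[nat]_n) :
  pag_pmf kappa m B = (\prod_(i < n) rising kappa (degree B i)) /
    rising (kappa * n%:R) (2 * m) * (m`!%:R * edge_weight R B).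
Proof. by rewrite /pag_pmf /edge_weight; congr (_ * _); rewrite mulrA. Qed.

Section block_probability.
Context {R : realType}.
Variables (kappa rho : R).
Hypotheses (kappa_gt0 : 0 < kappa) (rho_gt0 : 0 < rho).
Local Notation Z := (gamma_cdf_inv kappa rho).
Local Notation rT := (measurableTypeR R).
Let beta := kappa / rho.
Let beta_gt0 : 0 < beta. Proof. exact: divr_gt0. Qed.

(** A finite sum of weights, independent of any probability space, to be computed from the formula
    of the law alone. *)
Definition block_prob N n m (grp : 'I_N -> bool) (Phi : 'I_N -> 'I_n) (A : 'M[nat]_N) : R :=
  \sum_(a : {ffun 'I_n * 'I_n -> 'I_m.+1} |
      slot_counts a && block_event grp Phi A (slot_matrix (fun p => a p)))
    pag_pmf kappa m (slot_matrix (fun p => a p)).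

Definition degree_moment N (A : 'M[nat]_N) : R :=
  \prod_(i < N) (rising kappa (degree A i) / beta ^+ degree A i).

(* The square of the total mass is the total weight of the pairs of vertices; the
   two squares subtracted are the weights of the pairs within the two groups. *)
Definition rest_mass (M : nat) (p : R * R * R) : R :=
  `|(p.1.1 + p.1.2 + p.2) ^+ 2 - p.1.1 ^+ 2 - p.1.2 ^+ 2| ^+ M.

Lemma measurable_rest_mass M : measurable_fun setT (rest_mass M).
Proof.
apply: measurable_funX; apply: measurableT_comp => //.
have m11 : measurable_fun setT (fun p : R * R * R => p.1.1) by exact: measurableT_comp.
have m12 : measurable_fun setT (fun p : R * R * R => p.1.2) by exact: measurableT_comp.
by do ?[apply: measurable_funB | apply: measurable_funX | apply: measurable_funD].
Qed.

Lemma triple_mean_cst a0 a1 a2 : triple_mean kappa rho a0 a1 a2 (cst 1%E) = 1%E.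
Proof.
rewrite /triple_mean /=.
have c1 (P : probability rT R) : (\int[P]_x 1 = 1)%E.
  by rewrite integral_cst// mul1e; exact: probability_setT.
under eq_integral do under eq_integral do rewrite c1.
by under eq_integral do rewrite c1; rewrite c1.
Qed.

(** Read from right to left, this exhibits the law as a mixture: the rising factorials in the weight
    of [B] become one integral over the cube. *)
Lemma cube_degree_moment n (B : 'M[nat]_n) :
  (\int[unit_cube_measure R n]_t (\prod_(i < n) Z (tnth t i) ^+ degree B i)%:E =
   (degree_moment B)%:E)%E.
Proof.
have := cube_moments kappa_gt0 rho_gt0 (fun=> ord0) (degree B)
  (measurable_cst (1%E : \bar R)) (fun=> lee01).
by under eq_integral do rewrite mule1; rewrite triple_mean_cst mule1.
Qed.

Section fixed_block.
Variables (N n m : nat) (grp : 'I_N -> bool) (Phi : 'I_N -> 'I_n) (A : 'M[nat]_N).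
Hypotheses (Phi_inj : injective Phi) (Aadj : adjacency A) (Abd : block_diagonal grp A).
Hypotheses (n_gt0 : (0 < n)%N) (em : (num_edges A <= m)%N).

(** The codes follow the order of the arguments of [triple_mean] and [rest_mass]: 0 where [grp] is
    false, 1 where it is true, 2 outside the block. *)
Let lab (u : 'I_n) : 'I_3 :=
  if label Phi u is Some i then (if grp i then @Ordinal 3 1 isT else @Ordinal 3 0 isT)
  else @Ordinal 3 2 isT.

Let labK i : lab (Phi i) = if grp i then @Ordinal 3 1 isT else @Ordinal 3 0 isT.
Proof. by rewrite /lab labelK. Qed.

Let lab_none u : label Phi u = None -> lab u = @Ordinal 3 2 isT.
Proof. by rewrite /lab => ->. Qed.

Let sum_lab (F : 'I_n -> R) (b : bool) :
  \sum_(u | lab u == b :> nat) F u = \sum_(i | grp i == b) F (Phi i).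
Proof.
rewrite big_mkcond (big_label Phi_inj) => [|u u0]; last by rewrite (lab_none u0); case: b.
by rewrite [RHS]big_mkcond; apply: eq_bigr => i _; rewrite labK; case: (grp i); case: b.
Qed.

Let sum_lab2 (F : 'I_n -> R) : \sum_u F u =
  \sum_(u | lab u == 0%N :> nat) F u + \sum_(u | lab u == 1%N :> nat) F u +
  \sum_(u | lab u == 2%N :> nat) F u.
Proof.
rewrite [X in _ = X + _ + _]big_mkcond [X in _ = _ + X + _]big_mkcond.
rewrite [X in _ = _ + _ + X]big_mkcond -!big_split; apply: eq_bigr => u _ /=.
by case: (lab u) => -[|[|[|//]]] ? /=; rewrite ?(addr0, add0r).
Qed.

(** Under the integral of the mixture the sum over counts is evaluated by [sum_block_event] for
    fixed [Z_i]. What remains depends on the block powers and on three group sums, the form that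
    [cube_moments] integrates. *)
Lemma block_probE :
  (block_prob m grp Phi A)%:E =
  ((beta ^+ (2 * m) / rising (kappa * n%:R) (2 * m) * (m`!%:R / (m - num_edges A)`!%:R) *
     edge_weight R A * degree_moment A)%:E *
   triple_mean kappa rho (\sum_(i | ~~ grp i) (kappa + (degree A i)%:R))
     (\sum_(i | grp i) (kappa + (degree A i)%:R)) (kappa * (n%:R - N%:R))
     (fun p => (rest_mass (m - num_edges A) p)%:E))%E.
Proof.
have Z0 x : 0 <= Z x by exact: gamma_cdf_inv_ge0.
have mZ (i : 'I_n) : measurable_fun [set: n.-tuple rT] (fun t => Z (tnth t i)).
  exact: measurableT_comp (measurable_gamma_cdf_inv kappa_gt0 rho_gt0) (measurable_tnth i).
have mprod (d : 'I_n -> nat) :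
    measurable_fun [set: n.-tuple rT] (fun t => (\prod_(i < n) Z (tnth t i) ^+ d i)%:E).
  apply/measurable_EFinP; apply: measurable_prod => i _.
  by apply: measurable_funX; exact: mZ.
have w0 B : 0 <= edge_weight R B.
  rewrite /edge_weight divr_ge0 ?exprn_ge0// mulr_ge0// prodr_ge0// => i _.
  by rewrite prodr_ge0.
(* The power of [beta] undoes the rate in the Gamma moments, as the degrees add up to [2 * m]. *)
pose K := beta ^+ (2 * m) / rising (kappa * n%:R) (2 * m) * m`!%:R.
pose al (a : {ffun 'I_n * 'I_n -> 'I_m.+1}) p : nat := a p.
have pmfE a : slot_counts a -> (pag_pmf kappa m (slot_matrix (al a)))%:E =
    (K%:E * \int[unit_cube_measure R n]_t
      (\prod_p ((multiplicity R p * (Z (tnth t p.1) * Z (tnth t p.2))) ^+ a p / (a p)`!%:R))%:E)%E.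
  move=> /andP[/eqP sa /'forall_implyP up].
  have a0 : zero_above (al a) by move=> p /up/eqP.
  transitivity (K%:E * ((edge_weight R (slot_matrix (al a)))%:E *
      (degree_moment (slot_matrix (al a)))%:E))%E.
    rewrite -!EFinM pag_pmfE /K /degree_moment; congr EFin.
    rewrite big_split /= prodfV -expr_sum sum_degree_slot_matrix.
    rewrite -/(al a) (_ : (\sum_p al a p)%N = m)// -mul2n.
    have bm : beta ^+ (2 * m) != 0 by rewrite expf_neq0// gt_eqF.
    set D := \prod_(i < n) _; set E := edge_weight _ _; set r := rising _ _.
    by field; rewrite bm /r gt_eqF// rising_gt0// mulr_gt0// ltr0n.
  rewrite -cube_degree_moment -ge0_integralZl//; last 2 first.
  - by move=> t _; rewrite lee_fin prodr_ge0// => i _; exact: exprn_ge0.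
  - by rewrite lee_fin.
  congr (_ * _)%E; apply: eq_integral => t _; rewrite -EFinM; congr EFin.
  rewrite prod_degree_slot_matrix edge_weight_slot_matrix// -big_split.
  by apply: eq_bigr => p _; rewrite [in RHS]exprMn mulrAC.
transitivity (K%:E * \int[unit_cube_measure R n]_t
    (\sum_(a : {ffun 'I_n * 'I_n -> 'I_m.+1} | slot_counts a && block_event grp Phi A (slot_matrix (al a)))
      \prod_p ((multiplicity R p * (Z (tnth t p.1) * Z (tnth t p.2))) ^+ a p / (a p)`!%:R))%:E)%E.
  under [in RHS]eq_integral do rewrite -sumEFin -big_filter.
  rewrite ge0_integral_sum//; last 2 first.
  - move=> a; apply/measurable_EFinP; apply: measurable_prod => p _.
    apply: measurable_funM => //; apply: measurable_funX; apply: measurable_funM => //.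
    by apply: measurable_funM; exact: mZ.
  - move=> a t _; rewrite lee_fin prodr_ge0// => p _.
    by rewrite divr_ge0// exprn_ge0// mulr_ge0 ?mulr_ge0// /multiplicity; case: ifP.
  rewrite big_filter ge0_sume_distrr; last first.
    move=> a _; apply: integral_ge0 => t _; rewrite lee_fin prodr_ge0// => p _.
    by rewrite divr_ge0// exprn_ge0// mulr_ge0 ?mulr_ge0// /multiplicity; case: ifP.
  rewrite /block_prob -sumEFin; apply: eq_bigr => a /andP[sa _].
  exact: pmfE.
set M := (m - num_edges A)%N.
pose delta u := degree (embed Phi A) u.
transitivity (K%:E * \int[unit_cube_measure R n]_t ((edge_weight R A / M`!%:R)%:E *
   ((\prod_(i < n) Z (tnth t i) ^+ delta i)%:E *
     (rest_mass M (group_sum kappa rho lab 0 t, group_sum kappa rho lab 1 t,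
        group_sum kappa rho lab 2 t))%:E)))%E.
  congr (_ * _)%E; apply: eq_integral => t _; rewrite -!EFinM; congr EFin.
  transitivity (edge_weight R A * \prod_i Z (tnth t (Phi i)) ^+ degree A i *
    (((\sum_u Z (tnth t u)) ^+ 2 - (\sum_(i | ~~ grp i) Z (tnth t (Phi i))) ^+ 2
      - (\sum_(i | grp i) Z (tnth t (Phi i))) ^+ 2) ^+ M / M`!%:R)).
    exact: (sum_block_event Phi_inj Aadj Abd (fun u => Z (tnth t u)) em).
  rewrite /delta (prod_degree_embed _ _ (fun u => Z (tnth t u)))//.
  pose z u := Z (tnth t u).
  have s0 : \sum_(i | ~~ grp i) z (Phi i) = group_sum kappa rho lab 0 t.
    rewrite /group_sum (sum_lab z false); apply: eq_bigl => i.
    by case: (grp i).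
  have s1 : \sum_(i | grp i) z (Phi i) = group_sum kappa rho lab 1 t.
    rewrite /group_sum (sum_lab z true); apply: eq_bigl => i.
    by case: (grp i).
  have st : \sum_u z u = group_sum kappa rho lab 0 t + group_sum kappa rho lab 1 t +
      group_sum kappa rho lab 2 t by exact: (sum_lab2 z).
  rewrite s0 s1 st /rest_mass /=.
  have g0 g : 0 <= group_sum kappa rho lab g t by apply: sumr_ge0.
  move: (g0 0%N) (g0 1%N) (g0 2%N).
  move: (group_sum _ _ _ 0 _) (group_sum _ _ _ 1 _) (group_sum _ _ _ 2 _) => x y w x0 y0 w0'.
  (* Nonnegative group sums make the free mass nonnegative, so the absolute value in [rest_mass] can
     be removed. *)
  rewrite ger0_norm; last by nra.
  by ring.
have mI : measurable_fun [set: n.-tuple rT] (fun t =>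
    ((\prod_(i < n) Z (tnth t i) ^+ delta i)%:E *
     (rest_mass M (group_sum kappa rho lab 0 t, group_sum kappa rho lab 1 t,
        group_sum kappa rho lab 2 t))%:E)%E).
  apply: emeasurable_funM; first exact: mprod.
  apply/measurable_EFinP; apply: measurableT_comp (measurable_rest_mass M) _.
  by do ?[apply: measurable_fun_pair | exact: measurable_group_sum].
have I0 (t : n.-tuple rT) : (0 <= (\prod_(i < n) Z (tnth t i) ^+ delta i)%:E *
     (rest_mass M (group_sum kappa rho lab 0 t, group_sum kappa rho lab 1 t,
        group_sum kappa rho lab 2 t))%:E)%E.
  rewrite mule_ge0// lee_fin ?exprn_ge0//.
  by rewrite prodr_ge0// => i _; exact: exprn_ge0.
have wM0 : (0 <= (edge_weight R A / M`!%:R)%:E)%E by rewrite lee_fin divr_ge0.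
rewrite (ge0_integralZl _ measurableT mI (fun t _ => I0 t) wM0).
rewrite (cube_moments kappa_gt0 rho_gt0 lab delta (h := fun p => (rest_mass M p)%:E)); last 2 first.
- by apply/measurable_EFinP; exact: measurable_rest_mass.
- by move=> p; rewrite lee_fin exprn_ge0.
rewrite !muleA -!EFinM; congr (_%:E * _)%E.
  have -> : \prod_(i < n) (rising kappa (delta i) / (kappa / rho) ^+ delta i) = degree_moment A.
    rewrite (big_label Phi_inj) => [|u u0].
      by apply: eq_bigr => i _; rewrite /delta degree_embed.
    by rewrite /delta degree_embed0// rising0 expr0 divr1.
  by rewrite /K /M; ring.
have dE i : delta (Phi i) = degree A i by rewrite /delta degree_embed.
have e0 : \sum_(u | lab u == 0%N :> nat) (kappa + (delta u)%:R) =
    \sum_(i | ~~ grp i) (kappa + (degree A i)%:R).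
  rewrite (sum_lab (fun u => kappa + (delta u)%:R) false).
  by apply: eq_big => [i|i _]; [case: (grp i)|rewrite dE].
have e1 : \sum_(u | lab u == 1%N :> nat) (kappa + (delta u)%:R) =
    \sum_(i | grp i) (kappa + (degree A i)%:R).
  rewrite (sum_lab (fun u => kappa + (delta u)%:R) true).
  by apply: eq_big => [i|i _]; [case: (grp i)|rewrite dE].
have e2 : \sum_(u | lab u == 2%N :> nat) (kappa + (delta u)%:R) = kappa * (n%:R - N%:R).
  rewrite (eq_bigr (fun=> kappa)); last first.
    move=> u; rewrite /lab; case lu : (label Phi u) => [i|]; first by case: (grp i).
    by move=> _; rewrite /delta degree_embed0// addr0.
  have := sum_lab2 (fun=> kappa).
  rewrite (sum_lab (fun=> kappa) false) (sum_lab (fun=> kappa) true).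
  have -> : \sum_(i | grp i == false) kappa + \sum_(i | grp i == true) kappa = \sum_(i < N) kappa.
    rewrite [RHS](bigID grp)/= addrC.
    by congr (_ + _); apply: eq_bigl => i; case: (grp i).
  rewrite !sumr_const !card_ord -[kappa *+ n]mulr_natr -[kappa *+ N]mulr_natr mulrBr => ->.
  by rewrite addrC addKr.
by rewrite e0 e1 e2.
Qed.
End fixed_block.
End block_probability.

(** * From triples of Gamma variables to Beta means *)

Section dirichlet_reduction.
Context {R : realType}.
Variables (kappa rho : R).
Hypotheses (kappa_gt0 : 0 < kappa) (rho_gt0 : 0 < rho).
Local Notation rT := (measurableTypeR R).
Let beta := kappa / rho.
Let beta_gt0 : 0 < beta. Proof. exact: divr_gt0. Qed.

Lemma beta_mean_ge0 (a b : R) (f : R -> \bar R) : 0 < a -> 0 < b ->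
  (forall u, 0 <= f u)%E -> (0 <= beta_mean a b f)%E.
Proof.
move=> a0 b0 f0; apply: mule_ge0.
  exact: divr_ge0 (ltW (Gamma_gt0 (addr_gt0 a0 b0)))
    (mulr_ge0 (ltW (Gamma_gt0 a0)) (ltW (Gamma_gt0 b0))).
by apply: integral_ge0 => u _; rewrite mule_ge0// lee_fin beta_kernel_ge0.
Qed.

Lemma beta_meanZ (a b c : R) (f : R -> \bar R) : 0 <= c ->
  measurable_fun [set: R] f -> (forall u, 0 <= f u)%E ->
  (beta_mean a b (fun u => c%:E * f u) = c%:E * beta_mean a b f)%E.
Proof.
move=> c0 mf f0; rewrite /beta_mean [RHS]muleCA; congr (_ * _)%E.
have mk : measurable_fun [set: R] (fun u => (beta_kernel a b u)%:E * f u)%E.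
  apply: emeasurable_funM => //; apply/measurable_EFinP; exact: measurable_beta_kernel.
have k0 u : (0 <= (beta_kernel a b u)%:E * f u)%E by rewrite mule_ge0// lee_fin beta_kernel_ge0.
under eq_integral do rewrite muleCA.
by rewrite ge0_integralZl.
Qed.

Lemma measurable_beta_mean (a b : R) d (T : measurableType d) (f : T * R -> \bar R) :
  measurable_fun [set: T * R] f -> (forall p, 0 <= f p)%E ->
  measurable_fun [set: T] (fun x => beta_mean a b (fun u => f (x, u))).
Proof.
move=> mf f0; apply: emeasurable_funM => //.
apply: (@measurable_fun_fubini_tonelli_F _ _ T rT R (@lebesgue_measure R)
  (fun p : T * R => ((beta_kernel a b p.2)%:E * f p)%E)).
  apply: emeasurable_funM => //; apply/measurable_EFinP.
  by apply: measurableT_comp (measurable_beta_kernel _ _) _.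
by move=> p; rewrite mule_ge0// lee_fin beta_kernel_ge0.
Qed.

Lemma gamma_moment_cst (a : R) (k : nat) (c : \bar R) : 0 < a -> (0 <= c)%E ->
  (\int[gamma_probability a beta]_r ((`|r| ^+ k)%:E * c) = (rising a k / beta ^+ k)%:E * c)%E.
Proof.
move=> a0 c0; rewrite (gamma_probability_moment k a0 beta_gt0 (measurable_cst c) (fun=> c0)).
congr (_ * _)%E.
rewrite -[RHS]mule1 -(probability_setT (gamma_probability (a + k%:R) beta)).
exact: integral_cst.
Qed.

(** The second group is empty here. The free mass is homogeneous of degree 2 in the total [r], so
    [r] factors out with exponent [2 * M] and leaves a function of the share [u] of the block. *)
Lemma triple_mean_single (a b : R) (M : nat) : 0 < a -> 0 < b ->
  triple_mean kappa rho a 0 b (fun p => (rest_mass M p)%:E) =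
  ((rising (a + b) (2 * M) / beta ^+ (2 * M))%:E *
   beta_mean a b (fun u => (`|1 - u ^+ 2| ^+ M)%:E))%E.
Proof.
move=> a0 b0; rewrite /triple_mean.
pose H (p : R * R) := (rest_mass M (p.1, 0, p.2))%:E.
have mrm : measurable_fun setT (fun p : R * R * R => (rest_mass M p)%:E).
  by apply/measurable_EFinP; exact: measurable_rest_mass.
have mH : measurable_fun [set: R * R] H.
  apply: measurableT_comp mrm _.
  by do ?[apply: measurable_fun_pair].
transitivity (\int[gamma_probability a beta]_s \int[gamma_probability b beta]_t H (s, t))%E.
  apply: eq_integral => x _; rewrite integral_gamma_probability0//.
  apply: (measurable_integral_section _ (k := fun p : R * R => (rest_mass M (x, p.1, p.2))%:E)) => //.
    apply: measurableT_comp mrm _.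
    by do ?[apply: measurable_fun_pair].
  by move=> p; rewrite lee_fin exprn_ge0.
rewrite gamma_probability_split//; last by move=> p; rewrite lee_fin exprn_ge0.
have mE : measurable_fun [set: R] (fun u : R => (`|1 - u ^+ 2| ^+ M)%:E).
  apply/measurable_EFinP; apply: measurable_funX; apply: measurableT_comp => //.
  by apply: measurable_funB => //; exact: measurable_funX.
have E0 (u : R) : (0 <= (`|1 - u ^+ 2| ^+ M)%:E)%E by rewrite lee_fin exprn_ge0.
rewrite -gamma_moment_cst ?addr_gt0 ?beta_mean_ge0//.
apply: eq_integral => r _; rewrite -beta_meanZ ?exprn_ge0//.
congr beta_mean; apply/funext => u; rewrite -EFinM /H /rest_mass /=; congr EFin.
rewrite exprM -exprMn; congr (_ ^+ M); rewrite -normrX -normrM; congr `|_|.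
by ring.
Qed.

(** Splitting twice gives the masses [r * u] and [r * (1 - u) * v] for the groups and
    [r * (1 - u) * (1 - v)] for the rest; the total [r] factors out by homogeneity. *)
Lemma triple_mean_double (a b : R) (M : nat) : 0 < a -> 0 < b ->
  triple_mean kappa rho a a b (fun p => (rest_mass M p)%:E) =
  ((rising (a + (a + b)) (2 * M) / beta ^+ (2 * M))%:E *
   beta_mean a (a + b) (fun u => beta_mean a b
     (fun v => (`|1 - (u ^+ 2 + (1 - u) ^+ 2 * v ^+ 2)| ^+ M)%:E)))%E.
Proof.
move=> a0 b0; rewrite /triple_mean.
have mrm : measurable_fun setT (fun p : R * R * R => (rest_mass M p)%:E).
  by apply/measurable_EFinP; exact: measurable_rest_mass.
have rm0 p : (0 <= (rest_mass M p : R)%:E)%E by rewrite lee_fin exprn_ge0.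
pose K (q : R * R * R) := (rest_mass M (q.1.1, q.1.2 * q.2, q.1.2 * (1 - q.2)))%:E.
have mK : measurable_fun setT K.
  apply: measurableT_comp mrm _.
  have m12 : measurable_fun setT (fun q : R * R * R => q.1.2) by exact: measurableT_comp.
  apply: measurable_fun_pair.
    by apply: measurable_fun_pair; [exact: measurableT_comp|exact: measurable_funM].
  by apply: measurable_funM => //; exact: measurable_funB.
have K0 q : (0 <= K q)%E by rewrite lee_fin exprn_ge0.
pose H (p : R * R) := beta_mean a b (fun v => K (p, v)).
have mH : measurable_fun [set: R * R] H by exact: measurable_beta_mean.
have H0 p : (0 <= H p)%E by exact: beta_mean_ge0.
transitivity (\int[gamma_probability a beta]_s \int[gamma_probability (a + b) beta]_t H (s, t))%E.
  apply: eq_integral => x _.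
  rewrite (gamma_probability_split (H := fun p : R * R => (rest_mass M (x, p.1, p.2))%:E))//.
  apply: measurableT_comp mrm _.
  by do ?[apply: measurable_fun_pair].
have ab0 : 0 < a + b by rewrite addr_gt0.
rewrite gamma_probability_split//.
pose E (p : R * R) := (`|1 - (p.1 ^+ 2 + (1 - p.1) ^+ 2 * p.2 ^+ 2)| ^+ M)%:E.
have mE : measurable_fun [set: R * R] E.
  apply/measurable_EFinP; apply: measurable_funX; apply: measurableT_comp => //.
  apply: measurable_funB => //; apply: measurable_funD; first exact: measurable_funX.
  apply: measurable_funM; last exact: measurable_funX.
  by apply: measurable_funX; exact: measurable_funB.
have E0 p : (0 <= E p)%E by rewrite lee_fin exprn_ge0.
have mB : measurable_fun [set: R] (fun u => beta_mean a b (fun v => E (u, v))).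
  exact: measurable_beta_mean.
have B0 u : (0 <= beta_mean a b (fun v => E (u, v)))%E by exact: beta_mean_ge0.
rewrite -gamma_moment_cst ?addr_gt0 ?beta_mean_ge0//.
apply: eq_integral => r _; rewrite -(beta_meanZ _ _ _ mB B0) ?exprn_ge0//.
congr beta_mean; apply/funext => u; rewrite /H -beta_meanZ ?exprn_ge0//; last first.
  exact: measurableT_comp mE (pair1_measurable u).
congr beta_mean; apply/funext => v; rewrite -EFinM /K /rest_mass /=; congr EFin.
rewrite exprM -exprMn; congr (_ ^+ M); rewrite -normrX -normrM; congr `|_|.
by ring.
Qed.

End dirichlet_reduction.

(** * Asymptotics of the constants in a block probability *)

Section block_limits.
Context {R : realType}.
Variables (kappa rho : R).
Hypotheses (kappa_gt0 : 0 < kappa) (rho_gt0 : 0 < rho).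
Local Notation rT := (measurableTypeR R).
Let beta := kappa / rho.
Let beta_gt0 : 0 < beta. Proof. exact: divr_gt0. Qed.

(** The Beta limits come with rate [kappa], the coordinates of the cube with rate [kappa / rho]; a
    dilation by [rho] relates them. *)
Lemma gamma_probability_scale (a b c : R) (h : R -> \bar R) :
  0 < a -> 0 < b -> 0 < c -> measurable_fun [set: R] h -> (forall x, 0 <= h x)%E ->
  (\int[gamma_probability a (b / c)]_s h s = \int[gamma_probability a b]_x h (c * x)%R)%E.
Proof.
move=> a0 b0 c0 mh h0; have bc0 : 0 < b / c by rewrite divr_gt0.
have mhc : measurable_fun [set: R] (fun x => h (c * x)).
  by apply: measurableT_comp mh _; exact: measurable_funM.
rewrite (integral_gamma_probability a0 bc0 mh h0).
rewrite (integral_gamma_probability a0 b0 mhc (fun x => h0 (c * x))).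
have mph : measurable_fun [set: R] (fun x => (gamma_pdf x a (b / c))%:E * h x)%E.
  by apply: emeasurable_funM => //; apply/measurable_EFinP; exact: measurable_gamma_pdf.
have ph0 x : (0 <= (gamma_pdf x a (b / c))%:E * h x)%E.
  by rewrite mule_ge0// lee_fin gamma_pdf_ge0.
rewrite (ge0_integral_scale c0 mph ph0).
have mphc : measurable_fun [set: R] (fun x => (gamma_pdf (c * x) a (b / c))%:E * h (c * x)%R)%E.
  by apply: measurableT_comp mph _; exact: measurable_funM.
rewrite -ge0_integralZl//; last by rewrite lee_fin ltW.
apply: eq_integral => x _; rewrite muleA -EFinM; congr (_%:E * _)%E.
rewrite /gamma_pdf pmulr_rgt0//; case: ifP => x0; last by rewrite mulr0.
have ca : 0 < c `^ a by rewrite powR_gt0.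
have ga := Gamma_gt0 a0.
have -> : b / c * (c * x) = b * x by field; rewrite gt_eqF.
have ci0 : 0 <= c^-1 by rewrite invr_ge0 ltW.
rewrite (powRM _ (ltW c0) (ltW x0)) (powRM _ (ltW b0) ci0).
have -> : c^-1 `^ a = (c `^ a)^-1.
  by rewrite -(powR_inv1 (ltW c0)) -powRrM mulN1r powRN.
have -> : c `^ (a - 1) = c `^ a / c.
  by rewrite powRB ?(powRr1 (ltW c0))//; apply/implyP => _; rewrite gt_eqF.
move: (Gamma a) ga => G ga.
by field; rewrite !gt_eqF.
Qed.

(** The exponent is that of the product of all Poisson weights of the limit, [s] being the sum of
    the Gamma variables of the block. *)
Definition gauss_mean (a : R) : R :=
  fine (\int[gamma_probability a beta]_s (expR (- (s ^+ 2 / (2 * rho))))%:E)%E.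

Let measurable_gauss (c : R) : measurable_fun [set: R] (fun x : R => (expR (- (x ^+ 2 / c)))%:E).
Proof.
apply/measurable_EFinP; apply: measurableT_comp => //; apply: measurable_funN.
by apply: measurable_funM => //; exact: measurable_funX.
Qed.

Lemma gauss_mean_fineK (a : R) :
  ((gauss_mean a)%:E = \int[gamma_probability a beta]_s (expR (- (s ^+ 2 / (2 * rho))))%:E)%E.
Proof.
rewrite /gauss_mean fineK// ge0_fin_numE; last first.
  by apply: integral_ge0 => x _; rewrite lee_fin expR_ge0.
apply: (@le_lt_trans _ _ (\int[gamma_probability a beta]_x (cst 1 x))%E).
  apply: ge0_le_integral => //.
    exact: measurable_gauss.
  move=> x _; rewrite lee_fin expR_le1 oppr_le0 divr_ge0// ?sqr_ge0// mulr_ge0//.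
  exact: ltW.
by rewrite integral_cst// mul1e (le_lt_trans (probability_le1 _ _))// ltry.
Qed.

Lemma gauss_meanE (a : R) : 0 < a ->
  (\int[gamma_probability a kappa]_x (expR (- (rho / 2 * x ^+ 2)))%:E = (gauss_mean a)%:E)%E.
Proof.
move=> a0; rewrite gauss_mean_fineK.
have e0 (x : R) : (0 <= (expR (- (x ^+ 2 / (2 * rho))))%:E)%E by rewrite lee_fin expR_ge0.
rewrite (gamma_probability_scale a0 kappa_gt0 rho_gt0 (measurable_gauss (2 * rho)) e0).
apply: eq_integral => x _; congr (expR (- _))%:E.
by field; rewrite gt_eqF.
Qed.

Lemma rising_cvg (k : nat) : rising (kappa * n%:R) k / n%:R ^+ k @[n --> \oo] --> kappa ^+ k.
Proof.
elim: k => [|k IH].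
  rewrite expr0; under eq_fun do rewrite rising0 expr0 divr1; exact: cvg_cst.
have h : (kappa * n%:R + k%:R) / n%:R @[n --> \oo] --> kappa.
  have h1 : kappa + k%:R / n%:R @[n --> \oo] --> kappa.
    rewrite -[X in _ --> X]addr0; apply: cvgD; first exact: cvg_cst.
    rewrite -(mulr0 k%:R); apply: cvgM; first exact: cvg_cst.
    by rewrite -cvg_shiftS; exact: cvg_harmonic.
  apply: cvg_trans h1; apply: near_eq_cvg; near=> n.
  have n0 : n%:R != 0 :> R by rewrite pnatr_eq0 -lt0n; near: n; exists 1%N.
  by field.
have -> : (fun n => rising (kappa * n%:R) k.+1 / n%:R ^+ k.+1) =
    (fun n => (rising (kappa * n%:R) k / n%:R ^+ k) * ((kappa * n%:R + k%:R) / n%:R)).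
  by apply/funext => n; rewrite risingS exprSr invfM; ring.
by rewrite exprSr; exact: cvgM.
Unshelve. all: by end_near. Qed.

Variable m : nat -> nat.
Hypothesis m_lim : (2 * m n)%:R / n%:R ^+ 2 @[n --> \oo] --> rho.

Let inv_cvg (x : R) : x / n%:R @[n --> \oo] --> (0 : R).
Proof.
rewrite -(mulr0 x); apply: cvgM; first exact: cvg_cst.
by rewrite -cvg_shiftS; exact: cvg_harmonic.
Qed.

Let m_cvg (e : nat) : (m n)%:R / n%:R ^+ 2 - e%:R / n%:R ^+ 2 @[n --> \oo] --> rho / 2.
Proof.
rewrite -[X in _ --> X]subr0; apply: cvgB.
  have -> : (fun n => (m n)%:R / n%:R ^+ 2) = (fun n => (2 * m n)%:R / n%:R ^+ 2 / 2) :> (nat -> R).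
    by apply/funext => n; rewrite natrM mulrAC [2%:R * _]mulrC mulfK.
  by apply: cvgM => //; exact: cvg_cst.
have -> : (fun n => e%:R / n%:R ^+ 2) = (fun n => e%:R / n%:R * (1 / n%:R)) :> (nat -> R).
  by apply/funext => n; rewrite mul1r -mulrA -invfM -expr2.
by rewrite -(mulr0 0); apply: cvgM; exact: inv_cvg.
Qed.

Lemma near_leq_m (e : nat) : \forall n \near \oo, (e <= m n)%N.
Proof.
near=> n.
have : 0 < (m n)%:R / n%:R ^+ 2 - e%:R / n%:R ^+ 2 :> R.
  by near: n; apply: (cvgr_gt _ (m_cvg e)); rewrite divr_gt0.
have n0 : 0 < n%:R ^+ 2 :> R by rewrite exprn_gt0// ltr0n; near: n; exists 1%N.
by rewrite -mulrBl pmulr_lgt0 ?invr_gt0// subr_gt0 ltr_nat => /ltnW.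
Unshelve. all: by end_near. Qed.

Lemma subn_m_cvg (e : nat) : (m n - e)%N%:R / n%:R ^+ 2 @[n --> \oo] --> rho / 2.
Proof.
apply: cvg_trans (m_cvg e); apply: near_eq_cvg; near=> n.
rewrite natrB ?mulrBl//; near: n; exact: near_leq_m.
Unshelve. all: by end_near. Qed.

Lemma ffact_m_cvg (e : nat) : (m n ^_ e)%:R / n%:R ^+ (2 * e) @[n --> \oo] --> (rho / 2) ^+ e.
Proof.
elim: e => [|e IH].
  rewrite expr0; under eq_fun do rewrite ffactn0 muln0 expr0 divr1; exact: cvg_cst.
have -> : (fun n => (m n ^_ e.+1)%:R / n%:R ^+ (2 * e.+1)) =
    (fun n => ((m n ^_ e)%:R / n%:R ^+ (2 * e)) * ((m n - e)%N%:R / n%:R ^+ 2)) :> (nat -> R).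
  by apply/funext => n; rewrite ffactnSr natrM mulnS addnC exprD invfM; ring.
by rewrite exprSr; apply: cvgM => //; exact: subn_m_cvg.
Qed.

(** What is left of the constant of [block_probE] once the moment of order [2 * (m n - e)] of the
    total mass has cancelled; the falling factorial is the ratio of the two factorials there. *)
Definition block_const (e n : nat) : R :=
  beta ^+ (2 * e) * (m n ^_ e)%:R / rising (kappa * n%:R) (2 * e).

Lemma block_const_cvg (e : nat) : block_const e n @[n --> \oo] --> (2 * rho)^-1 ^+ e.
Proof.
have h : beta ^+ (2 * e) * ((m n ^_ e)%:R / n%:R ^+ (2 * e)) /
    (rising (kappa * n%:R) (2 * e) / n%:R ^+ (2 * e)) @[n --> \oo] --> (2 * rho)^-1 ^+ e.
  (* Per edge: [beta ^+ 2] from the Gamma rate, [rho / 2] from [m n] over [n ^+ 2], and [kappa ^+ 2]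
     from the rising factorial. *)
  have -> : (2 * rho)^-1 ^+ e = beta ^+ (2 * e) * (rho / 2) ^+ e / kappa ^+ (2 * e).
    rewrite !exprM -!exprMn -exprVn -exprMn; congr (_ ^+ e); rewrite /beta.
    by field; rewrite !gt_eqF.
  apply: cvgM.
    by apply: cvgM; [exact: cvg_cst|exact: ffact_m_cvg].
  by apply: cvgV; [rewrite expf_neq0// gt_eqF|exact: rising_cvg].
apply: cvg_trans h; apply: near_eq_cvg; near=> n.
have n0 : 0 < n%:R :> R by rewrite ltr0n; near: n; exists 1%N.
rewrite /block_const; field.
by rewrite expf_neq0 ?gt_eqF// rising_gt0// mulr_gt0.
Unshelve. all: by end_near. Qed.

(** Common to one and two blocks, with [B] the single or double Beta mean. The rising factorial of
    length [2 * m n] splits at [2 * num_edges A], and its second factor cancels against the moment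
    of the total mass. *)
Lemma block_prob_const N n (grp : 'I_N -> bool) (Phi : 'I_N -> 'I_n) (A : 'M[nat]_N) (B : \bar R) :
  injective Phi -> adjacency A -> block_diagonal grp A -> (0 < n)%N ->
  (num_edges A <= m n)%N -> B \is a fin_num ->
  triple_mean kappa rho (\sum_(i | ~~ grp i) (kappa + (degree A i)%:R))
     (\sum_(i | grp i) (kappa + (degree A i)%:R)) (kappa * (n%:R - N%:R))
     (fun p => (rest_mass (m n - num_edges A) p)%:E) =
  ((rising (kappa * n%:R + (2 * num_edges A)%:R) (2 * (m n - num_edges A)) /
    beta ^+ (2 * (m n - num_edges A)))%:E * B)%E ->
  block_prob kappa (m n) grp Phi A =
  edge_weight R A * degree_moment kappa rho A * block_const (num_edges A) n * fine B.
Proof.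
move=> Phi_inj Aadj Abd n0 em Bfin tE; apply: EFin_inj.
rewrite (block_probE kappa_gt0 rho_gt0 Phi_inj Aadj Abd n0 em) tE -(fineK Bfin) muleA -!EFinM.
congr (_ * _)%:E; rewrite /block_const.
set e := num_edges A; set M := (m n - e)%N.
have mE : (m n = e + M)%N by rewrite /M subnKC.
have -> : (2 * m n = 2 * e + 2 * M)%N by rewrite mE mulnDr.
rewrite risingD exprD -(ffact_fact em) -/e -/M (natrM _ (m n ^_ e)).
have kn : 0 < kappa * n%:R by rewrite mulr_gt0// ltr0n.
have r1 := rising_gt0 (2 * e) kn.
have r2 : 0 < rising (kappa * n%:R + (2 * e)%:R) (2 * M) by rewrite rising_gt0// ltr_wpDr.
have b2 : 0 < beta ^+ (2 * M) by rewrite exprn_gt0.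
have fM : 0 < M`!%:R :> R by rewrite ltr0n fact_gt0.
rewrite -/beta; move: (edge_weight R A) (degree_moment _ _ _) => w P.
move: (rising _ (2 * M)) r2 (rising _ (2 * e)) r1 => r r20 s s0.
move: (beta ^+ (2 * M)) b2 (beta ^+ (2 * e)) (M`!%:R) fM ((_ ^_ _)%:R) => x x0 y f f0 g.
by field; rewrite !gt_eqF.
Qed.
End block_limits.

(** * Two disjoint copies of a block *)

Section double_matrix.
Variables (k : nat) (A : 'M[nat]_k).

Definition second_half (i : 'I_(k + k)) : bool := (k <= i)%N.

(** The zero blocks are placeholders: with the grouping [second_half] their entries are not
    prescribed. *)
Definition double_mx : 'M[nat]_(k + k) :=
  block_mx A (const_mx 0%N) (const_mx 0%N) A.

Lemma double_mxE (i j : 'I_k) :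
  (double_mx (lshift k i) (lshift k j) = A i j) *
  (double_mx (lshift k i) (rshift k j) = 0%N) *
  (double_mx (rshift k i) (lshift k j) = 0%N) *
  (double_mx (rshift k i) (rshift k j) = A i j).
Proof.
by rewrite /double_mx block_mxEul block_mxEur block_mxEdl block_mxEdr !mxE.
Qed.

Lemma second_halfE (i : 'I_k) :
  (second_half (lshift k i) = false) * (second_half (rshift k i) = true).
Proof. by rewrite /second_half /= leqNgt ltn_ord leq_addr. Qed.

Lemma adjacency_double_mx : adjacency A -> adjacency double_mx.
Proof.
move=> [As Ae]; split=> [i j|i].
  case: (split_ordP i) => i' ->; case: (split_ordP j) => j' ->; rewrite !double_mxE//.
by case: (split_ordP i) => i' ->; rewrite !double_mxE.
Qed.

Lemma block_diagonal_double_mx : block_diagonal second_half double_mx.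
Proof.
move=> i j; case: (split_ordP i) => i' ->; case: (split_ordP j) => j' ->;
  by rewrite !second_halfE !double_mxE.
Qed.

Lemma degree_double_mx (i : 'I_k) :
  (degree double_mx (lshift k i) = degree A i) *
  (degree double_mx (rshift k i) = degree A i).
Proof.
rewrite /degree !big_split_ord /=; split.
  rewrite [X in (_ + X)%N]big1 ?addn0 => [|j _]; last by rewrite double_mxE.
  by apply: eq_bigr => j _; rewrite double_mxE.
rewrite big1 ?add0n => [|j _]; last by rewrite double_mxE.
by apply: eq_bigr => j _; rewrite double_mxE.
Qed.

Lemma num_edges_double_mx : adjacency A -> num_edges double_mx = (2 * num_edges A)%N.
Proof.
move=> Aadj; apply: double_inj; rewrite -sum_degree_adjacency; last exact: adjacency_double_mx.
rewrite big_split_ord /= mul2n -!sum_degree_adjacency// -addnn.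
by congr (_ + _)%N; apply: eq_bigr => i _; rewrite degree_double_mx.
Qed.

Lemma edge_weight_double_mx (R : realType) :
  edge_weight R double_mx = edge_weight R A ^+ 2.
Proof.
rewrite !edge_weightE expr_div_n !big_split_ord /= !expr2; congr (_ / _); last first.
  by congr *%R; apply: eq_bigr => i _; rewrite double_mxE.
congr *%R; apply: eq_bigr => i _; rewrite [LHS]big_mkcond big_split_ord /= [RHS]big_mkcond.
  rewrite [X in _ * X]big1 ?mulr1 => [|j _]; last by rewrite double_mxE divr1 if_same.
  by apply: eq_bigr => j _; rewrite double_mxE.
rewrite [X in X * _]big1 ?mul1r => [|j _]; last by rewrite double_mxE divr1 if_same.
by apply: eq_bigr => j _; rewrite double_mxE ltn_add2l.
Qed.

Lemma degree_moment_double_mx (R : realType) (kappa rho : R) :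
  degree_moment kappa rho double_mx = degree_moment kappa rho A ^+ 2.
Proof.
rewrite /degree_moment big_split_ord /= expr2.
by congr *%R; apply: eq_bigr => i _; rewrite degree_double_mx.
Qed.

Lemma sum_second_half (R : realType) (kappa : R) :
  (\sum_(i | ~~ second_half i) (kappa + (degree double_mx i)%:R) =
    \sum_(i < k) (kappa + (degree A i)%:R)) *
  (\sum_(i | second_half i) (kappa + (degree double_mx i)%:R) =
    \sum_(i < k) (kappa + (degree A i)%:R)).
Proof.
split; rewrite big_mkcond big_split_ord /=.
  rewrite [X in _ + X]big1 ?addr0 => [|i _]; last by rewrite second_halfE.
  by apply: eq_bigr => i _; rewrite second_halfE degree_double_mx.
rewrite big1 ?add0r => [|i _]; last by rewrite second_halfE.
by apply: eq_bigr => i _; rewrite second_halfE degree_double_mx.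
Qed.

Lemma sum_kappa_degree (R : realType) (kappa : R) : adjacency A ->
  \sum_(i < k) (kappa + (degree A i)%:R) = kappa * k%:R + (2 * num_edges A)%:R.
Proof.
move=> Aadj; rewrite big_split /= sumr_const card_ord -[kappa *+ k]mulr_natr.
by rewrite -natr_sum sum_degree_adjacency// mul2n.
Qed.

End double_matrix.

Section limits.
Context {R : realType}.
Variables (kappa rho : R).
Hypotheses (kappa_gt0 : 0 < kappa) (rho_gt0 : 0 < rho).
Variable m : nat -> nat.
Hypothesis m_lim : (2 * m n)%:R / n%:R ^+ 2 @[n --> \oo] --> rho.
Variables (k : nat) (A : 'M[nat]_k).
Hypotheses (k_gt0 : (0 < k)%N) (Aadj : adjacency A).

Let a := \sum_(i < k) (kappa + (degree A i)%:R).
Let e := num_edges A.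

(** The closed form in which the limit of the block probabilities and the density of the
    multigraphon are compared. *)
Definition limit_density : R :=
  edge_weight R A * degree_moment kappa rho A * (2 * rho)^-1 ^+ e * gauss_mean kappa rho a.

Let a_gt0 : 0 < a.
Proof.
rewrite /a sum_kappa_degree// ltr_wpDr//.
by rewrite mulr_gt0// ltr0n.
Qed.

Let b_cvg (N : nat) : kappa * (n%:R - N%:R) / n%:R @[n --> \oo] --> kappa.
Proof.
have h : kappa * (1 - N%:R / n%:R) @[n --> \oo] --> kappa.
  rewrite -[X in _ --> X]mulr1; apply: cvgM; first exact: cvg_cst.
  rewrite -[X in _ --> X]subr0; apply: cvgB; first exact: cvg_cst.
  rewrite -(mulr0 N%:R); apply: cvgM; first exact: cvg_cst.
  by rewrite -cvg_shiftS; exact: cvg_harmonic.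
apply: cvg_trans h; apply: near_eq_cvg; near=> n.
have n0 : n%:R != 0 :> R by rewrite pnatr_eq0 -lt0n; near: n; exists 1%N.
by field.
Unshelve. all: by end_near. Qed.

Let single_mean n := beta_mean a (kappa * (n%:R - k%:R))
  (fun u => (`|1 - u ^+ 2| ^+ (m n - e))%:E).

Let double_mean n := beta_mean a (a + kappa * (n%:R - (k + k)%N%:R))
  (fun u => beta_mean a (kappa * (n%:R - (k + k)%N%:R))
     (fun v => (`|1 - (u ^+ 2 + (1 - u) ^+ 2 * v ^+ 2)| ^+ (m n - 2 * e))%:E)).

Let abs_subr1_itv01 (M : nat) (x : R) : 0 <= x <= 1 -> ((`|1 - x| ^+ M)%:E <= 1)%E.
Proof.
move=> /andP[x0 x1]; rewrite lee_fin exprn_ile1//.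
by rewrite ler_norml; apply/andP; split; lra.
Qed.

Let fin_num_itv01 (x : \bar R) : (0 <= x <= 1)%E -> x \is a fin_num.
Proof. by move=> /andP[x0 x1]; rewrite ge0_fin_numE// (le_lt_trans x1)// ltry. Qed.

(** The closed form of a block probability does not involve the injective map [Phi], so one sequence
    [q] serves all such maps at once; averaging over maps relies on this uniformity. *)
Lemma single_block_limit : exists2 q : nat -> R, q n @[n --> \oo] --> limit_density &
  \forall n \near \oo, forall Phi : 'I_k -> 'I_n, injective Phi ->
    block_prob kappa (m n) (fun=> false) Phi A = q n.
Proof.
exists (fun n => edge_weight R A * degree_moment kappa rho A *
  block_const kappa rho m e n * fine (single_mean n)).
  apply: cvgM; first by apply: cvgM; [exact: cvg_cst|exact: block_const_cvg].
  have := @beta_mean_single_cvg R a kappa a_gt0 kappa_gt0 _ (fun n => (m n - e)%N) (rho / 2)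
    (b_cvg k) (subn_m_cvg rho_gt0 m_lim e).
  by rewrite gauss_meanE// => /fine_cvgP[_].
near=> n => Phi Phi_inj.
have kn : (k < n)%N by near: n; exists k.+1.
have em : (e <= m n)%N by near: n; exact: (near_leq_m rho_gt0 m_lim).
have b0 : 0 < kappa * (n%:R - k%:R) by rewrite mulr_gt0// subr_gt0 ltr_nat.
apply: block_prob_const => //.
- exact: leq_ltn_trans kn.
- apply/fin_num_itv01/beta_mean_itv01 => //.
  + apply/measurable_EFinP; apply: measurable_funX; apply: measurableT_comp => //.
    by apply: measurable_funB => //; exact: measurable_funX.
  + move=> u /andP[u0 u1]; apply: abs_subr1_itv01.
    by rewrite sqr_ge0 exprn_ile1// ltW.
(* With [grp] constantly false the second group is empty and gets shape 0. *)
rewrite [X in triple_mean _ _ _ X]big_pred0_eq triple_mean_single//.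
congr ((rising _ _ / _)%:E * _)%E.
by rewrite sum_kappa_degree//; ring.
Unshelve. all: by end_near. Qed.

(** Edge weight and degree moment are multiplicative over the two diagonal blocks, the number of
    edges is additive, and the double Beta mean tends to a square. *)
Lemma double_block_limit : exists2 q : nat -> R, q n @[n --> \oo] --> limit_density ^+ 2 &
  \forall n \near \oo, forall Phi : 'I_(k + k) -> 'I_n, injective Phi ->
    block_prob kappa (m n) (@second_half k) Phi (double_mx A) = q n.
Proof.
exists (fun n => edge_weight R A ^+ 2 * degree_moment kappa rho A ^+ 2 *
  block_const kappa rho m (2 * e) n * fine (double_mean n)).
  have -> : limit_density ^+ 2 = edge_weight R A ^+ 2 * degree_moment kappa rho A ^+ 2 *
      (2 * rho)^-1 ^+ (2 * e) * gauss_mean kappa rho a ^+ 2.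
    by rewrite /limit_density !exprMn -[(2 * e)%N]mulnC exprM.
  apply: cvgM; first by apply: cvgM; [exact: cvg_cst|exact: block_const_cvg].
  have r2 : 0 <= rho / 2 by rewrite divr_ge0// ltW.
  have := @beta_mean_double_cvg R a kappa a_gt0 kappa_gt0 _ (fun n => (m n - 2 * e)%N) (rho / 2)
    (b_cvg (k + k)) r2 (subn_m_cvg rho_gt0 m_lim (2 * e)).
  by rewrite gauss_meanE// -EFinM -expr2 => /fine_cvgP[_].
near=> n => Phi Phi_inj.
have kn : (k + k < n)%N by near: n; exists (k + k).+1.
have em : (2 * e <= m n)%N by near: n; exact: (near_leq_m rho_gt0 m_lim).
have b0 : 0 < kappa * (n%:R - (k + k)%N%:R) by rewrite mulr_gt0// subr_gt0 ltr_nat.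
have ab0 : 0 < a + kappa * (n%:R - (k + k)%N%:R) by rewrite addr_gt0.
have itv (u v : R) : 0 < u < 1 -> 0 < v < 1 -> 0 <= u ^+ 2 + (1 - u) ^+ 2 * v ^+ 2 <= 1.
  move=> /andP[u0 u1] /andP[v0 v1]; apply/andP; split.
    by apply: addr_ge0; [|apply: mulr_ge0]; exact: sqr_ge0.
  have v2 : v ^+ 2 <= 1 by rewrite exprn_ile1// ltW.
  have u2 : 0 <= (1 - u) ^+ 2 by exact: sqr_ge0.
  have := ler_wpM2l u2 v2; rewrite mulr1; nra.
have mE : measurable_fun [set: R * R]
    (fun p : R * R => (`|1 - (p.1 ^+ 2 + (1 - p.1) ^+ 2 * p.2 ^+ 2)| ^+ (m n - 2 * e))%:E).
  apply/measurable_EFinP; apply: measurable_funX; apply: measurableT_comp => //.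
  apply: measurable_funB => //; apply: measurable_funD; first exact: measurable_funX.
  apply: measurable_funM; last exact: measurable_funX.
  by apply: measurable_funX; exact: measurable_funB.
have E0 (p : R * R) : (0 <= (`|1 - (p.1 ^+ 2 + (1 - p.1) ^+ 2 * p.2 ^+ 2)| ^+ (m n - 2 * e))%:E)%E.
  by rewrite lee_fin.
rewrite -edge_weight_double_mx -degree_moment_double_mx -num_edges_double_mx//.
apply: block_prob_const => //.
- exact: adjacency_double_mx.
- exact: block_diagonal_double_mx.
- exact: leq_ltn_trans kn.
- by rewrite num_edges_double_mx.
- apply/fin_num_itv01/beta_mean_itv01 => //.
  + exact: (measurable_beta_mean a (kappa * (n%:R - (k + k)%N%:R)) mE E0).
  + by move=> u; apply: beta_mean_ge0 => // v; exact: (E0 (u, v)).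
  + move=> u u01.
    suff /andP[] : (0 <= beta_mean a (kappa * (n%:R - (k + k)%N%:R)) (fun v =>
      (`|1 - (u ^+ 2 + (1 - u) ^+ 2 * v ^+ 2)| ^+ (m n - 2 * e))%:E) <= 1)%E by [].
    apply: beta_mean_itv01 => //.
    * exact: (measurableT_comp mE (measurable_fun_pair (measurable_cst u) (@measurable_id _ _ setT))).
    * by move=> v v01; apply/abs_subr1_itv01/itv.
rewrite (sum_second_half A kappa).1 (sum_second_half A kappa).2 num_edges_double_mx//.
rewrite (triple_mean_double kappa_gt0 rho_gt0 (m n - 2 * e) a_gt0 b0).
(* The degrees of each copy add up to [2 * e], and the [kappa] of the [2 * k] block vertices restore
   the total [kappa * n]. *)
have -> : a + (a + kappa * (n%:R - (k + k)%N%:R)) = kappa * n%:R + (2 * (2 * e))%:R.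
  by rewrite /a sum_kappa_degree//; ring.
by [].
Unshelve. all: by end_near. Qed.
End limits.

(** * The limit multigraphon *)

Section multigraphon_pag_limit.
Context {R : realType}.

Lemma poisson_weight_ge0 k (lambda : R) : 0 <= lambda -> 0 <= poisson_weight k lambda.
Proof. by move=> l0; rewrite mulr_ge0 ?expR_ge0// divr_ge0// exprn_ge0. Qed.

Lemma series_poisson_weight (lambda : R) :
  series (fun k => poisson_weight k lambda) n @[n --> \oo] --> (1 : R).
Proof.
have -> : series (fun k => poisson_weight k lambda) =
    fun n => expR (- lambda) * series (exp_coeff lambda) n.
  by apply/funext => n; rewrite /series /= mulr_sumr.
rewrite -(expR0 R) -(addNr lambda) expRD; apply: cvgM; first exact: cvg_cst.
exact: is_cvg_series_exp_coeff.
Qed.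

Lemma poisson_weight_itv01 k (lambda : R) : 0 <= lambda -> 0 <= poisson_weight k lambda <= 1.
Proof.
move=> l0; rewrite poisson_weight_ge0//=.
have cv := series_poisson_weight lambda.
rewrite -(cvg_lim _ cv)//; apply: (@le_trans _ _ (series (fun k => poisson_weight k lambda) k.+1)).
  rewrite /series /= big_nat_recr//= lerDr sumr_ge0// => i _; exact: poisson_weight_ge0.
apply: nondecreasing_cvgn_le; last by apply/cvg_ex; exists 1.
by apply/nondecreasing_seqP => n; rewrite /series /= big_nat_recr//= lerDl poisson_weight_ge0.
Qed.

(** Exactly [uphalf n] of the indices below [n] are even. This reduces the diagonal clause of the
    limit to an ordinary Poisson series. *)
Lemma series_even (u : nat -> R) n :
  series (fun k => (~~ odd k : nat)%:R * u k./2) n = series u (uphalf n).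
Proof.
elim: n => [|n IH]; first by rewrite /series /= !big_nil.
rewrite /series /= big_nat_recr//= -/(series _ n) [LHS](congr1 (+%R^~ _) IH).
rewrite uphalf_half; case: (odd n) => /=; first by rewrite mul0r addr0 add1n.
by rewrite mul1r add0n /series /= big_nat_recr.
Qed.

Lemma measurable_fun_prod_nat d d' (T : measurableType d) (T' : measurableType d')
    (f : nat -> T -> T') : (forall k, measurable_fun setT (f k)) ->
  measurable_fun setT (fun p : T * nat => f p.2 p.1).
Proof.
move=> mf _ Y mY; rewrite setTI.
have -> : (fun p : T * nat => f p.2 p.1) @^-1` Y = \bigcup_k (f k @^-1` Y `*` [set k]).
  apply/seteqP; split => [[x k] /= fY|[x k] [j _ [/= fY ->//]]].
  by exists k.
apply: bigcupT_measurable => k; apply: measurableX => //.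
by rewrite -[X in measurable X]setTI; exact: mf.
Qed.

Variables (kappa rho : R).
Hypotheses (kappa_gt0 : 0 < kappa) (rho_gt0 : 0 < rho).

Lemma measurable_pag_limit k :
  measurable_fun [set: R * R] (fun p => pag_limit kappa rho p.1 p.2 k).
Proof.
have mw j (g : R * R -> R) : measurable_fun setT g ->
    measurable_fun setT (fun p => poisson_weight j (g p)).
  move=> mg; apply: measurable_funM.
    by apply: measurableT_comp => //; exact: measurable_funN.
  by apply: measurable_funM => //; exact: measurable_funX.
have mF := measurable_gamma_cdf_inv kappa_gt0 rho_gt0.
have mZ1 : measurable_fun [set: R * R] (fun p => gamma_cdf_inv kappa rho p.1).
  exact: measurableT_comp mF measurable_fst.
have mZ2 : measurable_fun [set: R * R] (fun p => gamma_cdf_inv kappa rho p.2).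
  exact: measurableT_comp mF measurable_snd.
apply: measurable_fun_ifT.
- by apply: measurable_neg; exact: measurable_fun_eqr measurable_fst measurable_snd.
- by apply: mw; apply: measurable_funM => //; exact: measurable_funM.
- apply: measurable_funM => //.
  by apply: mw; apply: measurable_funM => //; exact: measurable_funM.
Qed.

Lemma multigraphon_pag_limit : multigraphon (pag_limit kappa rho).
Proof.
have Z0 x := gamma_cdf_inv_ge0 kappa_gt0 rho_gt0 x.
have w0 x y c : 0 < c -> 0 <= gamma_cdf_inv kappa rho x * gamma_cdf_inv kappa rho y / c.
  by move=> c0; rewrite divr_ge0 ?mulr_ge0// ltW.
have rho2 : 0 < 2 * rho by rewrite mulr_gt0.
split.
- exact: measurable_funTS (measurable_fun_prod_nat measurable_pag_limit).
- move=> x y k _ _; rewrite /pag_limit; case: ifP => _.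
    exact: poisson_weight_itv01 (w0 _ _ _ rho_gt0).
  case: (odd k); rewrite ?mul0r ?lexx ?ler01// mul1r.
  exact: poisson_weight_itv01 (w0 _ _ _ rho2).
- by move=> x y k _ _; rewrite /pag_limit eq_sym (mulrC (gamma_cdf_inv _ _ x)).
- move=> x y _ _; have [xy|xy] := boolP (x != y).
    have -> : pag_limit kappa rho x y = fun k => poisson_weight k
        (gamma_cdf_inv kappa rho x * gamma_cdf_inv kappa rho y / rho).
      by apply/funext => k; rewrite /pag_limit xy.
    exact: series_poisson_weight.
  have -> : series (pag_limit kappa rho x y) = (fun n => series (fun k => poisson_weight k
      (gamma_cdf_inv kappa rho x * gamma_cdf_inv kappa rho y / (2 * rho))) (uphalf n)).
    apply/funext => n; rewrite -series_even; congr (series _ n).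
    by apply/funext => k; rewrite /pag_limit (negbTE xy).
  apply: cvg_comp (series_poisson_weight _).
  move=> B [N _ NB]; exists N.*2 => // n /= Nn; apply: NB => /=.
  by rewrite -(doubleK N) uphalf_half (leq_trans (half_leq Nn))// leq_addl.
- by move=> x k _; rewrite /pag_limit eqxx /= mul2n odd_double mul0r.
Qed.
End multigraphon_pag_limit.

(** * Coincident coordinates form a null set *)

Section uniq_coordinates.
Context {R : realType}.
Local Notation rT := (measurableTypeR R).

Lemma measurable_mem (s : seq R) : measurable ([set x | x \in s] : set rT).
Proof.
apply: (@countable_measurable _ rT) => [t|]; first exact: measurable_set1.
by apply: finite_set_countable; apply/finite_seqP; exists s.
Qed.

Lemma unit_itv_measure_mem (s : seq R) : unit_itv_measure R [set x | x \in s] = 0%E.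
Proof.
have cs : countable [set x | x \in s] by apply: finite_set_countable; apply/finite_seqP; exists s.
have ms := measurable_mem s.
apply: (dominates_uniform_prob ltr01 _ ms (@subset_refl _ _)).
by apply/measure0_null_setP => //; exact: countable_lebesgue_measure0.
Qed.

Lemma measurable_not_uniq k : measurable [set t : k.-tuple rT | ~~ uniq t].
Proof.
have -> : [set t : k.-tuple rT | ~~ uniq t] =
    \bigcup_(p in [set p : 'I_k * 'I_k | p.1 != p.2]) [set t | tnth t p.1 == tnth t p.2].
  apply/seteqP; split => t /=.
    move=> /negP tu; apply: contrapT => nex; apply: tu; apply/tuple_uniqP => i j ij.
    apply/eqP; apply/negPn/negP => nij; apply: nex; exists (i, j) => //=; exact/eqP.
  move=> [[i j] /= /eqP ij /eqP tij]; apply/negP => /tuple_uniqP/(_ _ _ tij); exact: ij.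
apply: fin_bigcup_measurable; first exact: finite_finset.
move=> [i j] _; rewrite -[X in measurable X]setTI.
have := @measurable_fun_eqr _ (k.-tuple rT) R setT _ _ (measurable_tnth i) (measurable_tnth j).
by move=> /(_ measurableT [set true]); exact.
Qed.

(** Induction with the first coordinate integrated innermost: over a tuple without repetition only
    finitely many of its values are bad, and the other tuples are negligible by induction. *)
Lemma unit_cube_measure_not_uniq k :
  unit_cube_measure R k [set t : k.-tuple rT | ~~ uniq t] = 0%E.
Proof.
elim: k => [|k IH].
  rewrite (_ : [set _ | _] = set0) ?measure0//.
  by apply/seteqP; split => t //=; rewrite tuple0.
have mN := @measurable_not_uniq k.+1.
have mf : measurable_fun setT (fun t : k.+1.-tuple rT =>
    (\1_[set t : k.+1.-tuple rT | ~~ uniq t] t)%:E : \bar R).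
  by apply/measurable_EFinP; exact: measurable_indic.
have f0 t : (0 <= (\1_[set t : k.+1.-tuple rT | ~~ uniq t] t)%:E :> \bar R)%E by rewrite lee_fin.
rewrite -[X in unit_cube_measure _ _ X]setIT -integral_indic// [LHS]/= ge0_integral_distribution//.
have mg := measurableT_comp mf (@measurable_tuple_cons R k).
rewrite (fubini_tonelli2 _ mg (fun=> f0 _)); apply/eqP; rewrite eq_le; apply/andP; split; last first.
  by apply: integral_ge0 => t _; apply: integral_ge0 => x _; exact: f0.
rewrite -IH -[X in unit_cube_measure _ _ X]setIT -integral_indic//; last exact: measurable_not_uniq.
apply: ge0_le_integral => //.
- by move=> t _; apply: integral_ge0 => x _; exact: f0.
- exact: (measurable_fun_fubini_tonelli_G _ mg (fun=> f0 _)).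
- by apply/measurable_EFinP; apply: measurable_indic; exact: measurable_not_uniq.
move=> t _; rewrite [leRHS]/= indicE /fubini_G.
have [tu|tu] := boolP (uniq t).
  rewrite memNset /=; last by rewrite tu.
  rewrite [leRHS](_ : _ = unit_itv_measure R [set x | x \in val t]); last first.
    by rewrite unit_itv_measure_mem.
  rewrite -[X in unit_itv_measure _ X]setIT -integral_indic//; last first.
    exact: measurable_mem.
  rewrite le_eqVlt; apply/orP; left; apply/eqP; apply: eq_integral => x _ /=.
  rewrite !indicE; congr (nat_of_bool _)%:R%:E.
  by apply/idP/idP; rewrite !inE /= tu andbT negbK.
rewrite mem_set//= (@le_trans _ _ (\int[unit_itv_measure R]_x (cst 1 x))%E)//; last first.
  by rewrite integral_cst// mul1e probability_le1.
apply: ge0_le_integral => //.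
- apply: measurableT_comp mf _.
  by apply: (measurableT_comp (@measurable_tuple_cons R k)); exact: measurable_fun_pair.
- by move=> x _; rewrite lee_fin /= indicE lern1 leq_b1.
Qed.
End uniq_coordinates.

(** * The density of the limit multigraphon in closed form *)

Section density.
Context {R : realType}.
Variables (kappa rho : R).
Hypotheses (kappa_gt0 : 0 < kappa) (rho_gt0 : 0 < rho).
Variables (k : nat) (A : 'M[nat]_k).
Hypothesis Aadj : adjacency A.
Local Notation Z := (gamma_cdf_inv kappa rho).
Let e := num_edges A.

(** On slots, pairs and loops take the same form, with Poisson rate [multiplicity R p * (Z (x p.1) *
    Z (x p.2)) / (2 * rho)]; the exponentials then combine by [sqr_sum_slots]. Injectivity confines
    the loop clause of [pag_limit] to [i = j]. *)
Lemma prod_pag_limit (x : 'I_k -> R) : injective x ->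
  \prod_(i < k) \prod_(j < k | (i <= j)%N) pag_limit kappa rho (x i) (x j) (A i j) =
  edge_weight R A * (2 * rho)^-1 ^+ e *
  ((\prod_(i < k) Z (x i) ^+ degree A i) * expR (- ((\sum_i Z (x i)) ^+ 2 / (2 * rho)))).
Proof.
move=> x_inj; have [As Ae] := Aadj.
have rho0 := lt0r_neq0 rho_gt0.
have := slots_ofK Aadj; have a0 := @zero_above_slots_of _ A.
set a := slots_of A in a0 * => aE.
transitivity (\prod_(p | ~~ upper p) (multiplicity R p ^+ a p / (a p)`!%:R *
    (2 * rho)^-1 ^+ a p * (Z (x p.1) * Z (x p.2)) ^+ a p *
    expR (- (multiplicity R p * (Z (x p.1) * Z (x p.2)) / (2 * rho))))).
  rewrite pair_big_dep /= (reindex_inj (can_inj (@swap_pairK _ _)))/=.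
  apply: eq_big => [[i j]|[i j]]/=; first by rewrite /upper -leqNgt.
  rewrite leq_eqVlt /pag_limit /multiplicity /a /slots_of /= (inj_eq x_inj) => /orP[|ji].
    move=> /eqP/val_inj ->; rewrite ltnn eqxx /= Ae mul1r.
    rewrite /poisson_weight expr1n !mul1r; set z := Z (x i); set l := _./2.
    rewrite [LHS]mulrC; congr (_ * expR _).
    by rewrite exprMn; ring.
  rewrite ji As -[j == i]val_eqE -[i == j]val_eqE /= (ltn_eqF ji) (gtn_eqF ji) /poisson_weight.
  set z := Z (x i); set w := Z (x j); set l := A i j.
  have -> : w * z / rho = 2 * ((2 * rho)^-1 * (z * w)) by field.
  rewrite [LHS]mulrC 2!exprMn; congr (_ * expR _); first by ring.
  by ring.
rewrite !big_split /=.
have upperE (F : 'I_k * 'I_k -> R) : (forall p, upper p -> F p = 1) ->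
    \prod_(p | ~~ upper p) F p = \prod_p F p.
  by move=> F1; rewrite [RHS](bigID (@upper k))/= [X in _ = X * _]big1// mul1r.
have -> : \prod_(p | ~~ upper p)
    expR (- (multiplicity R p * (Z (x p.1) * Z (x p.2)) / (2 * rho))) =
    expR (- ((\sum_i Z (x i)) ^+ 2 / (2 * rho))).
  by rewrite -expR_sum sumrN -mulr_suml (sqr_sum_slots (fun i => Z (x i))).
rewrite !upperE; try by move=> p /a0 ->; rewrite ?expr0// invr1.
rewrite -big_split -edge_weight_slot_matrix// aE -expr_sum -num_edges_slot_matrix aE.
by rewrite -(prod_degree_slot_matrix a (fun i => Z (x i))) aE [RHS]mulrA.
Qed.

Let a := \sum_(i < k) (kappa + (degree A i)%:R).

(** All vertices are put in one group, so the other two shapes are 0, and the test function reads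
    the first coordinate only. *)
Lemma integral_density_integrand :
  (\int[unit_cube_measure R k]_t ((\prod_(i < k) Z (tnth t i) ^+ degree A i) *
     expR (- ((\sum_i Z (tnth t i)) ^+ 2 / (2 * rho))))%:E =
   (degree_moment kappa rho A)%:E *
   \int[gamma_probability a (kappa / rho)]_s (expR (- (s ^+ 2 / (2 * rho))))%:E)%E.
Proof.
pose h (p : R * R * R) := (expR (- (p.1.1 ^+ 2 / (2 * rho))))%:E.
have mh : measurable_fun setT h.
  apply/measurable_EFinP; apply: measurableT_comp => //; apply: measurable_funN.
  apply: measurable_funM => //; apply: measurable_funX.
  exact: measurableT_comp measurable_fst measurable_fst.
have h0 p : (0 <= h p)%E by rewrite lee_fin expR_ge0.
have -> : (\int[gamma_probability a (kappa / rho)]_s (expR (- (s ^+ 2 / (2 * rho))))%:E =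
    triple_mean kappa rho a 0 0 h)%E.
  have c1 (P : probability (measurableTypeR R) R) (c : \bar R) : (\int[P]_x c = c)%E.
    rewrite integral_cst// -[RHS]mule1; congr (_ * _)%E; exact: probability_setT.
  by rewrite /triple_mean /h /=; apply: eq_integral => x _; rewrite !c1.
have := cube_moments kappa_gt0 rho_gt0 (fun=> ord0) (degree A) mh h0.
rewrite -/(degree_moment kappa rho A) /= [X in triple_mean _ _ _ X _ _]big_pred0; last by [].
rewrite [X in triple_mean _ _ _ _ X _]big_pred0; last by [].
move=> <-.
by apply: eq_integral => t _; rewrite EFinM.
Qed.

Lemma multigraphon_densityE :
  multigraphon_density A (pag_limit kappa rho) = limit_density kappa rho A.
Proof.
rewrite /multigraphon_density /Rintegral.
pose f (t : k.-tuple (measurableTypeR R)) := edge_weight R A * (2 * rho)^-1 ^+ e *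
  ((\prod_(i < k) Z (tnth t i) ^+ degree A i) *
   expR (- ((\sum_i Z (tnth t i)) ^+ 2 / (2 * rho)))).
have mZ i : measurable_fun setT (fun t : k.-tuple (measurableTypeR R) => Z (tnth t i)).
  exact: measurableT_comp (measurable_gamma_cdf_inv kappa_gt0 rho_gt0) (measurable_tnth i).
have mI : measurable_fun setT (fun t : k.-tuple (measurableTypeR R) =>
    (\prod_(i < k) Z (tnth t i) ^+ degree A i) *
    expR (- ((\sum_i Z (tnth t i)) ^+ 2 / (2 * rho)))).
  apply: measurable_funM.
    by apply: measurable_prod => i _; exact: measurable_funX.
  apply: measurableT_comp => //; apply: measurable_funN.
  apply: measurable_funM => //; apply: measurable_funX.
  by apply: measurable_sum.
have mf : measurable_fun setT f by exact: measurable_funM.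
have mW : measurable_fun setT (fun t : k.-tuple (measurableTypeR R) =>
    \prod_(i < k) \prod_(j < k | (i <= j)%N)
      pag_limit kappa rho (tnth t i) (tnth t j) (A i j)).
  apply: measurable_prod => i _; under eq_fun do rewrite big_mkcond.
  apply: measurable_prod => j _; case: leqP => // _.
  exact: (measurableT_comp (measurable_pag_limit kappa_gt0 rho_gt0 (A i j))
    (measurable_fun_pair (measurable_tnth i) (measurable_tnth j))).
have Z0 p : 0 <= Z p by exact: gamma_cdf_inv_ge0.
have -> : (\int[unit_cube_measure R k]_t (\prod_(i < k) \prod_(j < k | (i <= j)%N)
      pag_limit kappa rho (tnth t i) (tnth t j) (A i j))%:E =
    \int[unit_cube_measure R k]_t (f t)%:E)%E.
  (* The closed form holds at tuples without repetition, hence almost everywhere. *)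
  apply: ae_eq_integral => //; [exact/measurable_EFinP|exact/measurable_EFinP|].
  exists [set t : k.-tuple (measurableTypeR R) | ~~ uniq t]; split.
  - exact: measurable_not_uniq.
  - exact: unit_cube_measure_not_uniq.
  - move=> t /= tf; apply/negP => tu; apply: tf => _; congr EFin.
    by apply: prod_pag_limit; exact/tuple_uniqP.
have C0 : 0 <= edge_weight R A * (2 * rho)^-1 ^+ e.
  apply: mulr_ge0; last by rewrite exprn_ge0// invr_ge0 mulr_ge0// ltW.
  by rewrite divr_ge0 ?exprn_ge0// mulr_ge0// prodr_ge0// => i _; rewrite prodr_ge0.
have mI' := (measurable_EFinP _ _).2 mI.
have I0 (t : k.-tuple (measurableTypeR R)) : setT t ->
    (0 <= (EFin \o (fun t : k.-tuple (measurableTypeR R) =>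
    ((\prod_(i < k) Z (tnth t i) ^+ degree A i) *
    expR (- ((\sum_i Z (tnth t i)) ^+ 2 / (2 * rho))))%R)) t)%E.
  by move=> _; rewrite lee_fin mulr_ge0 ?expR_ge0// prodr_ge0// => i _; rewrite exprn_ge0.
have C0' : (0 <= (edge_weight R A * (2 * rho)^-1 ^+ e)%:E)%E by rewrite lee_fin.
transitivity (fine ((edge_weight R A * (2 * rho)^-1 ^+ e)%:E *
  ((degree_moment kappa rho A)%:E * (gauss_mean kappa rho a)%:E))%E).
  congr fine; rewrite gauss_mean_fineK// -integral_density_integrand.
  rewrite -(ge0_integralZl _ measurableT mI' I0 C0').
  by apply: eq_integral => t _; rewrite /f EFinM.
by rewrite -!EFinM [LHS]/= mulrA [_ * degree_moment _ _ _]mulrAC.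
Qed.
End density.

(** * The second moment method *)

Section split_map.
Variables (k n : nat).

Definition left_map (Psi : {ffun 'I_(k + k) -> 'I_n}) : {ffun 'I_k -> 'I_n} :=
  [ffun i => Psi (lshift k i)].
Definition right_map (Psi : {ffun 'I_(k + k) -> 'I_n}) : {ffun 'I_k -> 'I_n} :=
  [ffun i => Psi (rshift k i)].
Definition join_map (p : {ffun 'I_k -> 'I_n} * {ffun 'I_k -> 'I_n}) : {ffun 'I_(k + k) -> 'I_n} :=
  [ffun i => match fintype.split i with inl j => p.1 j | inr j => p.2 j end].

Lemma join_mapK : cancel join_map (fun Psi => (left_map Psi, right_map Psi)).
Proof.
move=> [phi psi]; congr (_, _); apply/ffunP => i; rewrite !ffunE.
  by case: split_ordP => j /eqP; rewrite (eq_lshift, eq_lrshift)// => /eqP ->.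
by case: split_ordP => j /eqP; rewrite (eq_rshift, eq_rlshift)// => /eqP ->.
Qed.

Lemma split_mapK : cancel (fun Psi => (left_map Psi, right_map Psi)) join_map.
Proof.
move=> Psi; apply/ffunP => i; rewrite ffunE.
by case: split_ordP => j -> /=; rewrite ffunE.
Qed.

Lemma sum_pair_map (R : realType) (F : {ffun 'I_k -> 'I_n} -> {ffun 'I_k -> 'I_n} -> R) :
  \sum_phi \sum_psi F phi psi = \sum_Psi F (left_map Psi) (right_map Psi).
Proof.
rewrite pair_bigA /= (reindex (fun Psi => (left_map Psi, right_map Psi)))//=.
by exists join_map => p _; [exact: split_mapK|exact: join_mapK].
Qed.

Lemma block_event_double_mx (Psi : {ffun 'I_(k + k) -> 'I_n}) (A : 'M[nat]_k) (B : 'M[nat]_n) :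
  block_event (@second_half k) Psi (double_mx A) B =
  block_event (fun=> false) (left_map Psi) A B && block_event (fun=> false) (right_map Psi) A B.
Proof.
apply/idP/andP => [/forallP h|[/forallP hl /forallP hr]].
  split; apply/forallP => i; apply/forallP => j; rewrite !ffunE.
    by have /forallP /(_ (lshift k j)) := h (lshift k i); rewrite !second_halfE double_mxE.
  by have /forallP /(_ (rshift k j)) := h (rshift k i); rewrite !second_halfE double_mxE.
apply/forallP => i; apply/forallP => j.
case: (split_ordP i) => i' ->; case: (split_ordP j) => j' ->; rewrite !second_halfE //= double_mxE.
  by have /forallP /(_ j') := hl i'; rewrite !ffunE.
by have /forallP /(_ j') := hr i'; rewrite !ffunE.
Qed.

Lemma sum_injective (R : realType) : (0 < n)%N ->
  (n%:R ^+ (k + k))^-1 * \sum_(Psi : {ffun 'I_(k + k) -> 'I_n} | ~~ injectiveb Psi) 1 =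
  1 - (n ^_ (k + k))%:R / n%:R ^+ (k + k) :> R.
Proof.
move=> n0; have n0' : n%:R ^+ (k + k) != 0 :> R by rewrite expf_neq0// pnatr_eq0 -lt0n.
have -> : \sum_(Psi : {ffun 'I_(k + k) -> 'I_n} | ~~ injectiveb Psi) (1 : R) =
    n%:R ^+ (k + k) - (n ^_ (k + k))%:R.
  apply/eqP; rewrite eq_sym subr_eq; apply/eqP.
  have -> : n%:R ^+ (k + k) = \sum_(Psi : {ffun 'I_(k + k) -> 'I_n}) (1 : R).
    by rewrite sumr_const card_ffun !card_ord natrX.
  rewrite [LHS](bigID (fun Psi : {ffun 'I_(k + k) -> 'I_n} => injectiveb Psi))/= addrC.
  congr +%R; rewrite sumr_const.
  by have := card_inj_ffuns 'I_(k + k) 'I_n; rewrite !card_ord cardsE => ->.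
by field.
Qed.
End split_map.

(** * Expectations under the law of the graph *)

Section pag_law.
Context {R : realType}.
Variables (kappa : R) (n m : nat).

Definition pag_mean (g : 'M[nat]_n -> R) : R :=
  \sum_(a : {ffun 'I_n * 'I_n -> 'I_m.+1} | slot_counts a)
    pag_pmf kappa m (slot_matrix (fun p => a p)) * g (slot_matrix (fun p => a p)).

Lemma pag_mean_block_event N (grp : 'I_N -> bool) (Phi : 'I_N -> 'I_n) (A : 'M[nat]_N) :
  pag_mean (fun B => (block_event grp Phi A B)%:R) = block_prob kappa m grp Phi A.
Proof.
rewrite /pag_mean /block_prob [RHS]big_mkcondr; apply: eq_bigr => a _.
by case: ifP; rewrite ?mulr1 ?mulr0.
Qed.

Context d (Omega : measurableType d) (P : probability Omega R).
Variable X : {RV P >-> 'M[nat]_n}.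
Hypotheses (X_adj : forall w, adjacency_edges m (X w))
  (X_law : forall B : 'M[nat]_n, adjacency_edges m B ->
    P [set w | X w = B] = (pag_pmf kappa m B)%:E).

Let slot_adj (a : {ffun 'I_n * 'I_n -> 'I_m.+1}) : slot_counts a ->
  adjacency_edges m (slot_matrix (fun p => a p)).
Proof.
move=> /andP[/eqP sa _]; split; first exact: adjacency_slot_matrix.
by rewrite num_edges_slot_matrix.
Qed.

Let slot_pmf_ge0 (a : {ffun 'I_n * 'I_n -> 'I_m.+1}) : slot_counts a ->
  0 <= pag_pmf kappa m (slot_matrix (fun p => a p)).
Proof. by move=> sa; rewrite -lee_fin -X_law//; exact: slot_adj. Qed.

(** The event is cut into finitely many pieces, one per admissible family of counts; they are
    disjoint because the slots can be recovered from the matrix. *)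
Lemma pag_mean_law (D : pred 'M[nat]_n) :
  P [set w | D (X w)] = (pag_mean (fun B => (D B)%:R))%:E.
Proof.
pose S := [set a : {ffun 'I_n * 'I_n -> 'I_m.+1} | slot_counts a && D (slot_matrix (fun p => a p))].
have -> : [set w | D (X w)] = \bigcup_(a in S) [set w | X w = slot_matrix (fun p => a p)].
  apply/seteqP; split=> [w /= Dw|w [a /andP[_ Da] /= ->//]].
  have [adjX eX] := X_adj w.
  (* No slot exceeds the number of edges, so bounded counts reach every value of [X]. *)
  have lt_m p : (slots_of (X w) p < m.+1)%N.
    rewrite ltnS -eX -[in leqRHS](slots_ofK adjX) num_edges_slot_matrix (bigD1 p)//=.
    exact: leq_addr.
  pose a := [ffun p => Ordinal (lt_m p)] : {ffun 'I_n * 'I_n -> 'I_m.+1}.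
  have aE : slot_matrix (fun p => a p) = X w.
    by rewrite -[RHS](slots_ofK adjX); apply/matrixP => i j; rewrite !mxE !ffunE.
  exists a; last by rewrite /= aE.
  rewrite /S /= aE Dw andbT /slot_counts -num_edges_slot_matrix aE eX eqxx /=.
  by apply/'forall_implyP => p up; rewrite ffunE /= (zero_above_slots_of _ up).
rewrite measure_fin_bigcup; first last.
- move=> a _; rewrite -[X in measurable X]/(X @^-1` [set slot_matrix (fun p => a p)]).
  exact: measurable_funPTI.
- move=> a b /andP[/andP[_ /'forall_implyP a0] _] /andP[/andP[_ /'forall_implyP b0] _].
  move=> [w [/= -> ab]]; apply/ffunP => p; apply/val_inj => /=.
  rewrite -(@slot_matrixK _ (fun p => a p)) => [|q uq]; last by apply/eqP/a0.
  by rewrite ab slot_matrixK// => q uq; apply/eqP/b0.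
- exact: finite_finset.
rewrite -(@bigfs _ _ _ _ (index_enum _) (fun a => slot_counts a && D (slot_matrix (fun p => a p))));
  last 2 first.
- exact: index_enum_uniq.
- by move=> a _; rewrite mem_index_enum.
rewrite big_mkcondr /pag_mean -sumEFin; apply: eq_bigr => a sa.
case: ifP => _; last by rewrite mulr0.
by rewrite mulr1; apply: X_law; exact: slot_adj.
Qed.

Lemma le_pag_mean (g h : 'M[nat]_n -> R) : (forall B, g B <= h B) -> pag_mean g <= pag_mean h.
Proof. by move=> gh; apply: ler_sum => a sa; rewrite ler_wpM2l// slot_pmf_ge0. Qed.

Lemma pag_meanZ (c : R) (g : 'M[nat]_n -> R) : pag_mean (fun B => c * g B) = c * pag_mean g.
Proof. by rewrite /pag_mean mulr_sumr; apply: eq_bigr => a _; rewrite mulrCA. Qed.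

Lemma pag_meanD (g h : 'M[nat]_n -> R) :
  pag_mean (fun B => g B + h B) = pag_mean g + pag_mean h.
Proof. by rewrite /pag_mean -big_split; apply: eq_bigr => a _; rewrite mulrDr. Qed.

Lemma pag_mean_sum (I : finType) (g : I -> 'M[nat]_n -> R) :
  pag_mean (fun B => \sum_i g i B) = \sum_i pag_mean (g i).
Proof. by rewrite /pag_mean exchange_big; apply: eq_bigr => a _; rewrite mulr_sumr. Qed.

(** The total mass of the weights is read off from [P], as they are the probabilities of the values
    of [X]. *)
Lemma pag_mean_cst (c : R) : pag_mean (fun=> c) = c.
Proof.
have : pag_mean (fun=> 1) = 1.
  apply: EFin_inj; rewrite -(probability_setT P).
  by rewrite -(pag_mean_law xpredT); congr (P _); apply/seteqP.
by move=> m1; rewrite -[in LHS](mulr1 c) pag_meanZ m1 mulr1.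
Qed.

Lemma pag_mean_chebyshev (g : 'M[nat]_n -> R) (eps : R) : 0 < eps ->
  (P [set w | (eps < `|g (X w)|)%R] <= (pag_mean (fun B => g B ^+ 2) / eps ^+ 2)%:E)%E.
Proof.
move=> e0; rewrite (pag_mean_law (fun B => eps < `|g B|)) lee_fin mulrC -pag_meanZ.
apply: le_pag_mean => B; have e2 : 0 < eps ^+ 2 by rewrite exprn_gt0.
case: ltP => [eg|_] /=; last by rewrite mulr_ge0 ?sqr_ge0// invr_ge0 ltW.
by rewrite mulrC ler_pdivlMr// mul1r -[leRHS]real_normK ?num_real// lerXn2r ?nnegrE// ltW.
Qed.

(** The squared deviation is an average over maps on [k + k] vertices. Every injective one
    contributes the same amount, found by expanding a product of two centred indicators; the others
    are bounded by [(1 + |l|) ^+ 2] and weighted by their proportion. *)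
Lemma pag_mean_sqr_dev k (A : 'M[nat]_k) (l q1 q2 : R) : (0 < n)%N ->
  (forall Phi : 'I_k -> 'I_n, injective Phi ->
    block_prob kappa m (fun=> false) Phi A = q1) ->
  (forall Psi : 'I_(k + k) -> 'I_n, injective Psi ->
    block_prob kappa m (@second_half k) Psi (double_mx A) = q2) ->
  pag_mean (fun B => (hom_density R A B - l) ^+ 2) <=
  `|q2 - 2 * l * q1 + l ^+ 2| +
    (1 + `|l|) ^+ 2 * (1 - (n ^_ (k + k))%:R / n%:R ^+ (k + k)).
Proof.
move=> n0 q1E q2E; set c := n%:R ^+ (k + k).
have c0 : 0 < c by rewrite exprn_gt0// ltr0n.
pose one (phi : {ffun 'I_k -> 'I_n}) (B : 'M[nat]_n) : R := (block_event (fun=> false) phi A B)%:R.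
pose g (Psi : {ffun 'I_(k + k) -> 'I_n}) B :=
  (one (left_map Psi) B - l) * (one (right_map Psi) B - l).
have devE B : (hom_density R A B - l) ^+ 2 = c^-1 * \sum_Psi g Psi B.
  have -> : hom_density R A B - l = (n%:R ^+ k)^-1 * \sum_phi (one phi B - l).
    rewrite /hom_density sumrB mulrBr; congr (_ - _).
    rewrite sumr_const card_ffun !card_ord -[l *+ _]mulr_natl natrX mulrA mulVf ?mul1r//.
    by rewrite expf_neq0// pnatr_eq0 -lt0n.
  rewrite /g -(sum_pair_map (fun phi psi => (one phi B - l) * (one psi B - l))).
  rewrite exprMn exprVn -exprM muln2 -addnn expr2 mulr_suml.
  by under eq_bigr do rewrite mulr_sumr.
have -> : (fun B => (hom_density R A B - l) ^+ 2) = (fun B => c^-1 * \sum_Psi g Psi B).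
  exact/funext.
rewrite pag_meanZ pag_mean_sum (bigID (fun Psi : {ffun 'I_(k + k) -> 'I_n} => injectiveb Psi))/=.
rewrite mulrDr lerD//.
  rewrite mulrC ler_pdivrMr// (@le_trans _ _ (\sum_(Psi : {ffun 'I_(k + k) -> 'I_n})
      `|q2 - 2 * l * q1 + l ^+ 2|))//; last first.
    by rewrite sumr_const card_ffun !card_ord /c -natrX mulr_natr.
  rewrite [leLHS]big_mkcond; apply: ler_sum => Psi _; case: ifPn => // /injectiveP Psi_inj.
  have L_inj : injective (left_map Psi).
    by move=> i j; rewrite !ffunE => /Psi_inj/lshift_inj.
  have R_inj : injective (right_map Psi).
    by move=> i j; rewrite !ffunE => /Psi_inj/rshift_inj.
  have -> : g Psi = (fun B => (block_event (@second_half k) Psi (double_mx A) B)%:R +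
      (- l * one (left_map Psi) B + (- l * one (right_map Psi) B + l ^+ 2))).
    apply/funext => B; rewrite block_event_double_mx /g /one.
    by do 2 case: block_event => /=; ring.
  rewrite !pag_meanD !pag_meanZ !pag_mean_block_event pag_mean_cst q2E// !q1E//.
  by apply: le_trans (ler_norm _); rewrite le_eqVlt; apply/orP; left; apply/eqP; ring.
rewrite -sum_injective// mulrCA ler_wpM2l ?invr_ge0 ?(ltW c0)// mulr_sumr; apply: ler_sum => Psi _.
rewrite mulr1 -[leRHS]pag_mean_cst; apply: le_pag_mean => B; apply: le_trans (ler_norm _) _.
have one_le phi : `|one phi B - l| <= 1 + `|l|.
  rewrite (le_trans (ler_normB _ _))// lerD2r /one.
  by case: block_event; rewrite ?normr1 ?normr0.
by rewrite normrM expr2 ler_pM.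
Qed.
End pag_law.

Lemma ffact_ratio_cvg (R : realType) (k : nat) :
  (n ^_ k)%:R / n%:R ^+ k @[n --> \oo] --> (1 : R).
Proof.
elim: k => [|k IH].
  under eq_fun do rewrite ffactn0 expr0 divr1; exact: cvg_cst.
have h : (n - k)%N%:R / n%:R @[n --> \oo] --> (1 : R).
  have h1 : 1 - k%:R / n%:R @[n --> \oo] --> (1 : R).
    rewrite -[X in _ --> X]subr0; apply: cvgB; first exact: cvg_cst.
    rewrite -(mulr0 k%:R); apply: cvgM; first exact: cvg_cst.
    by rewrite -cvg_shiftS; exact: cvg_harmonic.
  apply: cvg_trans h1; apply: near_eq_cvg; near=> n.
  have n0 : n%:R != 0 :> R by rewrite pnatr_eq0 -lt0n; near: n; exists 1%N.
  have kn : (k <= n)%N by near: n; exists k.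
  by rewrite natrB//; field.
have -> : (fun n => (n ^_ k.+1)%:R / n%:R ^+ k.+1) =
    (fun n => ((n ^_ k)%:R / n%:R ^+ k) * ((n - k)%N%:R / n%:R)) :> (nat -> R).
  by apply/funext => n; rewrite ffactnSr natrM exprSr invfM; ring.
by rewrite -[X in _ --> X]mulr1; exact: cvgM.
Unshelve. all: by end_near. Qed.

Theorem theorem2 (R : realType) (kappa rho : R)
    (kappa_gt0 : 0 < kappa) (rho_gt0 : 0 < rho)
    (m : nat -> nat) (m_gt0 : forall n, (0 < n)%N -> (0 < m n)%N)
    (d : nat -> measure_display) (Omega : forall n, measurableType (d n))
    (P : forall n, probability (Omega n) R)
    (X : forall n, {RV (P n) >-> 'M[nat]_n})
    (X_adj : forall n, (0 < n)%N -> forall w, adjacency_edges (m n) (X n w))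
    (X_law : forall n, (0 < n)%N ->
       forall B : 'M[nat]_n, adjacency_edges (m n) B ->
       P n [set w | X n w = B] = (pag_pmf kappa (m n) B)%:E)
    (m_lim : (2 * m n)%:R / n%:R ^+ 2 @[n --> \oo] --> rho) :
  multigraphon (pag_limit kappa rho) /\
  cvg_to_multigraphon P X (pag_limit kappa rho).
Proof.
split; first exact: multigraphon_pag_limit.
move=> k A k_gt0 Aadj eps eps_gt0; rewrite multigraphon_densityE//.
have [q1 q1_cvg q1E] := single_block_limit kappa_gt0 rho_gt0 m_lim k_gt0 Aadj.
have [q2 q2_cvg q2E] := double_block_limit kappa_gt0 rho_gt0 m_lim k_gt0 Aadj.
set l := limit_density kappa rho A in q1_cvg q2_cvg *.
(* The first term vanishes in the limit since [q1] tends to [l] and [q2] to its square, the second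
   since the falling factorial is equivalent to the power. *)
pose bound n := (`|q2 n - 2 * l * q1 n + l ^+ 2| +
  (1 + `|l|) ^+ 2 * (1 - (n ^_ (k + k))%:R / n%:R ^+ (k + k))) / eps ^+ 2.
have bound_cvg : bound n @[n --> \oo] --> (0 : R).
  have -> : (0 : R) = (`|l ^+ 2 - 2 * l * l + l ^+ 2| + (1 + `|l|) ^+ 2 * (1 - 1)) / eps ^+ 2.
    by rewrite subrr mulr0 addr0 (_ : _ + _ = 0) ?normr0 ?mul0r//; ring.
  apply: cvgM; last exact: cvg_cst.
  apply: cvgD.
    apply: cvg_norm; apply: cvgD; last exact: cvg_cst.
    by apply: cvgB => //; apply: cvgM => //; exact: cvg_cst.
  apply: cvgM; first exact: cvg_cst.
  by apply: cvgB; [exact: cvg_cst|exact: ffact_ratio_cvg].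
apply: (@squeeze_cvge _ _ _ _ (fun=> 0%E) _ (EFin \o bound)).
- near=> n; rewrite measure_ge0 /=.
  have n0 : (0 < n)%N by near: n; exists 1%N.
  apply: le_trans (pag_mean_chebyshev (X_adj n n0) (X_law n n0)
    (fun B => hom_density R A B - l) eps_gt0) _.
  rewrite lee_fin ler_pM2r ?invr_gt0 ?exprn_gt0//.
  apply: (pag_mean_sqr_dev (X_adj n n0) (X_law n n0) l n0).
    by near: n.
  by near: n.
- exact: cvg_cst.
- by apply: cvg_EFin; [exact: nearW|exact: bound_cvg].
Unshelve. all: by end_near. Qed.
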